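(* Let $U$ and $Y$ be separable real Hilbert spaces, let $Q:U\to U$ be a bounded self-adjoint strictly positive operator (not necessarily of finite trace), and let $U_0=Q^{1/2}(U)$ with norm $\|u\|_{U_0}=\|Q^{-1/2}u\|_U$. Let $\{g_j\}_{j\ge1}$ be an orthonormal basis of $U_0$ and let $\{\beta_j\}_{j\ge 1}$ be independent standard real-valued Wiener processes with respect to a filtration $(\mathcal{F}_t)_{t\ge 0}$ on a probability space $(\Omega,\mathcal{F},P)$. Let $W_c(t)=\sum_{j=1}^\infty g_j\beta_j(t)$ be the associated Wiener process, where the series converges in $L^2(\Omega,\mathcal{F},P;U_1)$ for any Hilbert space $U_1$ such that $U$ is continuously embedded into $U_1$ and the embedding $U_0\to U_1$ is Hilbert--Schmidt. Let $T>0$. Then for every $\Phi\in N(Y)$ and every $t\in[0,T]$ the sequence $$Z_m=\sum_{j=1}^m\int_0^t\Phi(s)g_j\,d\beta_j(s),\qquad m\in\mathbb{N},$$ is a Cauchy sequence in $L^2(\Omega,\mathcal{F},P;Y)$. Hence the stochastic integral $$\int_0^t\Phi(s)\,dW_c(s):=\lim_{m\to\infty}\sum_{j=1}^m\int_0^t\Phi(s)g_j\,d\beta_j(s)\quad\text{in } L^2(\Omega,\mathcal{F},P;Y)$$ is well defined. Moreover, neither the class $N(Y)$ of integrands nor the integral depends on the choice of the space $U_1$.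
   Context: Strictly positive means $Q$ is non-negative and $Qx\neq0$ for $x\neq 0$. $L_2(U_0,Y)$ denotes the space of Hilbert--Schmidt operators from $U_0$ to $Y$ with norm $\|\psi\|_{L_2(U_0,Y)}^2=\sum_{j}\|\psi g_j\|_Y^2$. The class $N(Y)$ consists of all stochastic processes $\Phi:[0,T]\times\Omega\to L_2(U_0,Y)$ such that $E\int_0^T\|\Phi(t)\|_{L_2(U_0,Y)}^2\,dt<+\infty$ and such that for every $u\in U_0$ the $Y$-valued process $\Phi(t)u$ is measurable with respect to the filtration $(\mathcal{F}_t)$, i.e. jointly measurable in $(t,\omega)$ and adapted to $(\mathcal{F}_t)$. That $\beta_j$ is a Wiener process with respect to $(\mathcal{F}_t)$ means that it is a continuous $(\mathcal{F}_t)$-adapted standard Brownian motion, $\beta_j(0)=0$, whose increments $\beta_j(t)-\beta_j(s)$, $t\ge s$, are independent of $\mathcal{F}_s$. The integrals $\int_0^t\Phi(s)g_j\,d\beta_j(s)$ are the usual It\^o integrals of $Y$-valued square-integrable adapted processes with respect to the real Wiener process $\beta_j$. When $\mathrm{tr}\,Q=+\infty$, $W_c$ is called a cylindrical Wiener process in $U$. *)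

(* Defs.v *)
From HB Require Import structures.
From mathcomp Require Import all_boot all_order all_algebra.
From mathcomp Require Import all_classical all_reals all_analysis.

Set Implicit Arguments.
Unset Strict Implicit.
Unset Printing Implicit Defensive.

Import Order.TTheory GRing.Theory Num.Theory.
Import numFieldNormedType.Exports.

Local Open Scope classical_set_scope.
Local Open Scope ring_scope.

HB.mixin Record isHilbert (R : realType) V of CompleteNormedModule R V := {
  inner : V -> V -> R ;
  innerC : forall x y, inner x y = inner y x ;
  innerP : forall a x y z, inner (a *: x + y) z = a * inner x z + inner y z ;
  inner_norm : forall x, inner x x = `|x| ^+ 2
}.

#[short(type="hilbertType")]
HB.structure Definition Hilbert (R : realType) :=
  {V of CompleteNormedModule R V & isHilbert R V}.

Definition separable_space (T : topologicalType) :=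
  exists D : set T, countable D /\ dense D.

Section operators.
Context {R : realType} {U : hilbertType R}.

Definition self_adjoint (A : U -> U) :=
  forall x y, inner (A x) y = inner x (A y).

Definition nonneg_op (A : U -> U) := forall x, 0 <= inner (A x) x.

Definition strictly_positive (A : U -> U) :=
  nonneg_op A /\ forall x, x != 0 -> A x != 0.

(* These conditions characterize [Q^(1/2)] uniquely. *)
Definition is_op_sqrt (Q S : {linear U -> U}) :=
  [/\ continuous S, self_adjoint S, nonneg_op S & forall x, S (S x) = Q x].

End operators.

(* A Hilbert space continuously included in [V] is given by an injective linear
   map [K : H -> V]: its elements are those of [range K], and its norm is
   [|K^-1 v|_H].  With [K := Q^(1/2)] this is [U_0] as a subspace of [U]; with
   [K := iota \o Q^(1/2)], for an embedding [iota : U -> U_1], it is [U_0] as a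
   subspace of [U_1]. *)
Section image_space.
Context {R : realType} {H V : hilbertType R}.
Variable K : H -> V.

Definition im_inv : V -> H := 'pinv_(fun=> 0) [set: H] K.

Definition im_norm (v : V) : R := `|im_inv v|.

Definition im_inner (v v' : V) : R := inner (im_inv v) (im_inv v').

Definition im_basis (g : nat -> V) :=
  [/\ forall j, range K (g j),
      forall i j, im_inner (g i) (g j) = (i == j)%:R &
      forall v, range K v ->
        im_norm (v - \sum_(j < m) im_inner v (g j) *: g j) @[m --> \oo] --> 0].

(* Operators on the subspace are encoded by functions on [V]; their values
   outside [range K] are irrelevant. *)
Definition im_bounded_op (Y : hilbertType R) (psi : V -> Y) :=
  (forall a u v, range K u -> range K v ->
     psi (a *: u + v) = a *: psi u + psi v) /\
  exists C : R, forall v, range K v -> `|psi v| <= C * im_norm v.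

Definition hs_norm2 (Y : hilbertType R) (g : nat -> V) (psi : V -> Y) : \bar R :=
  (\sum_(0 <= j <oo) (`|psi (g j)| ^+ 2)%:E)%E.

Definition hilbert_schmidt (Y : hilbertType R) (g : nat -> V) (psi : V -> Y) :=
  im_bounded_op psi /\ (hs_norm2 g psi < +oo)%E.

End image_space.

(* Measurability, with respect to the sigma-algebra [G], of the restriction of
   [f] to [D], for the Borel sigma-algebra of [Y]. *)
Definition borel_wrt (X : Type) (Y : topologicalType) (G : set (set X))
    (D : set X) (f : X -> Y) :=
  forall O, open O -> G (D `&` f @^-1` O).

Section probability.
Context {R : realType} {d : measure_display} {Omega : measurableType d}.
Variable P : probability Omega R.

Definition is_filtration (F : R -> set (set Omega)) :=
  (forall t, 0 <= t -> sigma_algebra [set: Omega] (F t) /\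
                       F t `<=` measurable) /\
  (forall s t, 0 <= s -> s <= t -> F s `<=` F t).

(* Finite subfamilies are covered by taking [A j] to be the whole space for the
   other indices. *)
Definition independent_family (G : nat -> set (set Omega)) :=
  forall (n : nat) (A : nat -> set Omega), (forall j, G j (A j)) ->
    P (\bigcap_(j in `I_n) A j) = (\prod_(j < n) P (A j))%E.

Definition process_sigma_algebra (b : R -> Omega -> R) : set (set Omega) :=
  <<s [set A | exists t (B : set R),
         [/\ 0 <= t, measurable B & A = b t @^-1` B]] >>.

Definition independent_processes (b : nat -> R -> Omega -> R) :=
  independent_family (fun j => process_sigma_algebra (b j)).

Definition is_wiener (F : R -> set (set Omega)) (b : R -> Omega -> R) :=
  [/\ {ae P, forall w, b 0 w = 0},
      {ae P, forall w, {within `[0, +oo[, continuous (b ^~ w)}},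
      forall t, 0 <= t -> borel_wrt (F t) setT (b t),
      forall s t (B : set R), 0 <= s -> s < t -> measurable B ->
        P [set w | B (b t w - b s w)] = normal_prob 0 (Num.sqrt (t - s)) B &
      forall s t (A : set Omega) (B : set R), 0 <= s -> s <= t ->
        F s A -> measurable B ->
        P (A `&` [set w | B (b t w - b s w)]) =
          (P A * P [set w | B (b t w - b s w)%R])%E].

Section hilbert_valued.
Context {Y : hilbertType R}.

Definition L2norm (X : Omega -> Y) : \bar R :=
  'N[P]_2%:E[EFin \o (fun w => `|X w|%R)]%E.

Definition in_L2 (X : Omega -> Y) :=
  borel_wrt measurable setT X /\ (L2norm X < +oo)%E.

Definition L2_cauchy (Z : nat -> Omega -> Y) :=
  (forall m, in_L2 (Z m)) /\
  forall e : R, 0 < e -> exists N, forall m n, (N <= m)%N -> (N <= n)%N ->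
    (L2norm (fun w => Z m w - Z n w)%R < e%:E)%E.

Definition L2_cvg (Z : nat -> Omega -> Y) (X : Omega -> Y) :=
  [/\ forall m, in_L2 (Z m), in_L2 X &
      L2norm (fun w => Z m w - X w) @[m --> \oo] --> 0%E].

Definition ae_the (S : set (Omega -> Y)) (X : Omega -> Y) :=
  S X /\ forall X', S X' -> X' = X %[ae P].

(* "Measurable with respect to the filtration" on [[0, t]]: jointly measurable
   in time and chance, and adapted. *)
Definition measurable_adapted (F : R -> set (set Omega)) (t : R)
    (f : R -> Omega -> Y) :=
  borel_wrt (@measurable _ (measurableTypeR R * Omega)%type)
            (`[0, t] `*` setT) (fun p => f p.1 p.2) /\
  forall s, 0 <= s <= t -> borel_wrt (F s) setT (f s).

Definition E_int (t : R) (h : R -> Omega -> \bar R) : \bar R :=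
  (\int[P]_w \int[lebesgue_measure]_(s in `[0%R, t]) h s w)%E.

Definition ito_integrand (F : R -> set (set Omega)) (t : R)
    (f : R -> Omega -> Y) :=
  measurable_adapted F t f /\
  (E_int t (fun s w => (`|f s w| ^+ 2)%:E) < +oo)%E.

(* The simple process equal to [sp_coef i] on [] sp_time i, sp_time i.+1 ]] for
   [i < sp_size], and to [0] elsewhere. *)
Record simple_process := SimpleProcess {
  sp_size : nat ;
  sp_time : nat -> R ;
  sp_coef : nat -> Omega -> Y
}.

Definition simple_on (F : R -> set (set Omega)) (t : R) (p : simple_process) :=
  [/\ 0 <= sp_time p 0%N, sp_time p (sp_size p) <= t,
      forall i, (i < sp_size p)%N -> sp_time p i <= sp_time p i.+1,
      forall i, (i < sp_size p)%N ->
        borel_wrt (F (sp_time p i)) setT (sp_coef p i) &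
      exists M : R, forall i w, (i < sp_size p)%N -> `|sp_coef p i w| <= M].

Definition simple_val (p : simple_process) (s : R) (w : Omega) : Y :=
  \sum_(i < sp_size p) \1_(`]sp_time p i, sp_time p i.+1]) s *: sp_coef p i w.

Definition simple_integral (b : R -> Omega -> R) (p : simple_process)
    (w : Omega) : Y :=
  \sum_(i < sp_size p)
    (b (sp_time p i.+1) w - b (sp_time p i) w) *: sp_coef p i w.

(* [I] is a version of the Ito integral of [f] over [[0, t]]: the limit in
   [L^2] of the integrals of simple processes approximating [f] in
   [L^2([0, t] x Omega)]. *)
Definition is_ito_integral (F : R -> set (set Omega)) (b : R -> Omega -> R)
    (t : R) (f : R -> Omega -> Y) (I : Omega -> Y) :=
  ito_integrand F t f /\
  exists p : nat -> simple_process,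
    [/\ forall n, simple_on F t (p n),
        E_int t (fun s w => (`|f s w - simple_val (p n) s w| ^+ 2)%:E)
          @[n --> \oo] --> 0%E &
        L2_cvg (fun n => simple_integral b (p n)) I].

Definition ito_integral (F : R -> set (set Omega)) (b : R -> Omega -> R)
    (t : R) (f : R -> Omega -> Y) : Omega -> Y :=
  xget (cst 0) (is_ito_integral F b t f).

End hilbert_valued.

Section stochastic_integral.
Context {H V Y : hilbertType R}.
Variables (K : H -> V) (g : nat -> V).
Variables (F : R -> set (set Omega)) (b : nat -> R -> Omega -> R).

(* The class [N(Y)], for the subspace [range K] of [V] with orthonormal
   basis [g]. *)
Definition N_class (T : R) (Phi : R -> Omega -> V -> Y) :=
  [/\ forall s w, 0 <= s <= T -> hilbert_schmidt K g (Phi s w),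
      (E_int T (fun s w => hs_norm2 g (Phi s w)) < +oo)%E &
      forall u, range K u -> measurable_adapted F T (fun s w => Phi s w u)].

Definition ito_partial_sum (t : R) (Phi : R -> Omega -> V -> Y) (m : nat)
    (w : Omega) : Y :=
  \sum_(j < m) ito_integral F (b j) t (fun s w' => Phi s w' (g j)) w.

Definition stoch_integral (t : R) (Phi : R -> Omega -> V -> Y) : Omega -> Y :=
  xget (cst 0) (L2_cvg (ito_partial_sum t Phi)).

Definition wiener_partial_sum (t : R) (m : nat) (w : Omega) : V :=
  \sum_(j < m) b j t w *: g j.

End stochastic_integral.

End probability.

(* Main.v *)
Require Import Defs.
From HB Require Import structures.
From mathcomp Require Import all_boot all_order all_algebra.
From mathcomp Require Import all_classical all_reals all_analysis.
From mathcomp Require Import measurable_realfun.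
From mathcomp Require Import ring lra.

(** The integrals of [Phi g_j] against the processes [beta_j] are orthogonal in
    [L2(Omega; Y)], and the second moment of the [j]-th one is controlled by the
    mean of the time integral of [|Phi g_j| ^ 2]. These means form a convergent
    series, whose sum is the mean of the time integral of the squared
    Hilbert-Schmidt norm. Hence the partial sums are Cauchy, and they converge by
    the Riesz-Fischer theorem ([L2_complete]) for functions with values in [Y].

    Orthogonality is the fact that the bracket of two independent Wiener
    processes of a common filtration vanishes ([covariation_indep]): along a
    partition of mesh [h] into [n] intervals, the sum of the products of the two
    increments has second moment [n * h ^ 2], which tends to [0] when [n * h] is
    fixed. With this, the inner product of two increments with coefficients known
    at the start is the measure of the overlap of the two time intervals times
    the mean of the inner product of the coefficients, for one process, and [0]
    for two independent ones ([incrM_overlap]). Summation gives the Ito isometry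
    for simple processes ([simple_isometryB]) and the orthogonality
    ([simple_isometry_sum]).

    The Ito integral of a general integrand is obtained from the density of the
    simple processes among the measurable adapted square-integrable ones
    ([simple_approx]). A truncation reduces this to a bounded process, which is
    sampled at one point of each cell of a uniform partition. The points are
    chosen where the mean error does not exceed its average over the cell
    ([sampling_points]); these averages tend to [0] because almost every time is
    a Lebesgue point of each path ([sliding_gap_cvg0]). The existence
    and the uniqueness of the Ito integral ([ito_integralP]) and the bound for
    sums of orthogonal integrals ([ito_sum_le]) then follow by passing to the
    limit.

    The Wiener series is another sum of orthogonal terms, whose second moments
    are [t * |iota g_j| ^ 2] ([wiener_sum_sqn], [wiener_series_cvg]). Finally
    [Q ^ (1/2)] is injective because [Q] is strictly positive, and so is its
    composite with an embedding [iota] of [U] into [U_1]. The norm and the basis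
    of [U_0] are therefore the same in [U] and in [U_1], and so are the class of
    integrands ([N_class_embedding]) and the integrals
    ([stoch_integral_embedding]). *)

Set Implicit Arguments.
Unset Strict Implicit.
Unset Printing Implicit Defensive.

Import Order.TTheory GRing.Theory Num.Theory.
Import numFieldNormedType.Exports.

Local Open Scope classical_set_scope.
Local Open Scope ring_scope.

(** * Algebra of inner products *)

Section hilbert_algebra.
Context {R : realType} {Y : hilbertType R}.
Implicit Types (x y z : Y) (a : R).

Lemma innerDl x y z : inner (x + y) z = inner x z + inner y z.
Proof. by rewrite -{1}(scale1r x) innerP mul1r. Qed.

Lemma inner0l z : inner 0 z = 0 :> R.
Proof. by apply: (addrI (inner 0 z)); rewrite -innerDl !addr0. Qed.

Lemma innerZl a x z : inner (a *: x) z = a * inner x z.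
Proof. by rewrite -(addr0 (a *: x)) innerP inner0l addr0. Qed.

Lemma innerNl x z : inner (- x) z = - inner x z.
Proof. by rewrite -scaleN1r innerZl mulN1r. Qed.

Lemma innerDr x y z : inner z (x + y) = inner z x + inner z y.
Proof. by rewrite ![inner z _]innerC innerDl. Qed.

Lemma innerZr a x z : inner z (a *: x) = a * inner z x.
Proof. by rewrite ![inner z _]innerC innerZl. Qed.

Lemma innerNr x z : inner z (- x) = - inner z x.
Proof. by rewrite ![inner z _]innerC innerNl. Qed.

Lemma inner_suml (I : Type) (r : seq I) (p : I -> Y) z :
  inner (\sum_(i <- r) p i) z = \sum_(i <- r) inner (p i) z.
Proof.
by elim/big_rec2: _ => [|i u v _ <-]; rewrite ?inner0l// innerDl.
Qed.

Lemma inner_sumr (I : Type) (r : seq I) (p : I -> Y) z :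
  inner z (\sum_(i <- r) p i) = \sum_(i <- r) inner z (p i).
Proof.
by rewrite innerC inner_suml; apply: eq_bigr => i _; rewrite innerC.
Qed.

Lemma sqr_normD x y : `|x + y| ^+ 2 = `|x| ^+ 2 + 2 * inner x y + `|y| ^+ 2.
Proof. by rewrite -!inner_norm innerDl !innerDr (innerC y x); ring. Qed.

Lemma sqr_norm_sum (I : Type) (r : seq I) (p : I -> Y) :
  `|\sum_(i <- r) p i| ^+ 2 = \sum_(i <- r) \sum_(j <- r) inner (p i) (p j).
Proof.
by rewrite -inner_norm inner_suml; apply: eq_bigr => i _; rewrite inner_sumr.
Qed.

Lemma polarization x y : inner x y = 4^-1 * (`|x + y| ^+ 2 - `|x - y| ^+ 2).
Proof. by rewrite !sqr_normD innerNr normrN; field. Qed.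

Lemma inner_le x y : `|inner x y| <= 2^-1 * (`|x| ^+ 2 + `|y| ^+ 2).
Proof.
have := sqr_ge0 `|x + y|; have := sqr_ge0 `|x - y|.
by rewrite !sqr_normD innerNr normrN ler_norml; lra.
Qed.

Lemma sqr_normD_le x y : `|x + y| ^+ 2 <= 2 * `|x| ^+ 2 + 2 * `|y| ^+ 2.
Proof.
by have := sqr_ge0 `|x - y|; rewrite !sqr_normD innerNr normrN; lra.
Qed.

Lemma sqr_normB_le x y : `|x - y| ^+ 2 <= 2 * `|x| ^+ 2 + 2 * `|y| ^+ 2.
Proof. by rewrite -(normrN y) sqr_normD_le. Qed.

End hilbert_algebra.

(** * Borel maps into separable spaces *)

Section borel.
Context {R : realType} {d : measure_display} {X : measurableType d}.
Local Notation borel := (borel_wrt (@measurable d X)).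

Lemma countable_bigcup_measurable (I : Type) (D : set I) (A : I -> set X) :
  countable D -> (forall i, D i -> measurable (A i)) ->
  measurable (\bigcup_(i in D) A i).
Proof.
move=> /pfcard_geP[->|[f]] mA; first by rewrite bigcup_set0.
have -> : \bigcup_(i in D) A i = \bigcup_n A (f n).
  rewrite eqEsubset; split=> [x [i Di Aix]|x [n _ Ax]]; last first.
    by exists (f n) => //; exact: funS.
  by have [n _ ni] := 'surj_f Di; exists n => //; rewrite /= ni.
by apply: bigcupT_measurable => n; apply: mA; exact: funS.
Qed.

Lemma separable_second_countable (V : normedModType R) :
  separable_space V -> @second_countable V.
Proof.
move=> [D [cD dD]].
exists ((fun p : V * nat => ball p.1 p.2.+1%:R^-1) @` (D `*` setT)).
  by apply: card_le_trans (card_image_le _ _) _; exact: countableX.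
split=> [_ [p _ <-]|x]; first exact: ball_open.
move=> A /nbhs_ballP[e /= e0 xA].
have [n ne] : exists n, n.+1%:R^-1 < e / 2.
  have /cvgrPdist_lt/(_ (e / 2)) := @cvg_harmonic R.
  case; first exact: divr_gt0.
  move=> n _ Hn; exists n; have := Hn n (leqnn n).
  by rewrite sub0r normrN ger0_norm ?invr_ge0.
have [||y [xy Dy]] := dD (ball x n.+1%:R^-1).
- by exists x; exact: ballxx.
- exact: ball_open.
exists (ball y n.+1%:R^-1) => /=.
  by split; [exists (y, n)|exact: ball_sym].
move=> z yz; apply: xA; rewrite [e]splitr.
by apply: ball_triangle (le_ball (ltW ne) xy) (le_ball (ltW ne) yz).
Qed.

Lemma borel_cont (A B : topologicalType) (D : set X) (f : X -> A) (h : A -> B) :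
  continuous h -> borel D f -> borel D (h \o f).
Proof.
by move=> ch mf O oO; rewrite comp_preimage; apply: mf; move/continuousP: ch; exact.
Qed.

(** The rectangles of a countable basis generate the topology of the product,
    so that a preimage by a pair is a countable union of intersections. *)
Lemma borel_pair (A B C : topologicalType) (D : set X) (f : X -> A) (g : X -> B)
    (h : A * B -> C) :
  @second_countable A -> @second_countable B -> continuous h ->
  borel D f -> borel D g -> borel D (fun x => h (f x, g x)).
Proof.
move=> [U cU [oU bU]] [V cV [oV bV]] /continuousP ch mf mg O oO.
pose S := (U `*` V) `&` [set p | p.1 `*` p.2 `<=` h @^-1` O].
have -> : D `&` (fun x => h (f x, g x)) @^-1` O =
    \bigcup_(p in S) ((D `&` f @^-1` p.1) `&` (D `&` g @^-1` p.2)).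
  apply/seteqP; split=> [x [Dx Ox]|x [p [_ pO] [[Dx fx] [_ gx]]]]; last first.
    by split => //; exact: (pO (f x, g x)).
  have : nbhs (f x, g x) (h @^-1` O) by apply: open_nbhs_nbhs; split => //; exact: ch.
  move=> [[A1 B1]] /= [/bU[A2 [UA2 A2x] A21] /bV[B2 [VB2 B2x] B21]] AB.
  exists (A2, B2); last by do 2 split.
  by split => // -[u v] [/= ? ?]; apply: AB; split; [exact: A21|exact: B21].
apply: countable_bigcup_measurable => [|p [[Up Vp] _]].
  - apply: sub_countable (countableX cU cV); apply: subset_card_le.
    exact: subIsetl.
  - by apply: measurableI; [apply: mf; exact: oU|apply: mg; exact: oV].
Qed.

Lemma borel_measurable_fun (D : set X) (f : X -> R) :
  borel D f -> measurable_fun D f.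
Proof.
move=> mf; apply: (measurability _ (RGenOpens.measurableE R)).
move=> _ [_ [a [b ->]] <-].
by apply: mf; exact: interval_open.
Qed.

Lemma measurable_fun_borel (D : set X) (f : X -> R) :
  measurable D -> measurable_fun D f -> borel D f.
Proof. by move=> mD mf O oO; apply: mf => //; exact: open_measurable. Qed.

(** An open set is the union of the open sets [V k] obtained by shrinking it by
    [1 / k]; the limit lies in it iff the sequence is eventually in some [V k]. *)
Lemma borel_lim (V : normedModType R) (f_ : nat -> X -> V) (f : X -> V) :
  (forall n, borel setT (f_ n)) -> (forall x, f_ n x @[n --> \oo] --> f x) ->
  borel setT f.
Proof.
move=> mf cf O oO.
pose e k : R := k.+1%:R^-1.
have e0 k : 0 < e k by rewrite invr_gt0.
pose A k := \bigcup_(z in [set z : V | ball z (e k + e k) `<=` O]) ball z (e k).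
have -> : setT `&` f @^-1` O =
    \bigcup_k \bigcup_N \bigcap_(n in [set n | (N <= n)%N]) (setT `&` f_ n @^-1` A k).
  rewrite setTI eqEsubset; split=> [x Ox|x [k _ [N _ H]]].
    have /nbhs_ballP[r /= r0 rO] : nbhs (f x) O by apply: open_nbhs_nbhs.
    have [k kr] : exists k, e k < r / 2.
      have /cvgrPdist_lt/(_ (r / 2)) := @cvg_harmonic R.
      case; first exact: divr_gt0.
      move=> n _ Hn; exists n; have := Hn n (leqnn n).
      by rewrite sub0r normrN ger0_norm ?invr_ge0.
    have /cvgrPdist_lt/(_ _ (e0 k))[N _ HN] := cf x.
    exists k => //; exists N => // n /HN; split => //; exists (f x) => /=.
      by apply: subset_trans rO; apply: le_ball; lra.
    by rewrite -ball_normE.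
  have /cvgrPdist_lt/(_ _ (e0 k))[N' _ HN'] := cf x.
  have [_ [z zO zx]] := H (maxn N N') (leq_maxl _ _).
  apply: zO; apply: ball_triangle zx _; rewrite -ball_normE /= distrC.
  by apply: HN'; exact: leq_maxr.
apply: bigcupT_measurable => k; apply: bigcupT_measurable => N.
apply: bigcap_measurable => [|n _]; first by exists N => /=.
by apply: mf; apply: bigcup_open => z _; exact: ball_open.
Qed.

Lemma borel_cst (V : topologicalType) (D : set X) (c : V) :
  measurable D -> borel D (fun=> c).
Proof.
move=> mD O oO; rewrite (_ : _ @^-1` O = [set _ | O c])//.
by have [Oc|Oc] := pselect (O c);
  [rewrite (_ : [set _ | _] = setT) ?setIT//|
   rewrite (_ : [set _ | _] = set0) ?setI0//]; apply/seteqP; split.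
Qed.

Section separable_space.
Context {Y : hilbertType R} (sepY : separable_space Y).
Implicit Types (D : set X) (f g : X -> Y).

Let scY := separable_second_countable sepY.

Lemma borelD D f g : borel D f -> borel D g -> borel D (fun x => f x + g x).
Proof.
by apply: (borel_pair (h := fun p => p.1 + p.2)) => //; exact: add_continuous.
Qed.

Lemma borelN D f : borel D f -> borel D (fun x => - f x).
Proof. by apply: (borel_cont (h := -%R)); exact: opp_continuous. Qed.

Lemma borelB D f g : borel D f -> borel D g -> borel D (fun x => f x - g x).
Proof. by move=> mf mg; apply: borelD => //; exact: borelN. Qed.

Lemma borelZ D (r : X -> R) f : measurable D ->
  measurable_fun D r -> borel D f -> borel D (fun x => r x *: f x).
Proof.
move=> mD /(measurable_fun_borel mD).
apply: (borel_pair (A := R^o) (h := fun p => p.1 *: p.2)) => //.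
  apply: separable_second_countable; exists (@ratr R @` setT); split.
    by apply: card_le_trans (card_image_le _ _) _; exact: countableP.
  exact: dense_rat.
exact: scale_continuous.
Qed.

Lemma borel_sum D (I : Type) (r : seq I) (f_ : I -> X -> Y) : measurable D ->
  (forall i, borel D (f_ i)) -> borel D (fun x => \sum_(i <- r) f_ i x).
Proof.
move=> mD mf; elim: r => [|i r ih].
  by under eq_fun do rewrite big_nil; exact: borel_cst.
by under eq_fun do rewrite big_cons; exact: borelD.
Qed.

Lemma borel_norm D f : borel D f -> measurable_fun D (fun x => `|f x|).
Proof.
move=> mf; apply: borel_measurable_fun.
by apply: (borel_cont (h := fun y : Y => (`|y| : R^o))) mf; exact: norm_continuous.
Qed.

Lemma borel_sqr_norm D f : borel D f -> measurable_fun D (fun x => `|f x| ^+ 2).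
Proof. by move=> mf; apply: measurable_funX; exact: borel_norm. Qed.

Lemma borel_inner D f g : borel D f -> borel D g ->
  measurable_fun D (fun x => inner (f x) (g x)).
Proof.
move=> mf mg; under eq_fun do rewrite polarization.
apply: measurable_funM; first exact: measurable_cst.
by apply: measurable_funB; apply: borel_sqr_norm; [exact: borelD|exact: borelB].
Qed.

End separable_space.

End borel.

Section sub_sigma_algebra.
Context {R : realType} {d : measure_display} {X : measurableType d}.

Lemma borel_sub (V : topologicalType) (G H : set (set X)) D (f : X -> V) :
  G `<=` H -> borel_wrt G D f -> borel_wrt H D f.
Proof. by move=> GH mf O oO; exact/GH/mf. Qed.

Lemma borel_sigma_algebra (V : topologicalType) (G : set (set X)) D (f : X -> V) :
  sigma_algebra setT G ->
  borel_wrt (@measurable _ (g_sigma_algebraType G)) D f = borel_wrt G D f.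
Proof.
move=> sG; have -> // : @measurable _ (g_sigma_algebraType G) = G.
exact: sigma_algebra_id.
Qed.

End sub_sigma_algebra.

(** * Integrals of real functions *)

Section real_integrals.
Context {R : realType} {d : measure_display} {T : measurableType d}.
Variable mu : {measure set T -> \bar R}.
Implicit Types (f g : T -> R).

Definition rintegrable f := mu.-integrable setT (EFin \o f).

Lemma rintegrable_meas f : rintegrable f -> measurable_fun setT f.
Proof. by move=> /integrableP[/measurable_EFinP]. Qed.

Lemma rintegrableD f g : rintegrable f -> rintegrable g ->
  rintegrable (fun x => f x + g x).
Proof. by move=> If Ig; exact: (integrableD measurableT If Ig). Qed.

Lemma rintegrableB f g : rintegrable f -> rintegrable g ->
  rintegrable (fun x => f x - g x).
Proof. by move=> If Ig; exact: (integrableB measurableT If Ig). Qed.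

Lemma rintegrableZ k f : rintegrable f -> rintegrable (fun x => k * f x).
Proof. by move=> If; exact: (integrableZl measurableT k If). Qed.

Lemma rintegrable_sum (I : Type) (r : seq I) (f_ : I -> T -> R) :
  (forall i, rintegrable (f_ i)) -> rintegrable (fun x => \sum_(i <- r) f_ i x).
Proof.
move=> If; elim: r => [|i r ih].
  by under eq_fun do rewrite big_nil; exact: integrable0.
by under eq_fun do rewrite big_cons; exact: rintegrableD.
Qed.

Lemma rintegrable_le f g : measurable_fun setT f ->
  (forall x, `|f x| <= g x) -> rintegrable g -> rintegrable f.
Proof.
move=> mf fg; apply: le_integrable => //; first exact/measurable_EFinP.
by move=> x _ /=; rewrite lee_fin (le_trans (fg x)) ?ler_norm.
Qed.

Lemma rintegrable_ge0 f : measurable_fun setT f -> (forall x, 0 <= f x) ->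
  (\int[mu]_x (f x)%:E < +oo)%E -> rintegrable f.
Proof.
move=> mf f0 Hf; apply/integrableP; split; first exact/measurable_EFinP.
under eq_integral => x _ do rewrite /= ger0_norm ?f0//.
exact: Hf.
Qed.

Lemma rintegral_EFin f : rintegrable f ->
  (\int[mu]_x (f x)%:E)%E = (\int[mu]_x f x)%:E.
Proof. by move=> If; rewrite [RHS]fineK//; exact: (integrable_fin_num measurableT If). Qed.

Lemma rintegralD f g : rintegrable f -> rintegrable g ->
  \int[mu]_x (f x + g x) = \int[mu]_x f x + \int[mu]_x g x.
Proof. by move=> If Ig; rewrite RintegralD. Qed.

Lemma rintegralB f g : rintegrable f -> rintegrable g ->
  \int[mu]_x (f x - g x) = \int[mu]_x f x - \int[mu]_x g x.
Proof. by move=> If Ig; rewrite RintegralB. Qed.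

Lemma rintegralZ k f : rintegrable f ->
  \int[mu]_x (k * f x) = k * \int[mu]_x f x.
Proof. by move=> If; rewrite RintegralZl. Qed.

Lemma rintegral_sum (I : Type) (r : seq I) (f_ : I -> T -> R) :
  (forall i, rintegrable (f_ i)) ->
  \int[mu]_x (\sum_(i <- r) f_ i x) = \sum_(i <- r) \int[mu]_x f_ i x.
Proof.
move=> If; elim: r => [|i r ih].
  under eq_Rintegral do rewrite big_nil; rewrite big_nil.
  by rewrite /Rintegral integral0.
under eq_Rintegral do rewrite big_cons; rewrite big_cons -ih rintegralD//.
exact: rintegrable_sum.
Qed.

Lemma rintegral_le f g : rintegrable f -> rintegrable g ->
  (forall x, f x <= g x) -> \int[mu]_x f x <= \int[mu]_x g x.
Proof. by move=> If Ig fg; apply: le_Rintegral => // x _; exact: fg. Qed.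

End real_integrals.

Section real_expectations.
Context {R : realType} {d : measure_display} {T : measurableType d}.
Variable P : probability T R.

Lemma rintegrable_cst (c : R) : rintegrable P (fun=> c).
Proof. exact: finite_measure_integrable_cst. Qed.

Lemma rintegral_cst (c : R) : \int[P]_x c = c.
Proof.
have := @Rintegral_cst _ _ _ P _ measurableT c.
have /= -> := probability_setT P; by rewrite mulr1.
Qed.

End real_expectations.

(** * Moments of centred normal laws *)

Section normal_moments.
Context {R : realType}.
Implicit Types (m s : R).
Local Notation mu := (@lebesgue_measure R).

Import HBNNSimple.

(** The normal law is defined by the integrals of its density over measurable
    sets, so the formula holds for indicators; it extends to simple functions by
    linearity and to [f] by monotone convergence. *)
Lemma ge0_integral_normal_prob m s (f : R -> \bar R) :
  measurable_fun setT f -> (forall x, 0 <= f x)%E ->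
  (\int[normal_prob m s]_x f x = \int[mu]_x (f x * (normal_pdf m s x)%:E))%E.
Proof.
move=> mf f0; pose g := nnsfun_approx measurableT mf.
have mpdf : measurable_fun setT (fun x => (normal_pdf m s x)%:E).
  by apply/measurable_EFinP; exact: measurable_normal_pdf.
have pdf0 x : (0 <= (normal_pdf m s x)%:E)%E by rewrite lee_fin normal_pdf_ge0.
have indicE A : measurable A -> (\int[normal_prob m s]_x (\1_A x)%:E =
    \int[mu]_x ((\1_A x)%:E * (normal_pdf m s x)%:E))%E.
  move=> mA; rewrite integral_indic// setIT.
  transitivity (\int[mu]_(x in A) (normal_pdf m s x)%:E)%E => //.
  rewrite [LHS]integral_mkcond.
  by apply: eq_integral => x _; rewrite epatch_indic muleC.
have nnsfunE (h : {nnsfun R >-> R}) : (\int[normal_prob m s]_x (h x)%:E =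
    \int[mu]_x ((h x)%:E * (normal_pdf m s x)%:E))%E.
  have mh r : measurable (h @^-1` [set r]) by exact: measurable_funPTI.
  have mi r : measurable_fun setT (fun x => (r * \1_(h @^-1` [set r]) x)%:E).
    by apply/measurable_EFinP; apply: measurable_funM => //; exact: measurable_indic.
  under eq_integral do rewrite fimfunE -fsumEFin//.
  under [RHS]eq_integral.
    move=> x _; rewrite fimfunE -fsumEFin// ge0_mule_fsuml; last first.
      by move=> r; rewrite EFinM nnfun_muleindic_ge0.
    over.
  rewrite ge0_integral_fsum//; last first.
  - by move=> r x _; rewrite EFinM nnfun_muleindic_ge0.
  rewrite ge0_integral_fsum//; last 2 first.
  - move=> r; apply: emeasurable_funM; [exact: mi|exact: mpdf].
  - by move=> r x _; rewrite mule_ge0// EFinM nnfun_muleindic_ge0.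
  apply: eq_fsbigr => r /set_mem [y _ yr].
  have r0 : (0 <= r)%R by rewrite -yr; exact: fun_ge0.
  under eq_integral do rewrite EFinM.
  under [RHS]eq_integral do rewrite EFinM -muleA.
  have m1 : measurable_fun setT (fun x => (\1_(h @^-1` [set r]) x)%:E : \bar R).
    by apply/measurable_EFinP; exact: measurable_indic.
  rewrite [LHS]ge0_integralZl ?lee_fin// indicE//.
  rewrite [RHS]ge0_integralZl ?lee_fin// => [|x _]; last by rewrite mule_ge0.
    by apply: emeasurable_funM; [exact: m1|exact: mpdf].
  exact: mh.
have mg n : measurable_fun setT (fun x => (g n x)%:E).
  by apply/measurable_EFinP; exact: measurable_funP.
transitivity (limn (fun n => \int[normal_prob m s]_x (g n x)%:E)%E).
  rewrite -monotone_convergence//=.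
  - apply: eq_integral => x _; apply/esym/cvg_lim => //.
    exact: (cvg_nnsfun_approx measurableT mf).
  - by move=> n x _; rewrite lee_fin.
  - by move=> x _ a b ab; rewrite lee_fin; exact/lefP/(nd_nnsfun_approx measurableT mf).
rewrite (_ : (fun n => _) =
    (fun n => \int[mu]_x ((g n x)%:E * (normal_pdf m s x)%:E)))%E; last first.
  by apply/funext => n; exact: nnsfunE.
rewrite -monotone_convergence//=.
- apply: eq_integral => x _; apply/cvg_lim => //.
  by apply: cvgeZr => //; apply: (cvg_nnsfun_approx measurableT mf).
- by move=> n; apply: emeasurable_funM; [exact: mg|exact: mpdf].
- by move=> n x _; rewrite mule_ge0// lee_fin.
- move=> x _ a b ab; rewrite lee_wpmul2r// lee_fin.
  exact/lefP/(nd_nnsfun_approx measurableT mf).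
Qed.

(** Comparing the densities of [N(m, t)] and [N(0, s)] through
    [1 + y <= exp y], where the exponent is an affine function of [x] and
    [x ^+ 2], bounds the moments of [N(0, s)] from the total mass of [N(m, t)]. *)
Lemma normal_tilt s m t (h : R -> R) : 0 < s -> 0 < t ->
  (forall x, h x = x ^+ 2 / (s ^+ 2 *+ 2) - (x - m) ^+ 2 / (t ^+ 2 *+ 2)) ->
  (\int[normal_prob 0%R s]_x (expR (h x))%:E = (t / s)%:E)%E.
Proof.
move=> s0 t0 hE.
have mh : measurable_fun setT h.
  rewrite (funext hE).
  by apply: measurable_funB; apply: measurable_funM => //; apply: measurable_funX => //;
    exact: measurable_funB.
rewrite ge0_integral_normal_prob; last 2 first.
- by apply/measurable_EFinP; exact: measurableT_comp.
- by move=> x; rewrite lee_fin expR_ge0.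
have peakE u : 0 < u -> normal_peak u = u^-1 * (Num.sqrt (pi *+ 2))^-1.
  move=> u0; rewrite /normal_peak -mulrnAr sqrtrM ?sqr_ge0// sqrtr_sqr gtr0_norm//.
  by rewrite invfM.
under eq_integral => x _.
  have -> : ((expR (h x))%:E * (normal_pdf 0 s x)%:E =
      (t / s)%:E * (normal_pdf m t x)%:E)%E.
    rewrite -!EFinM !normal_pdfE ?gt_eqF// !peakE// hE; congr EFin.
    rewrite /normal_fun mulrCA -expRD subr0.
    rewrite [X in expR X](_ : _ = - (x - m) ^+ 2 / (t ^+ 2 *+ 2)); last by ring.
    have aux (a e : R) : s^-1 * a * e = t / s / t * a * e by field; rewrite !gt_eqF.
    by rewrite !mulrA; exact: aux.
  over.
rewrite ge0_integralZl//; first by rewrite integral_normal_pdf mule1.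
- by apply/measurable_EFinP; exact: measurable_normal_pdf.
- by move=> x _; rewrite lee_fin normal_pdf_ge0.
- by rewrite lee_fin divr_ge0// ltW.
Qed.

(** The tilt to [N(0, 2 * s)] has the exponent [c * x ^+ 2] with [c > 0], and
    [c * x ^+ 2 <= expR (c * x ^+ 2)]. *)
Lemma normal_var_fin s : 0 < s ->
  (\int[normal_prob 0%R s]_x (x ^+ 2)%:E < +oo)%E.
Proof.
move=> s0; pose c := 3 / (8 * s ^+ 2).
have c0 : 0 < c by rewrite divr_gt0// mulr_gt0// exprn_gt0.
have mX2 : measurable_fun setT (fun x : R => (x ^+ 2)%:E).
  by apply/measurable_EFinP; exact: measurable_funX.
apply: (@le_lt_trans _ _ (c^-1%:E * (2 * s / s)%:E)%E); last first.
  by rewrite -EFinM ltry.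
have mexp : measurable_fun setT (fun x : R => (expR (c * x ^+ 2))%:E).
  apply/measurable_EFinP; apply: measurableT_comp => //.
  by apply: measurable_funM => //; exact: measurable_funX.
rewrite -(@normal_tilt s 0 (2 * s) (fun x : R => c * x ^+ 2))//; last 2 first.
- by rewrite mulr_gt0.
- by move=> x; rewrite /c subr0; field; rewrite gt_eqF.
rewrite -ge0_integralZl ?lee_fin ?invr_ge0 ?(ltW c0)//.
apply: ge0_le_integral => //.
- by move=> x _; rewrite lee_fin sqr_ge0.
- by apply: emeasurable_funM.
- move=> x _; rewrite -EFinM lee_fin ler_pdivlMl//.
  by apply: le_trans (expR_ge1Dx _); rewrite lerDr.
Qed.

Lemma normal_sqr_integrable s : 0 < s ->
  rintegrable (normal_prob 0 s) (fun x : R => x ^+ 2).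
Proof.
move=> s0; apply: rintegrable_ge0; last exact: normal_var_fin.
- exact: measurable_funX.
- by move=> x; exact: sqr_ge0.
Qed.

Lemma normal_integrable s : 0 < s ->
  rintegrable (normal_prob 0 s) (fun x : R => x).
Proof.
move=> s0; apply: rintegrable_le; first exact: measurable_id; last first.
  exact: (rintegrableD (rintegrable_cst _ 1) (normal_sqr_integrable s0)).
move=> x; have -> : x ^+ 2 = `|x| ^+ 2 by rewrite real_normK// num_real.
by have := sqr_ge0 (`|x| - 1); nra.
Qed.

(** Let [e] be the mean. The tilt to [N(e, s)] has an affine exponent with mean
    [e ^+ 2 / (2 * s ^+ 2)], and its exponential has mean [1]; since
    [1 + h <= expR h], this forces [e ^+ 2 <= 0]. *)
Lemma normal_mean s : 0 < s -> \int[normal_prob 0 s]_x x = 0.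
Proof.
move=> s0; set e := Rintegral _ _ _.
have ix := normal_integrable s0.
pose h x : R := (s ^+ 2)^-1 * e * x - e ^+ 2 / (s ^+ 2 *+ 2).
have mexp : measurable_fun setT (fun x : R => expR (h x)).
  by apply: measurableT_comp => //; apply: measurable_funB => //; exact: measurable_funM.
have tilt : (\int[normal_prob 0%R s]_x (expR (h x))%:E = 1)%E.
  rewrite (@normal_tilt s e s h)// ?divff ?gt_eqF// => x; rewrite /h; field.
  by rewrite gt_eqF.
have ih : rintegrable (normal_prob 0 s) (fun x => expR (h x)).
  by apply: rintegrable_ge0 => //; rewrite tilt ltry.
pose c := 1 - e ^+ 2 / (s ^+ 2 *+ 2).
have ic := rintegrable_cst (normal_prob 0 s) c.
have icx := rintegrableZ ((s ^+ 2)^-1 * e) ix.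
have : \int[normal_prob 0 s]_x (c + (s ^+ 2)^-1 * e * x) <=
    \int[normal_prob 0 s]_x (expR (h x)).
  apply: rintegral_le => //; first by apply: rintegrableD.
  by move=> x; apply: le_trans (expR_ge1Dx _); rewrite /c /h; lra.
rewrite rintegralD// rintegralZ// -/e rintegral_cst.
rewrite [X in _ <= X]/Rintegral tilt /= /c => H.
have : (s ^+ 2)^-1 * e ^+ 2 <= 0.
  have -> : (s ^+ 2)^-1 * e ^+ 2 = 2 * (1 - e ^+ 2 / (s ^+ 2 *+ 2) + (s ^+ 2)^-1 * e * e - 1).
    by field; rewrite gt_eqF.
  lra.
rewrite pmulr_rle0 ?invr_gt0 ?exprn_gt0// => e0.
by apply/eqP; rewrite -sqrf_eq0 eq_le e0 sqr_ge0.
Qed.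

(** Let [k] be the ratio of the variance to [s ^+ 2]. The tilts to [N(0, u * s)],
    for all [u > 0], give [0 <= (u - 1) * (2 * u ^+ 2 - k * (u + 1))]. The second
    factor must have the sign of [u - 1] on both sides of [u = 1], so it vanishes
    there, which means [k = 1]. *)
Lemma normal_variance s : 0 < s -> \int[normal_prob 0 s]_x (x ^+ 2) = s ^+ 2.
Proof.
move=> s0; set v := Rintegral _ _ _.
have ix := normal_sqr_integrable s0.
pose k := v / s ^+ 2.
have s20 : 0 < s ^+ 2 by rewrite exprn_gt0.
have key u : 0 < u -> 1 - (u^-2 - 1) * k / 2 <= u.
  move=> u0; pose c := (1 - u^-2) / (s ^+ 2 *+ 2).
  pose h x : R := c * x ^+ 2.
  have mexp : measurable_fun setT (fun x : R => expR (h x)).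
    apply: measurableT_comp => //; apply: measurable_funM; first exact: measurable_cst.
    by apply: measurable_funX; exact: measurable_id.
  have tilt : (\int[normal_prob 0%R s]_x (expR (h x))%:E = u%:E)%E.
    rewrite (@normal_tilt s 0 (u * s) h)// ?mulr_gt0//.
      by rewrite mulfK// gt_eqF.
    by move=> x; rewrite /h /c; field; rewrite !gt_eqF.
  have ih : rintegrable (normal_prob 0 s) (fun x => expR (h x)).
    by apply: rintegrable_ge0 => //; rewrite tilt ltry.
  have i1 := rintegrable_cst (normal_prob 0 s) 1.
  have icx : rintegrable (normal_prob 0 s) h by exact: rintegrableZ.
  have : \int[normal_prob 0 s]_x (1 + h x) <= \int[normal_prob 0 s]_x (expR (h x)).
    apply: rintegral_le => //; first by apply: rintegrableD.
    by move=> x; exact: expR_ge1Dx.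
  rewrite rintegralD// rintegralZ// -/v rintegral_cst.
  rewrite [X in _ <= X]/Rintegral tilt /=.
  apply: le_trans; rewrite le_eqVlt; apply/orP; left; apply/eqP.
  by rewrite /c /k; field; rewrite !gt_eqF.
have key2 u : 0 < u -> 0 <= (u - 1) * (2 * u ^+ 2 - k * (u + 1)).
  move=> u0; have := key u u0.
  have -> : 1 - (u^-2 - 1) * k / 2 =
      u - (u - 1) * (2 * u ^+ 2 - k * (u + 1)) / (2 * u ^+ 2).
    by field; rewrite gt_eqF.
  by rewrite gerBl pmulr_lge0// invr_gt0 mulr_gt0// exprn_gt0.
(* If [k <> 1], the second factor has the wrong sign at [1 + e] or [1 - e] for
   [e] small compared with [|k - 1|]. *)
suff k1 : k = 1 by rewrite -[LHS](divfK (lt0r_neq0 s20)) -/k k1 mul1r.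
apply/eqP; rewrite eq_le; apply/andP; split; rewrite leNgt; apply/negP => k1.
- pose dl := k - 1; have dl0 : 0 < dl by rewrite subr_gt0.
  pose e := dl / (4 * (1 + dl)).
  have e0 : 0 < e by rewrite divr_gt0// mulr_gt0// addr_gt0.
  have eE : 4 * e * (1 + dl) = dl.
    by rewrite /e; field; rewrite gt_eqF// addr_gt0.
  have e4 : 4 * e <= 1 by nra.
  have := key2 (1 + e) (addr_gt0 ltr01 e0).
  rewrite addrAC subrr add0r pmulr_rge0// (_ : k = 1 + dl); last by rewrite /dl; lra.
  by nra.
- pose dl := 1 - k; have dl0 : 0 < dl by rewrite subr_gt0.
  have k0 : 0 <= k.
    apply: divr_ge0; last exact: ltW.
    by apply: Rintegral_ge0 => x _; exact: sqr_ge0.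
  pose e := dl / 4.
  have e0 : 0 < e by rewrite divr_gt0.
  have dlE : dl = 4 * e by rewrite /e; lra.
  have dl1 : dl <= 1 by rewrite /dl; lra.
  have := key2 (1 - e) ltac:(lra).
  rewrite addrAC subrr add0r nmulr_rge0 ?oppr_lt0// (_ : k = 1 - dl); last by rewrite /dl; lra.
  by nra.
Qed.

End normal_moments.

(** * Products of independent variables *)

Section independence.
Context {R : realType} {d : measure_display} {Omega : measurableType d}.
Variable P : probability Omega R.

(** The pair has the product of the two laws as its law, so that Fubini's
    theorem separates the variables. *)
Lemma rintegralM_indep (X Z : Omega -> R) :
  rintegrable P X -> rintegrable P Z ->
  (forall A B : set R, measurable A -> measurable B ->
    P (X @^-1` A `&` Z @^-1` B) = (P (X @^-1` A) * P (Z @^-1` B))%E) ->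
  rintegrable P (fun w => X w * Z w) /\
  \int[P]_w (X w * Z w) = \int[P]_w X w * \int[P]_w Z w.
Proof.
move=> iX iZ XZ; have mX := rintegrable_meas iX; have mZ := rintegrable_meas iZ.
pose X' : {mfun Omega >-> R} := HB.pack X (isMeasurableFun.Build _ _ _ _ X mX).
pose Z' : {mfun Omega >-> R} := HB.pack Z (isMeasurableFun.Build _ _ _ _ Z mZ).
pose XZf w := (X w, Z w).
have mXZ : measurable_fun setT XZf by exact: measurable_fun_pair.
pose W : {mfun Omega >-> (R * R)%type} :=
  HB.pack XZf (isMeasurableFun.Build _ _ _ _ XZf mXZ).
pose PX : probability R R := distribution P X'.
pose PZ : probability R R := distribution P Z'.
have nuE S : measurable S -> (PX \x PZ)%E S = distribution P W S.
  by move=> mS; apply: product_measure_unique => //= A B mA mB; exact: XZ.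
have mM : measurable_fun setT (fun p : R * R => p.1 * p.2) by exact: measurable_funM.
have distE (f : R * R -> \bar R) :
    (\int[PX \x PZ]_p f p = \int[distribution P W]_p f p)%E.
  by apply: eq_measure_integral => S mS _; exact: nuE.
have iPX : rintegrable PX (fun x => x).
  apply/integrableP; split; first by apply/measurable_EFinP; exact: measurable_id.
  rewrite ge0_integral_distribution//; first by case/integrableP : iX.
  by apply: measurableT_comp => //; apply/measurable_EFinP; exact: measurable_id.
have iPZ : rintegrable PZ (fun x => x).
  apply/integrableP; split; first by apply/measurable_EFinP; exact: measurable_id.
  rewrite ge0_integral_distribution//; first by case/integrableP : iZ.
  by apply: measurableT_comp => //; apply/measurable_EFinP; exact: measurable_id.
have mM' : measurable_fun setT (fun p : R * R => (p.1 * p.2)%:E).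
  exact/measurable_EFinP.
have absfin : (\int[PX \x PZ]_p (`|(p.1 * p.2)%:E|) < +oo)%E.
  rewrite (fubini_tonelli1 (fun p : R * R => `|(p.1 * p.2)%:E|%E))//; last first.
    exact: measurableT_comp.
  rewrite (eq_integral (fun x : R => `|x%:E| * \int[PZ]_z `|z%:E|)%E); last first.
    move=> x _; rewrite /fubini_F /=; under eq_integral do rewrite normrM EFinM.
    rewrite ge0_integralZl//.
    by apply: measurableT_comp => //; apply/measurable_EFinP; exact: measurable_id.
  have /integrableP[_ fX] := iPX; have /integrableP[_ fZ] := iPZ.
  rewrite ge0_integralZr//; last 2 first.
  - by apply: measurableT_comp => //; apply/measurable_EFinP; exact: measurable_id.
  - exact: integral_ge0.
  apply: lte_mul_pinfty => //; first exact: integral_ge0.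
  by rewrite ge0_fin_numE//; exact: integral_ge0.
have inu : (PX \x PZ)%E.-integrable setT (fun p : R * R => (p.1 * p.2)%:E).
  exact/integrableP.
have iXZ : rintegrable P (fun w => X w * Z w).
  apply/integrableP; split; first by apply/measurable_EFinP; exact: measurable_funM.
  move: absfin; rewrite distE ge0_integral_distribution//.
  exact: measurableT_comp.
split=> //; apply: EFin_inj; rewrite EFinM -!rintegral_EFin//.
transitivity (\int[PX \x PZ]_p (p.1 * p.2)%:E)%E.
  by rewrite distE integral_distribution.
rewrite -integral12_prod_meas1//.
have ZE : (\int[PZ]_z z%:E = (\int[P]_w Z w)%:E)%E.
  by rewrite -rintegral_EFin// integral_distribution.
rewrite (eq_integral (fun x : R => x%:E * (\int[P]_w Z w)%:E)%E); last first.
  move=> x _; rewrite /fubini_F /=; under eq_integral do rewrite EFinM.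
  by rewrite integralZl// ZE.
rewrite integralZr// (rintegral_EFin iZ); congr (_ * _)%E.
by rewrite integral_distribution.
Qed.

End independence.

(** * Increments of a Wiener process *)

Definition incr {R : realType} {Omega : Type} (b : R -> Omega -> R) s t w := b t w - b s w.

Section wiener_increments.
Context {R : realType} {d : measure_display} {Omega : measurableType d}.
Variables (P : probability Omega R) (F : R -> set (set Omega)).
Hypothesis Ffilt : is_filtration F.

Definition adapted_at (t : R) (X : Omega -> R) :=
  measurable_fun (setT : set (g_sigma_algebraType (F t))) X.

Lemma adapted_atE t X : 0 <= t -> borel_wrt (F t) setT X -> adapted_at t X.
Proof.
move=> t0 mX; apply: borel_measurable_fun.
by rewrite borel_sigma_algebra//; have [] := Ffilt.1 t t0.
Qed.

Lemma adapted_at_set t X B : 0 <= t -> adapted_at t X -> measurable B ->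
  F t (X @^-1` B).
Proof.
move=> t0 mX mB; have [sF _] := Ffilt.1 t t0.
by have := mX measurableT B mB; rewrite setTI /measurable /= sigma_algebra_id.
Qed.

Lemma adapted_at_meas t X : 0 <= t -> adapted_at t X -> measurable_fun setT X.
Proof.
move=> t0 mX _ B mB; rewrite setTI; have [_ sub] := Ffilt.1 t t0.
by apply: sub; exact: adapted_at_set.
Qed.

Lemma adapted_at_le s t X : 0 <= s -> s <= t -> adapted_at s X -> adapted_at t X.
Proof.
move=> s0 st mX _ B mB; rewrite setTI; apply: sub_sigma_algebra.
by apply: (Ffilt.2 _ _ s0 st); exact: adapted_at_set.
Qed.

Lemma adapted_atM t X Z : adapted_at t X -> adapted_at t Z ->
  adapted_at t (fun w => X w * Z w).
Proof. exact: measurable_funM. Qed.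

Lemma incr_split (b : R -> Omega -> R) s u t w : incr b s t w = incr b s u w + incr b u t w.
Proof. by rewrite /incr; ring. Qed.

Section one_process.
Variables (b : R -> Omega -> R).
Hypothesis bW : is_wiener P F b.

Lemma incr_adapted s t : 0 <= s -> s <= t -> adapted_at t (incr b s t).
Proof.
move=> s0 st; have [_ _ bF _ _] := bW; have t0 := le_trans s0 st.
apply: measurable_funB; first exact: adapted_atE (bF _ t0).
by apply: adapted_at_le (adapted_atE _ (bF _ s0)).
Qed.

Lemma incr_meas s t : 0 <= s -> s <= t -> measurable_fun setT (incr b s t).
Proof.
by move=> s0 st; apply: (@adapted_at_meas t); [exact: le_trans st|exact: incr_adapted].
Qed.

Lemma incr_law s t (f : R -> \bar R) : 0 <= s -> s < t ->
  measurable_fun setT f -> (forall x, 0 <= f x)%E ->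
  (\int[P]_w f (incr b s t w) = \int[normal_prob 0%R (Num.sqrt (t - s))]_x f x)%E.
Proof.
move=> s0 st mf f0; have mi := incr_meas s0 (ltW st).
pose X : {mfun Omega >-> measurableTypeR R} := HB.pack (incr b s t)
  (isMeasurableFun.Build _ _ Omega (measurableTypeR R) (incr b s t) mi).
transitivity (\int[distribution P X]_x f x)%E.
  by rewrite ge0_integral_distribution.
apply: (eq_measure_integral (normal_prob 0 (Num.sqrt (t - s)))) => B mB _.
by have [_ _ _ + _] := bW; apply.
Qed.

Let sqrtK (s t : R) : s < t ->
  (0 < Num.sqrt (t - s)) * (Num.sqrt (t - s) ^+ 2 = t - s).
Proof.
by move=> st; split; rewrite ?sqrtr_gt0 ?subr_gt0// sqr_sqrtr// subr_ge0 ltW.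
Qed.

Lemma incr_sqr s t : 0 <= s -> s <= t ->
  rintegrable P (fun w => incr b s t w ^+ 2) /\
  \int[P]_w (incr b s t w ^+ 2) = t - s.
Proof.
move=> s0; rewrite le_eqVlt => /orP[/eqP <-|st].
  rewrite (_ : (fun w => incr b s s w ^+ 2) = cst 0); last first.
    by apply/funext => w; rewrite /incr subrr expr0n.
  by rewrite subrr rintegral_cst; split=> //; exact: rintegrable_cst.
have E := incr_law s0 st (f := fun x => (x ^+ 2)%:E).
have {}E : (\int[P]_w (incr b s t w ^+ 2)%:E = (t - s)%:E)%E.
  rewrite E; last 2 first.
  - by apply/measurable_EFinP; exact: measurable_funX.
  - by move=> x; rewrite lee_fin sqr_ge0.
  rewrite rintegral_EFin; last by apply: normal_sqr_integrable; rewrite sqrtK.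
  by rewrite normal_variance sqrtK.
split; last by rewrite /Rintegral E.
apply: rintegrable_ge0; last by rewrite E ltry.
- by apply: measurable_funX; exact: incr_meas (ltW st).
- by move=> w; exact: sqr_ge0.
Qed.

Lemma incr_integrable s t : 0 <= s -> s <= t -> rintegrable P (incr b s t).
Proof.
move=> s0 st; apply: rintegrable_le (incr_meas s0 st) _ _; last first.
  exact: (rintegrableD (rintegrable_cst _ 1) (incr_sqr s0 st).1).
move=> w; have -> : incr b s t w ^+ 2 = `|incr b s t w| ^+ 2.
  by rewrite real_normK// num_real.
by have := sqr_ge0 (`|incr b s t w| - 1); nra.
Qed.

Lemma incr_mean s t : 0 <= s -> s <= t -> \int[P]_w incr b s t w = 0.
Proof.
move=> s0; rewrite le_eqVlt => /orP[/eqP <-|st].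
  by under eq_Rintegral do rewrite /incr subrr; rewrite rintegral_cst.
have sg0 : 0 < Num.sqrt (t - s) by rewrite sqrtK.
rewrite -(normal_mean sg0) /Rintegral; congr fine.
have mi := incr_meas s0 (ltW st).
pose X : {mfun Omega >-> measurableTypeR R} := HB.pack (incr b s t)
  (isMeasurableFun.Build _ _ Omega (measurableTypeR R) (incr b s t) mi).
transitivity (\int[distribution P X]_x x%:E)%E.
  by rewrite integral_distribution//; exact: incr_integrable (ltW st).
apply: (eq_measure_integral (normal_prob 0 (Num.sqrt (t - s)))) => B mB _.
by have [_ _ _ + _] := bW; apply.
Qed.

Let incr_indep s t X (h : R -> R) (A B : set R) : 0 <= s -> s <= t ->
  adapted_at s X -> measurable_fun setT h -> measurable A -> measurable B ->
  P (X @^-1` A `&` (fun w => h (incr b s t w)) @^-1` B) =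
  (P (X @^-1` A) * P ((fun w => h (incr b s t w)) @^-1` B))%E.
Proof.
move=> s0 st mX mh mA mB; have [_ _ _ _] := bW.
move=> /(_ s t (X @^-1` A) (h @^-1` B) s0 st); apply.
- exact: adapted_at_set.
- by rewrite -[X in measurable X]setTI; exact: mh.
Qed.

(** The martingale property: an increment is centred given the past. *)
Lemma incr_mart s t X : 0 <= s -> s <= t -> adapted_at s X -> rintegrable P X ->
  rintegrable P (fun w => X w * incr b s t w) /\
  \int[P]_w (X w * incr b s t w) = 0.
Proof.
move=> s0 st mX iX.
have [A B mA mB|i ->] := rintegralM_indep iX (incr_integrable s0 st).
  exact: (incr_indep (h := fun x => x)).
by rewrite incr_mean// mulr0.
Qed.

Lemma incr_sqr_mart s t X : 0 <= s -> s <= t -> adapted_at s X -> rintegrable P X ->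
  rintegrable P (fun w => X w * incr b s t w ^+ 2) /\
  \int[P]_w (X w * incr b s t w ^+ 2) = (t - s) * \int[P]_w X w.
Proof.
move=> s0 st mX iX; have [i2 E2] := incr_sqr s0 st.
have [A B mA mB|i ->] := rintegralM_indep iX i2.
  by apply: (incr_indep (h := fun x => x ^+ 2)) => //; exact: measurable_funX.
by rewrite E2 mulrC.
Qed.

End one_process.
End wiener_increments.

(** * The bracket of two Wiener processes *)

Section wiener_pairs.
Context {R : realType} {d : measure_display} {Omega : measurableType d}.
Variables (P : probability Omega R) (F : R -> set (set Omega)).
Hypothesis Ffilt : is_filtration F.
Local Notation adapted_at := (adapted_at F).
Local Notation rintegrable := (rintegrable P).

Lemma rintegrableM_bounded (M : R) (Z X : Omega -> R) :
  measurable_fun setT Z -> (forall w, `|Z w| <= M) -> rintegrable X ->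
  rintegrable (fun w => Z w * X w).
Proof.
move=> mZ ZM iX; have mX := rintegrable_meas iX.
apply: (rintegrable_le (g := fun w => M * `|X w|)); first exact: measurable_funM.
  by move=> w; rewrite normrM ler_wpM2r.
apply: rintegrableZ; apply: rintegrable_ge0 => //; first exact: measurableT_comp.
by case/integrableP: iX.
Qed.

Lemma rintegrableM_sqr (X Z : Omega -> R) :
  measurable_fun setT X -> measurable_fun setT Z ->
  rintegrable (fun w => X w ^+ 2) -> rintegrable (fun w => Z w ^+ 2) ->
  rintegrable (fun w => X w * Z w).
Proof.
move=> mX mZ iX iZ.
apply: (rintegrable_le (g := fun w => 2^-1 * (X w ^+ 2 + Z w ^+ 2))).
- exact: measurable_funM.
- move=> w; have := sqr_ge0 (X w - Z w); have := sqr_ge0 (X w + Z w).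
  by rewrite ler_norml; nra.
- by apply: rintegrableZ; exact: rintegrableD.
Qed.

Lemma rintegrable_incrM b1 b2 (M : R) (Z : Omega -> R) s t u v :
  is_wiener P F b1 -> is_wiener P F b2 ->
  0 <= s -> s <= t -> 0 <= u -> u <= v ->
  measurable_fun setT Z -> (forall w, `|Z w| <= M) ->
  rintegrable (fun w => Z w * (incr b1 s t w * incr b2 u v w)).
Proof.
move=> W1 W2 s0 st u0 uv mZ ZM; apply: rintegrableM_bounded mZ ZM _.
by apply: rintegrableM_sqr;
  [exact: (incr_meas Ffilt W1)|exact: (incr_meas Ffilt W2)|
   exact: (incr_sqr Ffilt W1 s0 st).1|exact: (incr_sqr Ffilt W2 u0 uv).1].
Qed.

(** [covariation b1 b2 c] says that the bracket of [b1] and [b2] at time [t] is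
    [c * t], tested against bounded variables from the past. *)
Definition covariation (b1 b2 : R -> Omega -> R) (c : R) :=
  forall s t (M : R) (Z : Omega -> R), 0 <= s -> s <= t ->
    adapted_at s Z -> (forall w, `|Z w| <= M) ->
    \int[P]_w (Z w * (incr b1 s t w * incr b2 s t w)) =
    c * (t - s) * \int[P]_w Z w.

Lemma rintegrable_bounded (M : R) (Z : Omega -> R) : measurable_fun setT Z ->
  (forall w, `|Z w| <= M) -> rintegrable Z.
Proof. by move=> mZ ZM; exact: rintegrable_le mZ ZM (rintegrable_cst P M). Qed.

Lemma covariation_self b : is_wiener P F b -> covariation b b 1.
Proof.
move=> W s t M Z s0 st mZ ZM.
under eq_Rintegral do rewrite -expr2.
rewrite mul1r; apply: (incr_sqr_mart Ffilt W s0 st mZ _).2.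
exact: rintegrable_bounded (adapted_at_meas Ffilt s0 mZ) ZM.
Qed.

Section independent_pair.
Variables (b1 b2 : R -> Omega -> R).
Hypothesis W1 : is_wiener P F b1.
Hypothesis W2 : is_wiener P F b2.
Hypothesis ind : forall A B, process_sigma_algebra b1 A -> process_sigma_algebra b2 B ->
  P (A `&` B) = (P A * P B)%E.

Let path_set (b : R -> Omega -> R) s t u v (B : set R) : 0 <= s -> 0 <= t -> 0 <= u -> 0 <= v ->
  measurable B -> process_sigma_algebra b ((fun w : Omega => incr b s t w * incr b u v w) @^-1` B).
Proof.
move=> s0 t0 u0 v0 mB; rewrite -[X in process_sigma_algebra _ X]setTI.
pose G := [set A : set Omega | exists t (B : set R),
  [/\ 0 <= t, measurable B & A = b t @^-1` B]].
have mb r : 0 <= r -> measurable_fun (setT : set (g_sigma_algebraType G)) (b r).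
  move=> r0 _ C mC; rewrite setTI; apply: sub_sigma_algebra.
  by exists r, C.
have : measurable_fun (setT : set (g_sigma_algebraType G))
    (fun w => incr b s t w * incr b u v w).
  by apply: measurable_funM; apply: measurable_funB; exact: mb.
exact.
Qed.

Let indep_prod s t u v : 0 <= s -> s <= t -> 0 <= u -> u <= v ->
  rintegrable (fun w => incr b1 s t w * incr b1 u v w) ->
  rintegrable (fun w => incr b2 s t w * incr b2 u v w) ->
  rintegrable (fun w => (incr b1 s t w * incr b1 u v w) * (incr b2 s t w * incr b2 u v w)) /\
  \int[P]_w ((incr b1 s t w * incr b1 u v w) * (incr b2 s t w * incr b2 u v w)) =
  \int[P]_w (incr b1 s t w * incr b1 u v w) * \int[P]_w (incr b2 s t w * incr b2 u v w).
Proof.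
move=> s0 st u0 uv i1 i2; have t0 := le_trans s0 st; have v0 := le_trans u0 uv.
by apply: rintegralM_indep => // A B mA mB; apply: ind; exact: path_set.
Qed.

Let incrM_integrable b s t u v : is_wiener P F b -> 0 <= s -> s <= t -> 0 <= u -> u <= v ->
  rintegrable (fun w => incr b s t w * incr b u v w).
Proof.
move=> W s0 st u0 uv; apply: rintegrableM_sqr.
- exact: (incr_meas Ffilt W).
- exact: (incr_meas Ffilt W).
- exact: (incr_sqr Ffilt W s0 st).1.
- exact: (incr_sqr Ffilt W u0 uv).1.
Qed.

Let incrM_disjoint b s t u v : is_wiener P F b -> 0 <= s -> s <= t -> t <= u -> u <= v ->
  \int[P]_w (incr b s t w * incr b u v w) = 0.
Proof.
move=> W s0 st tu uv; have t0 := le_trans s0 st; have u0 := le_trans t0 tu.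
apply: (incr_mart Ffilt W u0 uv _ _).2; last exact: (incr_integrable Ffilt W).
by apply: (adapted_at_le Ffilt t0 tu); exact: (incr_adapted Ffilt W).
Qed.

Section partition.
Variables (s h : R).
Hypotheses (s0 : 0 <= s) (h0 : 0 <= h).

Let u (k : nat) := s + k%:R * h.
Let u0 k : 0 <= u k. Proof. by rewrite addr_ge0// mulr_ge0. Qed.
Let uS k : u k <= u k.+1. Proof. by rewrite lerD2l ler_wpM2r// ler_nat. Qed.
Let u_le k l : (k <= l)%N -> u k <= u l.
Proof. by move=> kl; rewrite lerD2l ler_wpM2r// ler_nat. Qed.
Let su k : s <= u k. Proof. by rewrite lerDl mulr_ge0. Qed.
Let uSB k : u k.+1 - u k = h. Proof. by rewrite /u -natr1; ring. Qed.

Let dd k w := incr b1 (u k) (u k.+1) w * incr b2 (u k) (u k.+1) w.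
Let S n w := \sum_(k < n) dd k w.

Let dd_meas k : measurable_fun setT (dd k).
Proof.
by apply: measurable_funM; [exact: (incr_meas Ffilt W1)|exact: (incr_meas Ffilt W2)].
Qed.

Let S_meas n : measurable_fun setT (S n).
Proof. by apply: measurable_sum => k. Qed.

Let ddM l k : rintegrable (fun w => dd l w * dd k w) /\
  ((l < k)%N -> \int[P]_w (dd l w * dd k w) = 0) /\
  (l = k -> \int[P]_w (dd l w * dd k w) = h ^+ 2).
Proof.
have E w : dd l w * dd k w =
    (incr b1 (u l) (u l.+1) w * incr b1 (u k) (u k.+1) w) *
    (incr b2 (u l) (u l.+1) w * incr b2 (u k) (u k.+1) w).
  by rewrite /dd; ring.
rewrite (funext E).
have [i ->] := indep_prod (u0 l) (uS l) (u0 k) (uS k)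
  (incrM_integrable W1 (u0 l) (uS l) (u0 k) (uS k))
  (incrM_integrable W2 (u0 l) (uS l) (u0 k) (uS k)).
split=> //; split=> [lk|<-]; first by rewrite incrM_disjoint ?mul0r// u_le.
under eq_Rintegral do rewrite -expr2.
under [X in _ * X]eq_Rintegral do rewrite -expr2.
by rewrite (incr_sqr Ffilt W1 (u0 l) (uS l)).2 (incr_sqr Ffilt W2 (u0 l) (uS l)).2 uSB.
Qed.

(* The squares are centred and orthogonal, so the quadratic covariation along
   the partition has second moment [n * h ^+ 2]. *)
Let S_sqr n : rintegrable (fun w => S n w ^+ 2) /\ \int[P]_w (S n w ^+ 2) = n%:R * h ^+ 2.
Proof.
elim: n => [|n [ih1 ih2]].
  rewrite (_ : (fun w => S 0 w ^+ 2) = cst 0); last first.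
    by apply/funext => w; rewrite /S big_ord0 expr0n.
  by rewrite rintegral_cst mul0r; split=> //; exact: rintegrable_cst.
have E w : S n.+1 w ^+ 2 = S n w ^+ 2 + (2 * (\sum_(l < n) dd l w * dd n w) + dd n w * dd n w).
  by rewrite -mulr_suml /S big_ord_recr /=; ring.
rewrite (funext E).
have [i2 [_ /(_ erefl) E2]] := ddM n n.
have i3 : rintegrable (fun w => \sum_(l < n) dd l w * dd n w).
  by apply: rintegrable_sum => l; exact: (ddM l n).1.
have i4 := rintegrableZ 2 i3; have i5 := rintegrableD i4 i2.
split; first exact: rintegrableD.
rewrite rintegralD// rintegralD// rintegralZ// E2 ih2 rintegral_sum => [|l].
  rewrite big1 => [|l _]; last exact: (ddM l n).2.1.
  by rewrite mulr0 add0r -natr1; ring.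
exact: (ddM l n).1.
Qed.

(* Splitting at the points of the partition produces cross terms in which the
   later increment is centred given the other factors. *)
Let Z_S (M : R) (Z : Omega -> R) n : adapted_at s Z -> (forall w, `|Z w| <= M) ->
  \int[P]_w (Z w * (incr b1 s (u n) w * incr b2 s (u n) w)) = \int[P]_w (Z w * S n w).
Proof.
move=> mZ ZM; have mZ' := adapted_at_meas Ffilt s0 mZ.
have iS k : rintegrable (fun w => Z w * S k w).
  rewrite (_ : (fun w => _) = (fun w => \sum_(l < k) Z w * dd l w)); last first.
    by apply/funext => w; rewrite /S mulr_sumr.
  apply: rintegrable_sum => l.
  exact: (rintegrable_incrM W1 W2 (u0 l) (uS l) (u0 l) (uS l) mZ' ZM).
elim: n => [|n ih].
  apply: eq_Rintegral => w _.
  by rewrite /S big_ord0 /u mul0r addr0 /incr !subrr !mulr0.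
have mZu : adapted_at (u n) Z by exact: (adapted_at_le Ffilt s0 (su n)).
have cross b b' : is_wiener P F b -> is_wiener P F b' ->
    rintegrable (fun w => Z w * incr b s (u n) w * incr b' (u n) (u n.+1) w) /\
    \int[P]_w (Z w * incr b s (u n) w * incr b' (u n) (u n.+1) w) = 0.
  move=> W W'; apply: (incr_mart Ffilt W' (u0 n) (uS n)).
    by apply: adapted_atM => //; exact: (incr_adapted Ffilt W).
  exact: rintegrableM_bounded mZ' ZM (incr_integrable Ffilt W s0 (su n)).
have [i12 E12] := cross _ _ W1 W2; have [i21 E21] := cross _ _ W2 W1.
have i0 := rintegrable_incrM W1 W2 s0 (su n) s0 (su n) mZ' ZM.
have id := rintegrable_incrM W1 W2 (u0 n) (uS n) (u0 n) (uS n) mZ' ZM.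
have E w : Z w * (incr b1 s (u n.+1) w * incr b2 s (u n.+1) w) =
    Z w * (incr b1 s (u n) w * incr b2 s (u n) w) +
    (Z w * incr b1 s (u n) w * incr b2 (u n) (u n.+1) w +
    (Z w * incr b2 s (u n) w * incr b1 (u n) (u n.+1) w + Z w * dd n w)).
  by rewrite !(incr_split _ s (u n) (u n.+1)) /dd; ring.
rewrite (funext E) rintegralD//; last by do 2 apply: rintegrableD => //.
rewrite rintegralD//; last exact: rintegrableD.
rewrite rintegralD// E12 E21 !add0r ih -rintegralD//.
by apply: eq_Rintegral => w _; rewrite /S big_ord_recr /= mulrDr.
Qed.

(** The weighted inequality [2 * Z * S <= e * Z ^+ 2 + e^-1 * S ^+ 2], with a free
    weight [e], plays the part of the Cauchy-Schwarz inequality. *)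
Lemma incrM_partition_le (M e : R) (Z : Omega -> R) n :
  0 < e -> adapted_at s Z -> (forall w, `|Z w| <= M) ->
  `|\int[P]_w (Z w * (incr b1 s (s + n%:R * h) w * incr b2 s (s + n%:R * h) w))| <=
  2^-1 * (e * M ^+ 2 + e^-1 * (n%:R * h ^+ 2)).
Proof.
move=> e0 mZ ZM; rewrite (Z_S n mZ ZM).
have mZ' := adapted_at_meas Ffilt s0 mZ; have [iS ES] := S_sqr n.
have bnd w : `|Z w * S n w| <= 2^-1 * (e * M ^+ 2 + e^-1 * S n w ^+ 2).
  have ZM2 : Z w ^+ 2 <= M ^+ 2.
    by rewrite -(real_normK (num_real (Z w))) lerXn2r ?nnegrE// (le_trans _ (ZM w)).
  apply: (@le_trans _ _ (2^-1 * (e * Z w ^+ 2 + e^-1 * S n w ^+ 2))); last first.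
    by rewrite ler_pM2l// lerD2r ler_pM2l.
  have sg (x y : R) : 2 * x * y <= e * x ^+ 2 + e^-1 * y ^+ 2.
    rewrite -subr_ge0 (_ : _ - _ = e^-1 * (e * x - y) ^+ 2).
      by rewrite mulr_ge0 ?sqr_ge0// invr_ge0 ltW.
    by field; rewrite gt_eqF.
  by have := sg (Z w) (S n w); have := sg (- Z w) (S n w); rewrite sqrrN ler_norml; lra.
have ib : rintegrable (fun w => 2^-1 * (e * M ^+ 2 + e^-1 * S n w ^+ 2)).
  apply: rintegrableZ; apply: rintegrableD; first exact: rintegrable_cst.
  exact: rintegrableZ.
have iZS : rintegrable (fun w => Z w * S n w).
  by apply: rintegrable_le bnd ib; exact: (measurable_funM mZ' (S_meas n)).
have bE : \int[P]_w (2^-1 * (e * M ^+ 2 + e^-1 * S n w ^+ 2)) =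
    2^-1 * (e * M ^+ 2 + e^-1 * (n%:R * h ^+ 2)).
  have i1 := rintegrable_cst P (e * M ^+ 2); have i2 := rintegrableZ e^-1 iS.
  rewrite (rintegralZ _ (rintegrableD i1 i2)) (rintegralD i1 i2).
  by rewrite rintegral_cst (rintegralZ _ iS) ES.
apply: (le_trans (le_normr_Rintegral measurableT iZS)).
rewrite -bE; apply: rintegral_le => //.
apply: (rintegrable_le _ _ ib) => [|w]; last by rewrite normr_id.
by apply: measurableT_comp => //; exact: (measurable_funM mZ' (S_meas n)).
Qed.

End partition.

(** The increments of each process are independent of the past of the filtration,
    and the processes are independent of each other, but neither property bears
    directly on the product of both increments with a variable [Z] of the past.
    The product can be replaced by the sum of the products over a fine partition,
    because the cross terms are centred given the past, and this sum is small in
    L2 by the independence of the two processes. The partition has [m ^ 2] cells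
    and the weight [e] of [incrM_partition_le] is [1 / m], so that both terms of
    that bound are of order [1 / m]. *)
Lemma covariation_indep : covariation b1 b2 0.
Proof.
move=> s t M Z s0 st mZ ZM; rewrite !mul0r.
apply/eqP; rewrite -normr_eq0 eq_le normr_ge0 andbT; apply/ler_addgt0Pr => e e0; rewrite add0r.
pose K := M ^+ 2 + (t - s) ^+ 2.
have K0 : 0 <= K by rewrite addr_ge0 ?sqr_ge0.
have [m mK] : exists m : nat, K / e < m.+1%:R.
  by exists (Num.truncn (K / e)); rewrite truncnS_gt.
pose n := (m.+1 ^ 2)%N; pose h := (t - s) / n%:R.
have n0 : (0 : R) < n%:R by rewrite ltr0n expn_gt0.
have h0 : 0 <= h by rewrite divr_ge0 ?subr_ge0// ltW.
have := @incrM_partition_le s h s0 h0 M m.+1%:R^-1 Z n _ mZ ZM.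
rewrite (_ : s + n%:R * h = t); last by rewrite /h; field; rewrite gt_eqF.
move=> /(_ ltac:(by rewrite invr_gt0))/le_trans; apply.
rewrite invrK (_ : _ * h ^+ 2 = (t - s) ^+ 2 / n%:R); last first.
  by rewrite /h; field; rewrite gt_eqF.
rewrite /n natrX (_ : 2^-1 * _ = 2^-1 * (K / m.+1%:R)); last first.
  by rewrite /K; field; rewrite gt_eqF.
have mS : (0 : R) < m.+1%:R by [].
apply: (@le_trans _ _ (K / m.+1%:R)).
  by rewrite ler_piMl ?divr_ge0// invf_le1// ler1n.
by move: mK; rewrite ltr_pdivrMr// ler_pdivrMr// mulrC => /ltW.
Qed.

End independent_pair.
End wiener_pairs.

(** * Inner products of integrals of simple processes *)

Section simple_processes.
Context {R : realType} {d : measure_display} {Omega : measurableType d}.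
Variables (P : probability Omega R) (F : R -> set (set Omega)).
Hypothesis Ffilt : is_filtration F.
Local Notation adapted_at := (adapted_at F).
Local Notation rintegrable := (rintegrable P).
Local Notation mu := (@lebesgue_measure R).
Implicit Types (a c t : R).

(** The length of the intersection of two intervals. *)
Definition overlap a1 c1 a2 c2 : R :=
  Num.max 0 (Num.min c1 c2 - Num.max a1 a2).

Section two_intervals.
Variables (b1 b2 : R -> Omega -> R) (k : R).
Hypotheses (W1 : is_wiener P F b1) (W2 : is_wiener P F b2).
Hypothesis cov : covariation P F b1 b2 k.

(** The part of the longer increment after [c1] is centred given the rest. *)
Lemma incrM_same_start (M : R) (Z : Omega -> R) m c1 c2 : 0 <= m -> m <= c1 -> c1 <= c2 ->
  adapted_at m Z -> (forall w, `|Z w| <= M) ->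
  \int[P]_w (Z w * (incr b1 m c1 w * incr b2 m c2 w)) = k * (c1 - m) * \int[P]_w Z w.
Proof.
move=> m0 mc1 cc mZ ZM; have mZ' := adapted_at_meas Ffilt m0 mZ.
have c10 := le_trans m0 mc1.
have [i E] := incr_mart Ffilt W2 c10 cc
  (adapted_atM (adapted_at_le Ffilt m0 mc1 mZ) (incr_adapted Ffilt W1 m0 mc1))
  (rintegrableM_bounded mZ' ZM (incr_integrable Ffilt W1 m0 mc1)).
have H w : Z w * (incr b1 m c1 w * incr b2 m c2 w) =
    Z w * (incr b1 m c1 w * incr b2 m c1 w) + Z w * incr b1 m c1 w * incr b2 c1 c2 w.
  by rewrite (incr_split b2 m c1 c2); ring.
rewrite (funext H) rintegralD//; last first.
  exact: (rintegrable_incrM Ffilt W1 W2 m0 mc1 m0 mc1 mZ' ZM).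
by rewrite E addr0 (cov m0 mc1 mZ ZM).
Qed.

End two_intervals.

Lemma covariation_sym b1 b2 k : covariation P F b1 b2 k -> covariation P F b2 b1 k.
Proof.
move=> cov s t M Z s0 st mZ ZM; rewrite -(cov s t M Z)//.
by apply: eq_Rintegral => w _; rewrite (mulrC (incr b1 _ _ _)).
Qed.

Let start_le b1 b2 k (M : R) (Z : Omega -> R) a1 c1 a2 c2 :
  is_wiener P F b1 -> is_wiener P F b2 -> covariation P F b1 b2 k ->
  0 <= a1 -> a1 <= c1 -> a1 <= a2 -> a2 <= c2 ->
  adapted_at a2 Z -> (forall w, `|Z w| <= M) ->
  \int[P]_w (Z w * (incr b1 a1 c1 w * incr b2 a2 c2 w)) =
  k * Num.max 0 (Num.min c1 c2 - a2) * \int[P]_w Z w.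
Proof.
move=> W1 W2 cov a10 ac1 aa ac2 mZ ZM.
have a20 := le_trans a10 aa; have mZ' := adapted_at_meas Ffilt a20 mZ.
have past u : a1 <= u -> u <= a2 ->
    rintegrable (fun w => Z w * incr b1 a1 u w * incr b2 a2 c2 w) /\
    \int[P]_w (Z w * incr b1 a1 u w * incr b2 a2 c2 w) = 0.
  move=> a1u ua2; apply: (incr_mart Ffilt W2 a20 ac2).
    apply: adapted_atM => //; apply: (adapted_at_le Ffilt _ ua2).
      exact: le_trans a1u.
    exact: (incr_adapted Ffilt W1).
  exact: rintegrableM_bounded mZ' ZM (incr_integrable Ffilt W1 a10 a1u).
have [ca|/ltW ac] := leP c1 a2.
  rewrite (max_idPl _); last by rewrite subr_le0 (le_trans _ ca)// ge_min lexx.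
  rewrite mulr0 mul0r -[RHS](past c1 ac1 ca).2.
  by apply: eq_Rintegral => w _; rewrite mulrA.
have H w : Z w * (incr b1 a1 c1 w * incr b2 a2 c2 w) =
    Z w * incr b1 a1 a2 w * incr b2 a2 c2 w + Z w * (incr b1 a2 c1 w * incr b2 a2 c2 w).
  by rewrite (incr_split b1 a1 a2 c1); ring.
have [ip Ep] := past a2 aa (lexx _).
rewrite (funext H) rintegralD//; last first.
  exact: (rintegrable_incrM Ffilt W1 W2 a20 ac a20 ac2 mZ' ZM).
rewrite Ep add0r (max_idPr _); last by rewrite subr_ge0 le_min ac.
have [cc|/ltW cc] := leP c1 c2; first exact: incrM_same_start.
rewrite -(incrM_same_start W2 W1 (covariation_sym cov) a20 ac2 cc mZ ZM).
by apply: eq_Rintegral => w _; rewrite (mulrC (incr b1 _ _ _)).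
Qed.

(** Only the common part of the two time intervals contributes: increments after
    it are centred given the past, and so is the later increment given those
    before it. *)
Lemma incrM_overlap b1 b2 k (M : R) (Z : Omega -> R) a1 c1 a2 c2 :
  is_wiener P F b1 -> is_wiener P F b2 -> covariation P F b1 b2 k ->
  0 <= a1 -> a1 <= c1 -> 0 <= a2 -> a2 <= c2 ->
  adapted_at (Num.max a1 a2) Z -> (forall w, `|Z w| <= M) ->
  \int[P]_w (Z w * (incr b1 a1 c1 w * incr b2 a2 c2 w)) =
  k * overlap a1 c1 a2 c2 * \int[P]_w Z w.
Proof.
move=> W1 W2 cov a10 ac1 a20 ac2; rewrite /overlap.
have [aa|/ltW aa] := leP a1 a2 => mZ ZM; first exact: start_le.
rewrite minC -(start_le W2 W1 (covariation_sym cov) a20 ac2 aa ac1 mZ ZM).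
by apply: eq_Rintegral => w _; rewrite (mulrC (incr b1 _ _ _)).
Qed.

Section hilbert_valued.
Context {Y : hilbertType R} (sepY : separable_space Y).
Implicit Types (p q : @simple_process R d Omega Y).

(** The inner product of the two simple processes in [L2] of the time axis, see
    [simple_val_dot]. *)
Definition simple_dot p q w : R :=
  \sum_(i < sp_size p) \sum_(j < sp_size q)
    overlap (sp_time p i) (sp_time p i.+1) (sp_time q j) (sp_time q j.+1) *
    inner (sp_coef p i w) (sp_coef q j w).

Lemma simple_on_time t p i : simple_on F t p -> (i < sp_size p)%N ->
  [/\ 0 <= sp_time p i, sp_time p i <= sp_time p i.+1 & sp_time p i.+1 <= t].
Proof.
move=> [p0 pt pS _ _] ip.
have up j : (j <= sp_size p)%N -> 0 <= sp_time p j.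
  by elim: j => // j ih jp; rewrite (le_trans (ih (ltnW jp)))// pS.
have down j : (j <= sp_size p)%N -> sp_time p (sp_size p - j)%N <= t.
  elim: j => [|j ih jp]; first by rewrite subn0.
  apply: le_trans (ih (ltnW jp)); rewrite subnS -[X in _ <= sp_time p X]prednK.
    by apply: pS; rewrite prednK ?leq_subr// subn_gt0.
  by rewrite subn_gt0.
split; [exact/up/ltnW|exact: pS|].
by rewrite -(subKn ip); apply: down; exact: leq_subr.
Qed.

Lemma simple_coef_bound t p : simple_on F t p ->
  exists M : R, forall i w, (i < sp_size p)%N -> `|sp_coef p i w| ^+ 2 <= M.
Proof.
move=> [_ _ _ _ [M pM]]; exists (M ^+ 2) => i w ip.
by rewrite lerXn2r ?nnegrE ?pM// (le_trans _ (pM i w ip)).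
Qed.

Lemma simple_coef_adapted t t' p q i j : simple_on F t p -> simple_on F t' q ->
  (i < sp_size p)%N -> (j < sp_size q)%N ->
  adapted_at (Num.max (sp_time p i) (sp_time q j))
    (fun w => inner (sp_coef p i w) (sp_coef q j w)).
Proof.
move=> sp sq ip jq; have [p0 _ _] := simple_on_time sp ip.
have [q0 _ _] := simple_on_time sq jq.
have m0 : 0 <= Num.max (sp_time p i) (sp_time q j) by rewrite le_max p0.
apply: (borel_inner sepY); rewrite borel_sigma_algebra;
  try (by have [] := Ffilt.1 _ m0).
- case: sp => _ _ _ /(_ i ip) mp _; apply: borel_sub mp.
  by apply: (Ffilt.2 _ _ p0); rewrite le_max lexx.
- case: sq => _ _ _ /(_ j jq) mq _; apply: borel_sub mq.
  by apply: (Ffilt.2 _ _ q0); rewrite le_max lexx orbT.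
Qed.

Let coef_inner t t' p q : simple_on F t p -> simple_on F t' q ->
  exists M : R, forall i j w, (i < sp_size p)%N -> (j < sp_size q)%N ->
  `|inner (sp_coef p i w) (sp_coef q j w)| <= M.
Proof.
move=> /simple_coef_bound[M pM] /simple_coef_bound[N qN].
exists (2^-1 * (M + N)) => i j w ip jq; apply: le_trans (inner_le _ _) _.
by rewrite ler_pM2l// lerD ?pM ?qN.
Qed.

Lemma simple_dot_integrable t t' p q : simple_on F t p -> simple_on F t' q ->
  rintegrable (simple_dot p q).
Proof.
move=> sp sq; have [M pqM] := coef_inner sp sq.
apply: rintegrable_sum => i; apply: rintegrable_sum => j; apply: rintegrableZ.
apply: (rintegrable_bounded P (M := M)) => [|w]; last exact: pqM.
have [p0 _ _] := simple_on_time sp (ltn_ord i).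
apply: adapted_at_meas (simple_coef_adapted sp sq (ltn_ord i) (ltn_ord j)) => //.
by rewrite le_max p0.
Qed.

(** Both sides are bilinear in the coefficients, so the identity follows from
    [incrM_overlap] term by term. *)
Lemma simple_integral_dot t t' p q b1 b2 k : simple_on F t p -> simple_on F t' q ->
  is_wiener P F b1 -> is_wiener P F b2 -> covariation P F b1 b2 k ->
  rintegrable (fun w => inner (simple_integral b1 p w) (simple_integral b2 q w)) /\
  \int[P]_w inner (simple_integral b1 p w) (simple_integral b2 q w) =
  k * \int[P]_w simple_dot p q w.
Proof.
move=> sp sq W1 W2 cov; have [M pqM] := coef_inner sp sq.
pose Z i j w := inner (sp_coef p i w) (sp_coef q j w).
have tp i := simple_on_time sp (ltn_ord i); have tq j := simple_on_time sq (ltn_ord j).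
have aZ (i : 'I_(sp_size p)) (j : 'I_(sp_size q)) :=
  simple_coef_adapted sp sq (ltn_ord i) (ltn_ord j).
have mZ i j : measurable_fun setT (Z (i : 'I_(sp_size p)) (j : 'I_(sp_size q))).
  have [p0 _ _] := tp i.
  by apply: adapted_at_meas (aZ i j) => //; rewrite le_max p0.
have ZM (i : 'I_(sp_size p)) (j : 'I_(sp_size q)) w : `|Z i j w| <= M by exact: pqM.
have iZ (i : 'I_(sp_size p)) (j : 'I_(sp_size q)) := rintegrable_bounded P (mZ i j) (ZM i j).
have E w : inner (simple_integral b1 p w) (simple_integral b2 q w) =
    \sum_(i < sp_size p) \sum_(j < sp_size q) Z i j w *
      (incr b1 (sp_time p i) (sp_time p i.+1) w * incr b2 (sp_time q j) (sp_time q j.+1) w).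
  rewrite inner_suml; apply: eq_bigr => i _; rewrite inner_sumr; apply: eq_bigr => j _.
  by rewrite innerZl innerZr /Z /incr; ring.
have iE (i : 'I_(sp_size p)) (j : 'I_(sp_size q)) : rintegrable (fun w => Z i j w *
      (incr b1 (sp_time p i) (sp_time p i.+1) w * incr b2 (sp_time q j) (sp_time q j.+1) w)).
  have [p0 pS _] := tp i; have [q0 qS _] := tq j.
  exact: (rintegrable_incrM Ffilt W1 W2 p0 pS q0 qS (mZ i j) (ZM i j)).
rewrite (funext E); split.
  by apply: rintegrable_sum => i; exact: rintegrable_sum.
rewrite rintegral_sum => [|i]; last exact: rintegrable_sum.
have -> : \int[P]_w simple_dot p q w = \sum_(i < sp_size p) \sum_(j < sp_size q)
    overlap (sp_time p i) (sp_time p i.+1) (sp_time q j) (sp_time q j.+1) *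
    \int[P]_w Z i j w.
  rewrite rintegral_sum => [|i]; last first.
    by apply: rintegrable_sum => j; exact: rintegrableZ (iZ i j).
  apply: eq_bigr => i _; rewrite rintegral_sum => [|j]; last exact: rintegrableZ (iZ i j).
  by apply: eq_bigr => j _; exact: rintegralZ (iZ i j).
rewrite mulr_sumr; apply: eq_bigr => i _.
rewrite rintegral_sum// mulr_sumr; apply: eq_bigr => j _.
have [p0 pS _] := tp i; have [q0 qS _] := tq j.
by rewrite (incrM_overlap W1 W2 cov p0 pS q0 qS (aZ i j) (ZM i j)) mulrA.
Qed.

End hilbert_valued.
End simple_processes.

(** * The isometry for simple processes *)

Section time_integrals.
Context {R : realType} {d : measure_display} {Omega : measurableType d}.
Variables (P : probability Omega R) (F : R -> set (set Omega)).
Hypothesis Ffilt : is_filtration F.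
Local Notation mu := (@lebesgue_measure R).
Implicit Types (a c t : R).

Lemma overlap_integral a1 c1 a2 c2 :
  rintegrable mu (fun s => \1_(`]a1, c1]) s * \1_(`]a2, c2]) s) /\
  \int[mu]_s (\1_(`]a1, c1]) s * \1_(`]a2, c2]) s) = overlap a1 c1 a2 c2.
Proof.
pose I := `](Num.max a1 a2), (Num.min c1 c2)]%classic : set R.
have E s : \1_(`]a1, c1]) s * \1_(`]a2, c2]) s = \1_I s :> R.
  rewrite !indicE /I !mem_setE !in_itv /= gt_max le_min -natrM mulnb; congr (_%:R).
  by congr nat_of_bool; case: (a1 < s); case: (s <= c1); case: (a2 < s).
have mI : measurable (I : set (measurableTypeR R)) by exact: measurable_itv.
have intE : (\int[mu]_s (\1_I s)%:E = (overlap a1 c1 a2 c2)%:E)%E.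
  rewrite integral_indic//= setIT lebesgue_measure_itv /= lte_fin /overlap.
  case: ltP => cm.
    by rewrite -EFinB [Num.max 0 _](max_idPr _)// subr_ge0 ltW.
  by rewrite [Num.max 0 _](max_idPl _)// subr_le0.
rewrite (funext E); split; last by rewrite /Rintegral intE.
apply: rintegrable_ge0 => [|s|]; first exact: measurable_indic.
  by rewrite indicE.
by rewrite intE ltry.
Qed.

Section hilbert_valued.
Context {Y : hilbertType R} (sepY : separable_space Y).
Implicit Types (p q : @simple_process R d Omega Y).

Lemma simple_val_dot p q w :
  rintegrable mu (fun s => inner (simple_val p s w) (simple_val q s w)) /\
  \int[mu]_s inner (simple_val p s w) (simple_val q s w) = simple_dot p q w.
Proof.
pose ind p (i : nat) s : R := \1_(`]sp_time p i, sp_time p i.+1]) s.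
have E s : inner (simple_val p s w) (simple_val q s w) =
    \sum_(i < sp_size p) \sum_(j < sp_size q)
      inner (sp_coef p i w) (sp_coef q j w) * (ind p i s * ind q j s).
  rewrite inner_suml; apply: eq_bigr => i _; rewrite inner_sumr; apply: eq_bigr => j _.
  by rewrite innerZl innerZr /ind; ring.
have o i j := overlap_integral (sp_time p i) (sp_time p i.+1) (sp_time q j) (sp_time q j.+1).
have iE i j : rintegrable mu
    (fun s => inner (sp_coef p i w) (sp_coef q j w) * (ind p i s * ind q j s)).
  exact: rintegrableZ (o i j).1.
rewrite (funext E); split.
  by apply: rintegrable_sum => i; apply: rintegrable_sum => j; exact: iE.
rewrite rintegral_sum => [|i]; last by apply: rintegrable_sum => j; exact: iE.
apply: eq_bigr => i _; rewrite rintegral_sum => [|j]; last exact: iE.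
by apply: eq_bigr => j _; rewrite (rintegralZ _ (o i j).1) (o i j).2 mulrC.
Qed.

Lemma simple_val_out t p s w : simple_on F t p -> ~ `[0, t]%classic s ->
  simple_val p s w = 0.
Proof.
move=> sp st; apply: big1 => i _; rewrite indicE memNset ?scale0r//.
move=> /= /[!in_itv]/= /andP[ps sp']; apply: st => /=; rewrite in_itv/=.
have [p0 _ pt] := simple_on_time sp (ltn_ord i).
by rewrite (le_trans p0 (ltW ps)) (le_trans sp').
Qed.

(** Both processes vanish outside [[0, t]], so the integral over [[0, t]] is the
    one over the whole time axis, which [simple_val_dot] computes. *)
Lemma E_int_simpleB t p q : simple_on F t p -> simple_on F t q ->
  E_int P t (fun s w => (`|simple_val p s w - simple_val q s w| ^+ 2)%:E) =
  (\int[P]_w (simple_dot p p w - 2 * simple_dot p q w + simple_dot q q w))%:E.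
Proof.
move=> sp sq; have ipq p' q' := @simple_dot_integrable _ _ _ P F Ffilt _ sepY t t p' q'.
rewrite /E_int -rintegral_EFin; last first.
  apply: rintegrableD; last exact: ipq.
  by apply: rintegrableB; [exact: ipq|apply: rintegrableZ; exact: ipq].
apply: eq_integral => w _.
have [i1 E1] := simple_val_dot p p w; have [i2 E2] := simple_val_dot p q w.
have [i3 E3] := simple_val_dot q q w.
have H s : `|simple_val p s w - simple_val q s w| ^+ 2 =
    inner (simple_val p s w) (simple_val p s w)
    - 2 * inner (simple_val p s w) (simple_val q s w)
    + inner (simple_val q s w) (simple_val q s w).
  by rewrite sqr_normD innerNr normrN -!inner_norm; ring.
have i4 := rintegrableB i1 (rintegrableZ 2 i2).
rewrite -E1 -E2 -E3 -(rintegralZ 2 i2) -(rintegralB i1 (rintegrableZ 2 i2)).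
rewrite -(rintegralD i4 i3) -(rintegral_EFin (rintegrableD i4 i3)) [LHS]integral_mkcond.
apply: eq_integral => s _; rewrite patchE H; case: ifPn => //.
rewrite notin_setE => st; rewrite !(simple_val_out _ sp st) !(simple_val_out _ sq st).
by rewrite !inner0l mulr0 subr0 addr0.
Qed.

Lemma E_int_simple t p : simple_on F t p ->
  E_int P t (fun s w => (`|simple_val p s w| ^+ 2)%:E) = (\int[P]_w simple_dot p p w)%:E.
Proof.
move=> sp; pose z : @simple_process R d Omega Y := SimpleProcess 0 (fun=> 0) (fun _ _ => 0).
have t0 : 0 <= t.
  case: sp => p0 pt pS _ _; apply: le_trans pt.
  have : forall j, (j <= sp_size p)%N -> 0 <= sp_time p j.
    by elim=> // j ih jp; rewrite (le_trans (ih (ltnW jp)))// pS.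
  exact.
have sz : simple_on F t z by split=> //; exists 0.
have := E_int_simpleB sp sz; rewrite /E_int.
have z0 s w : simple_val z s w = 0 by rewrite /simple_val big_ord0.
have d0 q w : simple_dot q z w = 0 /\ simple_dot z q w = 0.
  split; last by rewrite /simple_dot big_ord0.
  by apply: big1 => i _; rewrite big_ord0.
under eq_integral do under eq_integral do rewrite z0 subr0.
move=> ->; congr EFin; apply: eq_Rintegral => w _.
by rewrite (d0 p w).1 (d0 z w).1 mulr0 subr0 addr0.
Qed.

Lemma simple_integral_meas t b p : is_wiener P F b -> simple_on F t p ->
  borel_wrt (@measurable _ Omega) setT (simple_integral b p).
Proof.
move=> W sp; suff H (r : seq 'I_(sp_size p)) : borel_wrt (@measurable _ Omega) setT
    (fun w => \sum_(i <- r) (b (sp_time p i.+1) w - b (sp_time p i) w) *: sp_coef p i w).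
  exact: H.
apply: (borel_sum sepY) => // i; have [p0 pS _] := simple_on_time sp (ltn_ord i).
apply: (borelZ sepY) => //; first exact: (incr_meas Ffilt W p0 pS).
case: sp => _ _ _ /(_ i (ltn_ord i)) mp _; apply: borel_sub mp.
by have [] := Ffilt.1 _ p0.
Qed.

(** The Ito isometry. A difference of simple processes with different partitions
    is handled by expanding the square, so that a common refinement is avoided. *)
Lemma simple_isometryB t b p q : is_wiener P F b -> simple_on F t p -> simple_on F t q ->
  (\int[P]_w (`|simple_integral b p w - simple_integral b q w| ^+ 2)%:E)%E =
  E_int P t (fun s w => (`|simple_val p s w - simple_val q s w| ^+ 2)%:E).
Proof.
move=> W sp sq; rewrite E_int_simpleB//.
have cov := covariation_self Ffilt W.
have [i1 E1] := simple_integral_dot Ffilt sepY sp sp W W cov.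
have [i2 E2] := simple_integral_dot Ffilt sepY sp sq W W cov.
have [i3 E3] := simple_integral_dot Ffilt sepY sq sq W W cov.
have dpp := simple_dot_integrable P Ffilt sepY sp sp.
have dpq := simple_dot_integrable P Ffilt sepY sp sq.
have dqq := simple_dot_integrable P Ffilt sepY sq sq.
have H w : `|simple_integral b p w - simple_integral b q w| ^+ 2 =
    inner (simple_integral b p w) (simple_integral b p w)
    - 2 * inner (simple_integral b p w) (simple_integral b q w)
    + inner (simple_integral b q w) (simple_integral b q w).
  by rewrite sqr_normD innerNr normrN -!inner_norm; ring.
have i4 := rintegrableB i1 (rintegrableZ 2 i2).
have d4 := rintegrableB dpp (rintegrableZ 2 dpq).
under eq_integral do rewrite H.
rewrite rintegral_EFin; last exact: rintegrableD i4 i3.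
congr EFin; rewrite (rintegralD i4 i3) (rintegralB i1 (rintegrableZ 2 i2)) (rintegralZ 2 i2).
rewrite (rintegralD d4 dqq) (rintegralB dpp (rintegrableZ 2 dpq)) (rintegralZ 2 dpq).
by rewrite E1 E2 E3 !mul1r.
Qed.

(** The double sum of the inner products is reduced to its diagonal by the
    vanishing of the brackets. *)
Lemma simple_isometry_sum t (b : nat -> R -> Omega -> R)
    (p : nat -> @simple_process R d Omega Y) (r : seq nat) :
  uniq r -> (forall j, is_wiener P F (b j)) ->
  (forall i j, i <> j -> covariation P F (b i) (b j) 0) ->
  (forall j, simple_on F t (p j)) ->
  (\int[P]_w (`|\sum_(j <- r) simple_integral (b j) (p j) w| ^+ 2)%:E)%E =
  (\sum_(j <- r) E_int P t (fun s w => (`|simple_val (p j) s w| ^+ 2)%:E))%E.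
Proof.
move=> ur W cov sp.
under [RHS]eq_bigr do rewrite E_int_simple//; rewrite sumEFin.
have ci i j : covariation P F (b i) (b j) (i == j)%:R.
  by have [->|/eqP/cov//] := eqVneq i j; exact: covariation_self.
have dot i j := simple_integral_dot Ffilt sepY (sp i) (sp j) (W i) (W j) (ci i j).
under eq_integral do rewrite sqr_norm_sum.
have is' i : rintegrable P (fun w => \sum_(j <- r)
    inner (simple_integral (b i) (p i) w) (simple_integral (b j) (p j) w)).
  by apply: rintegrable_sum => j; exact: (dot i j).1.
rewrite rintegral_EFin; last exact: rintegrable_sum.
congr EFin; rewrite rintegral_sum//; apply: eq_big_seq => i ir.
rewrite rintegral_sum => [|j]; last exact: (dot i j).1.
rewrite (bigD1_seq i)//= (dot i i).2 eqxx mul1r big1 ?addr0// => j ji.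
by rewrite (dot i j).2 eq_sym (negbTE ji) mul0r.
Qed.

End hilbert_valued.
End time_integrals.

(** * Mean-square convergence *)

Section ereal_limits.
Context {R : realType}.
Implicit Types (u : nat -> \bar R).

Lemma cvge0P u : (forall n, 0 <= u n)%E ->
  u n @[n --> \oo] --> 0%E <->
  (forall e : R, 0 < e -> exists N, forall n, (N <= n)%N -> (u n < e%:E)%E).
Proof.
move=> u0; split=> [/fine_cvgP[[N1 _ H1] /cvgrPdist_lt cu] e /cu[N2 _ H2]|H].
  exists (maxn N1 N2) => n; rewrite geq_max => /andP[n1 n2].
  have := H2 n n2; rewrite /= sub0r normrN ger0_norm ?fine_ge0// => ue.
  by rewrite -(fineK (H1 n n1)) lte_fin.
have fin n (e : R) : (u n < e%:E)%E -> u n \is a fin_num.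
  by move=> ue; rewrite ge0_fin_numE// (lt_trans ue) ?ltry.
apply/fine_cvgP; split.
  by have [N HN] := H 1 ltr01; exists N => // n /HN; exact: fin.
apply/cvgrPdist_lt => e /H[N HN]; exists N => // n /= /HN ue.
rewrite sub0r normrN ger0_norm ?fine_ge0//.
by rewrite -lte_fin fineK//; exact: fin ue.
Qed.

Lemma lee_2D (x y : \bar R) (a c : R) : (x <= a%:E)%E -> (y <= c%:E)%E ->
  (2%:E * x + 2%:E * y <= (2 * a + 2 * c)%:E)%E.
Proof.
move=> xa yc; have -> : (2 * a + 2 * c)%:E = (2%:E * a%:E + 2%:E * c%:E)%E by [].
by rewrite leeD// lee_pmul2l.
Qed.

Lemma limn_einf_le u (c : \bar R) K : (forall k, (K <= k)%N -> u k <= c)%E ->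
  (limn_einf u <= c)%E.
Proof.
move=> uc; rewrite limn_einf_lim; apply: lime_le; first exact: is_cvg_einfs.
exists K => // k /= Kk; apply: le_trans (uc k Kk).
by apply: ereal_inf_lbound; exists k => /=.
Qed.

End ereal_limits.

Section square_integrals.
Context {R : realType} {d : measure_display} {T : measurableType d}.
Variable P : probability T R.
Context {Y : hilbertType R}.
Implicit Types (X : T -> Y).
Local Notation borel := (borel_wrt (@measurable d T)).

Definition sqn X : \bar R := (\int[P]_w (`|X w| ^+ 2)%:E)%E.

Lemma sqn_ge0 X : (0 <= sqn X)%E.
Proof. by apply: integral_ge0 => w _; rewrite lee_fin sqr_ge0. Qed.

Lemma sqn_sym X X' : sqn (fun w => X w - X' w) = sqn (fun w => X' w - X w).
Proof. by apply: eq_integral => w _; rewrite distrC. Qed.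

(** The statement is a dichotomy because the norm is an extended real number,
    whose real square root is only available in the finite case. *)
Lemma L2norm_sqn X : (L2norm P X = +oo /\ sqn X = +oo)%E \/
  exists r : R, [/\ 0 <= r, L2norm P X = r%:E & sqn X = (r ^+ 2)%:E].
Proof.
have E : (L2norm P X `^ 2 = sqn X)%E.
  rewrite /L2norm poweR_Lnorm//; apply: eq_integral => w _ /=.
  by rewrite normr_id powR_mulrn.
have := Lnorm_ge0 P 2%:E (EFin \o (fun w => `|X w|)%R); rewrite -/(L2norm P X).
case: (L2norm P X) E => [r E r0|E _|//].
- rewrite lee_fin in r0; right; exists r; split => //.
  by rewrite -E poweR_EFin powR_mulrn.
- by left; split => //; rewrite -E /= ifF//; apply/negbTE.
Qed.

Lemma L2norm_fin X : (L2norm P X < +oo)%E <-> (sqn X < +oo)%E.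
Proof.
by case: (L2norm_sqn X) => [[-> ->]|[r [_ -> ->]]]; split=> //; rewrite !ltry.
Qed.

Lemma L2norm_lt X (e : R) : 0 < e ->
  (L2norm P X < e%:E)%E <-> (sqn X < (e ^+ 2)%:E)%E.
Proof.
move=> e0; case: (L2norm_sqn X) => [[-> ->]|[r [r0 -> ->]]]; first by split.
by rewrite !lte_fin ltr_pXn2r// nnegrE ltW.
Qed.

Lemma L2norm_cvg0 (D : nat -> T -> Y) :
  L2norm P (D m) @[m --> \oo] --> 0%E <-> sqn (D m) @[m --> \oo] --> 0%E.
Proof.
have n0 m : (0 <= L2norm P (D m))%E by exact: Lnorm_ge0.
split=> /cvge0P H; apply/cvge0P => [m|e e0]; [exact: sqn_ge0| |exact: n0|].
- have se0 : 0 < Num.sqrt e by rewrite sqrtr_gt0.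
  have [N HN] := H n0 _ se0; exists N => m /HN /(L2norm_lt _ se0).
  by rewrite sqr_sqrtr// ltW.
- have [N HN] := H (fun m => sqn_ge0 _) _ (exprn_gt0 2 e0).
  by exists N => m /HN /(L2norm_lt _ e0).
Qed.

Lemma sqnD X X' : measurable_fun setT (fun w => `|X w| ^+ 2) ->
  measurable_fun setT (fun w => `|X' w| ^+ 2) ->
  measurable_fun setT (fun w => `|X w + X' w| ^+ 2) ->
  (sqn (fun w => X w + X' w)%R <= 2%:E * sqn X + 2%:E * sqn X')%E.
Proof.
move=> /measurable_EFinP m1 /measurable_EFinP m2 /measurable_EFinP m3.
have p2 : (0 <= 2%:E :> \bar R)%E by rewrite lee_fin.
have g0 (Z : T -> Y) w : (0 <= (`|Z w| ^+ 2)%:E)%E by rewrite lee_fin sqr_ge0.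
have h0 (Z : T -> Y) w : (0 <= 2%:E * (`|Z w| ^+ 2)%:E)%E by exact: mule_ge0.
have n1 := measurable_funeM 2%:E m1; have n2 := measurable_funeM 2%:E m2.
rewrite -(ge0_integralZl P measurableT m1 (fun w _ => g0 X w) p2).
rewrite -(ge0_integralZl P measurableT m2 (fun w _ => g0 X' w) p2).
rewrite -(ge0_integralD P measurableT (fun w _ => h0 X w) n1 (fun w _ => h0 X' w) n2).
apply: ge0_le_integral => // [|w _]; first exact: emeasurable_funD.
by rewrite -!EFinM -EFinD lee_fin sqr_normD_le.
Qed.

(** Along a subsequence with [sqn (Z phi(k+1) - Z phi(k)) < 8 ^ - k], the
    series of the [4 ^ k * |Z phi(k+1) - Z phi(k)| ^ 2] has a finite integral, so
    that the increments are almost surely geometrically small. *)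
Lemma L2_complete_subseq (Z : nat -> T -> Y) :
  (forall m n, measurable_fun setT (fun w => `|Z m w - Z n w| ^+ 2)) ->
  (forall e : R, 0 < e -> exists N, forall m n, (N <= m)%N -> (N <= n)%N ->
    (sqn (fun w => Z m w - Z n w)%R < e%:E)%E) ->
  exists (phi : nat -> nat) (E : set T), [/\ measurable E, P (~` E) = 0%E,
    (forall w, E w -> cvgn (fun k => Z (phi k) w)) &
    forall e : R, 0 < e -> exists N K, forall m k, (N <= m)%N -> (K <= k)%N ->
      (sqn (fun w => Z m w - Z (phi k) w)%R < e%:E)%E].
Proof.
move=> mZ cZ.
have c8 k : exists N, forall m n, (N <= m)%N -> (N <= n)%N ->
    (sqn (fun w => Z m w - Z n w)%R < ((8^-1) ^+ k)%:E)%E.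
  by apply: cZ; rewrite exprn_gt0// invr_gt0.
have [N HN] := choice c8.
(* A sum of ranks rather than a maximum: it exceeds each [N i] with [i <= k]. *)
pose phi k := (\sum_(i < k.+1) N i)%N.
have Nphi i k : (i <= k)%N -> (N i <= phi k)%N.
  by rewrite -ltnS => ik; rewrite /phi (bigD1 (Ordinal ik))//= leq_addr.
pose D k w : \bar R := (4 ^+ k * `|Z (phi k.+1) w - Z (phi k) w| ^+ 2)%:E.
have D0 k w : (0 <= D k w)%E by rewrite lee_fin mulr_ge0 ?sqr_ge0// exprn_ge0.
have mD k : measurable_fun setT (D k).
  by apply/measurable_EFinP; apply: measurable_funM => //; exact: mZ.
pose S w : \bar R := (\sum_(0 <= k <oo) D k w)%E.
have S0 w : (0 <= S w)%E by apply: nneseries_ge0 => k _ _; exact: D0.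
have mS : measurable_fun setT S by apply: ge0_emeasurable_sum.
have iS : (\int[P]_w S w < +oo)%E.
  rewrite integral_nneseries//; apply: (@le_lt_trans _ _ 2%:E); last exact: ltry.
  apply: lime_le.
    by apply: is_cvg_nneseries => k _ _; exact: integral_ge0.
  apply: nearW => n.
  apply: (@le_trans _ _ (\sum_(0 <= k < n) ((2^-1 : R) ^+ k)%:E)%E).
    apply: lee_sum => k _; rewrite /D.
    under eq_integral do rewrite EFinM.
    rewrite ge0_integralZl ?lee_fin ?exprn_ge0//; last first.
      by apply/measurable_EFinP; exact: mZ.
    apply: (@le_trans _ _ ((4 ^+ k)%:E * ((8^-1) ^+ k)%:E)%E).
      rewrite lee_pmul2l ?lte_fin ?exprn_gt0//; apply: ltW; apply: HN; apply: Nphi => //.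
    rewrite -EFinM lee_fin -exprMn (_ : 4 * 8^-1 = 2^-1)//; lra.
  rewrite sumEFin lee_fin.
  have H i : \sum_(0 <= k < i) (2^-1 : R) ^+ k = 2 - 2 * 2^-1 ^+ i.
    elim: i => [|i IH]; first by rewrite big_geq// expr0; lra.
    by rewrite big_nat_recr//= IH exprS; lra.
  by rewrite H lerBlDr lerDl mulr_ge0// exprn_ge0// invr_ge0.
pose E := [set w | S w != +oo%E].
exists phi, E; split.
- by rewrite -[E]setTI; exact: emeasurable_neq.
- have iS' : P.-integrable setT S.
    by apply/integrableP; split => //; under eq_integral do rewrite gee0_abs//.
  have [A [mA PA sub]] := integrable_ae measurableT iS'.
  apply/eqP; rewrite eq_le measure_ge0 andbT -PA; apply: le_measure; rewrite ?inE//.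
    by apply: measurableC; rewrite -[E]setTI; exact: emeasurable_neq.
  move=> w /= /negP; rewrite negbK => /eqP Sw; apply: sub => /=.
  by rewrite Sw => /(_ I).
- move=> w Ew; have Sfin : S w \is a fin_num by rewrite ge0_fin_numE// ltey.
  pose c := Num.sqrt (fine (S w)).
  have Dle k : `|Z (phi k.+1) w - Z (phi k) w| <= geometric c 2^-1 k.
    have : (D k w <= S w)%E.
      apply: le_trans (nneseries_lim_ge k.+1 _) => //.
      by rewrite big_nat_recr//= leeDr// sume_ge0.
    rewrite -(fineK Sfin) lee_fin => H.
    have s0 : 0 <= fine (S w) by exact: fine_ge0.
    rewrite /geometric /= -(ler_pXn2r (ltn0Sn 1)) ?nnegrE//; last first.
      by rewrite mulr_ge0 ?sqrtr_ge0// exprn_ge0// invr_ge0.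
    rewrite exprMn /c sqr_sqrtr// -exprM mulnC exprM.
    rewrite (_ : 2^-1 ^+ 2 = 4^-1); last by field.
    by rewrite exprVn ler_pdivlMr ?exprn_gt0// mulrC.
  have : cvgn (series (telescope (fun k => Z (phi k) w))).
    apply: normed_cvg; apply: (series_le_cvg _ _ Dle) => [n|n|].
    - exact: normr_ge0.
    - by apply: le_trans (Dle n); exact: normr_ge0.
    - by apply: is_cvg_geometric_series; rewrite ger0_norm ?invr_ge0// invf_lt1// ltr1n.
  move=> cs; rewrite (_ : (fun k => _) = (fun k => Z (phi 0%N) w +
      series (telescope (fun k => Z (phi k) w)) k)); last first.
    by apply/funext => k; exact: eq_sum_telescope.
  by apply: is_cvgD => //; exact: is_cvg_cst.
- move=> e e0; have [N0 HN0] := cZ e e0.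
  have [K HK] : exists K, (8^-1 : R) ^+ K < e.
    have /cvgrPdist_lt/(_ _ e0) := @cvg_expr R 8^-1
      ltac:(by rewrite ger0_norm ?invr_ge0// invf_lt1// ltr1n).
    move=> [K _ HK]; exists K; have := HK K (leqnn K).
    by rewrite /= sub0r normrN ger0_norm// exprn_ge0// invr_ge0.
  exists (N K), K => m k mN Kk; apply: lt_trans (HN K _ _ mN (Nphi _ _ Kk)) _.
  by rewrite lte_fin.
Qed.

End square_integrals.

(** * Completeness of the space of square-integrable maps *)

Section L2_completeness.
Context {R : realType} {d : measure_display} {T : measurableType d}.
Variable P : probability T R.
Context {Y : hilbertType R}.
Implicit Types (X : T -> Y).
Local Notation borel := (borel_wrt (@measurable d T)).
Local Notation sqn := (sqn P).

(** The Riesz-Fischer theorem, by Fatou's lemma along an almost surely convergent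
    subsequence. The measurability of the norms of differences is a hypothesis so
    that non-separable spaces are covered, where the difference of two Borel maps
    can fail to be Borel. *)
Theorem L2_complete (Z : nat -> T -> Y) :
  (forall m, borel setT (Z m)) -> (forall m, sqn (Z m) < +oo)%E ->
  (forall m n, measurable_fun setT (fun w => `|Z m w - Z n w| ^+ 2)) ->
  (forall e : R, 0 < e -> exists N, forall m n, (N <= m)%N -> (N <= n)%N ->
    (sqn (fun w => Z m w - Z n w)%R < e%:E)%E) ->
  exists X, L2_cvg P Z X.
Proof.
move=> bZ fZ mZ cZ.
have [phi [E [mE PE cE cphi]]] := L2_complete_subseq mZ cZ.
(* Setting the values to [0] off the set of convergence makes the subsequence
   converge everywhere, so that its limit is Borel. *)
pose Z' k w : Y := if w \in E then Z (phi k) w else 0.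
pose X w := limn (fun k => Z' k w).
have Z'X w : Z' k w @[k --> \oo] --> X w.
  rewrite /X /Z'; have [/set_mem/cE//|wE] := boolP (w \in E).
  exact: is_cvg_cst.
have bX : borel setT X.
  apply: borel_lim Z'X => k O oO.
  have -> : setT `&` Z' k @^-1` O =
      (E `&` (setT `&` Z (phi k) @^-1` O)) `|` (~` E `&` (fun=> 0) @^-1` O).
    rewrite !setTI; apply/seteqP; split=> [w|w [] [wE]]; rewrite /preimage /Z' /=.
    - by have [/set_mem wE ?|/negP wE ?] := boolP (w \in E); [left|right];
        split => //= wE'; apply: wE; exact: mem_set.
    - by rewrite mem_set.
    - by rewrite memNset.
  apply: measurableU; first by apply: measurableI => //; exact: bZ.
  exact: (borel_cst (0 : Y) (measurableC mE) oO).
have mZ2 m : measurable_fun setT (fun w => `|Z m w| ^+ 2) by exact: borel_sqr_norm.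
pose f m k w : \bar R := (`|Z m w - Z' k w| ^+ 2)%:E.
have mf m k : measurable_fun setT (f m k).
  apply/measurable_EFinP.
  rewrite (_ : (fun w => _) = (fun w => \1_E w * `|Z m w - Z (phi k) w| ^+ 2 +
      \1_(~` E) w * `|Z m w| ^+ 2)); last first.
    apply/funext => w; rewrite !indicE in_setC /Z'.
    by case: ifPn => _ /=; rewrite mul1r mul0r ?addr0 ?add0r ?subr0.
  apply: measurable_funD; apply: measurable_funM => //; apply: measurable_indic => //.
  exact: measurableC.
have f0 m k w : (0 <= f m k w)%E by rewrite lee_fin sqr_ge0.
have fX m w : f m k w @[k --> \oo] --> (`|Z m w - X w| ^+ 2)%:E.
  apply: cvg_EFin; first by exact: nearW.
  apply: (@cvg_comp _ _ _ (fun k => Z m w - Z' k w) (fun y : Y => `|y| ^+ 2) _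
    (nbhs (Z m w - X w))).
    by apply: cvgB; [exact: cvg_cst|exact: Z'X].
  apply: (@cvg_comp _ _ _ (fun y : Y => `|y|) (fun r : R => r ^+ 2) _
    (nbhs `|Z m w - X w|)); first exact: norm_continuous.
  exact: sqr_continuous.
have mX m : measurable_fun setT (fun w => `|Z m w - X w| ^+ 2).
  apply/measurable_EFinP; by apply: (emeasurable_fun_cvg (f m)) => // w _; exact: fX.
have key e : 0 < e -> exists N, forall m, (N <= m)%N ->
    (sqn (fun w => Z m w - X w)%R <= e%:E)%E.
  move=> /cphi[N [K H]]; exists N => m Nm.
  have fE k : (\int[P]_w f m k w = sqn (fun w => Z m w - Z (phi k) w)%R)%E.
    apply: ge0_ae_eq_integral => //.
    - by apply/measurable_EFinP; exact: mZ.
    - exists (~` E); split; [exact: measurableC|exact: PE|].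
      move=> w /=; apply: contra_not => wE _.
      by rewrite /f /Z' mem_set.
  apply: (@le_trans _ _ (limn_einf (fun k => \int[P]_w f m k w)%E)).
    rewrite /sqn; under eq_integral do rewrite -(cvg_limn_einf_sup (fX m _)).1.
    exact: fatou.
  by apply: (@limn_einf_le _ _ _ K) => k Kk; rewrite fE ltW// H.
exists X; split.
- by move=> m; split; [exact: bZ|exact/L2norm_fin/fZ].
- split; first exact: bX.
  have [N HN] := key 1 ltr01; apply/L2norm_fin.
  apply: (@le_lt_trans _ _ (2%:E * sqn (fun w => X w - Z N w)%R + 2%:E * sqn (Z N))%E).
    rewrite [X in (X <= _)%E](_ : _ = sqn (fun w => (X w - Z N w) + Z N w)%R); last first.
      by apply: eq_integral => w _; rewrite subrK.
    apply: sqnD => //.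
    - by under eq_fun do rewrite distrC; exact: mX.
    - by under eq_fun do rewrite subrK; exact: borel_sqr_norm.
  rewrite sqn_sym lte_add_pinfty//; apply: lte_mul_pinfty => //.
  by apply: le_lt_trans (HN N (leqnn N)) _; exact: ltry.
- apply/L2norm_cvg0; apply/cvge0P => [m|e e0]; first exact: sqn_ge0.
  have e2 : 0 < e / 2 by rewrite divr_gt0.
  have [N HN] := key _ e2; exists N => m /HN H; apply: le_lt_trans H _.
  by rewrite lte_fin; lra.
Qed.

(** Separability makes the difference of the limits Borel, so that a vanishing
    mean square means vanishing almost everywhere. *)
Lemma L2_cvg_unique (Z : nat -> T -> Y) X X' : separable_space Y ->
  L2_cvg P Z X -> L2_cvg P Z X' -> X' = X %[ae P].
Proof.
move=> sepY [bZ [bX _] /L2norm_cvg0 cX] [_ [bX' _] /L2norm_cvg0 cX'].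
have mB : measurable_fun setT (fun w => `|X' w - X w| ^+ 2).
  by apply: borel_sqr_norm; exact: borelB.
suff H : sqn (fun w => X' w - X w) = 0%E.
  have /(ae_eq_integral_abs P measurableT) : measurable_fun setT
    (fun w => (`|X' w - X w| ^+ 2)%:E) by exact/measurable_EFinP.
  case=> /(_ _)/(filterS _) + _; apply; last first.
    by under eq_integral do rewrite gee0_abs ?lee_fin ?sqr_ge0//.
  move=> w /(_ I)/= [] /eqP; rewrite sqrf_eq0 normr_eq0 subr_eq0 => /eqP E _.
  exact: E.
apply/eqP; rewrite eq_le sqn_ge0 andbT; apply/lee_addgt0Pr => e e0; rewrite add0e.
have e4 : 0 < e / 4 by rewrite divr_gt0.
have [N1 H1] := (cvge0P (fun m => sqn_ge0 P _)).1 cX _ e4.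
have [N2 H2] := (cvge0P (fun m => sqn_ge0 P _)).1 cX' _ e4.
pose m := maxn N1 N2.
apply: (@le_trans _ _ (2%:E * sqn (fun w => X' w - Z m w)%R
    + 2%:E * sqn (fun w => Z m w - X w)%R)%E).
  rewrite [X in (X <= _)%E](_ : _ = sqn (fun w => (X' w - Z m w) + (Z m w - X w))%R).
    have bm := (bZ m).1.
    by apply: sqnD; apply: borel_sqr_norm; do ?[exact: borelB]; apply: borelD => //;
      exact: borelB.
  by apply: eq_integral => w _; rewrite addrA subrK.
rewrite sqn_sym; apply: (@le_trans _ _ (2%:E * (e / 4)%:E + 2%:E * (e / 4)%:E)%E).
  apply: leeD; rewrite lee_pmul2l// ltW//; first by apply: H2; exact: leq_maxr.
  by apply: H1; exact: leq_maxl.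
by rewrite -!EFinM -EFinD lee_fin; lra.
Qed.

End L2_completeness.

(** * Lebesgue points in the mean square *)

Section sliding_averages.
Context {R : realType} {Y : hilbertType R} (sepY : separable_space Y).
Local Notation mu := (@lebesgue_measure R).

Lemma separable_dense_seq : exists y : nat -> Y,
  forall (x : Y) (e : R), 0 < e -> exists k, `|x - y k| < e.
Proof.
case: sepY => D [/pfcard_geP[D0|[f]] dD].
  have [|x [_]] := dD setT _ openT; first by exists 0.
  by rewrite D0.
exists f => x e e0.
have [||z [xz Dz]] := dD (ball x e); [by exists x; exact: ballxx|exact: ball_open|].
by have [k _ kz] := 'surj_f Dz; exists k; rewrite kz; move: xz; rewrite -ball_normE.
Qed.

(** The length is twice the mesh [dl], because points chosen in two consecutive
    cells of length [dl] are less than [2 * dl] apart. *)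
Definition sliding_gap (x : R -> Y) (dl r : R) : \bar R :=
  (\int[mu]_(s in `]r, (r + 2 * dl)%R]) (`|x s - x r| ^+ 2)%:E)%E.

Lemma sliding_gap_le (x : R -> Y) (M dl r : R) :
  borel_wrt (@measurable _ (measurableTypeR R)) setT x ->
  (forall s, `|x s| <= M) -> 0 <= dl ->
  (sliding_gap x dl r <= (8 * M ^+ 2 * dl)%:E)%E.
Proof.
move=> mx xM dl0; rewrite /sliding_gap.
have mx2 : measurable_fun setT (fun s : measurableTypeR R => (`|x s - x r| ^+ 2)%:E).
  apply/measurable_EFinP; apply: borel_sqr_norm; apply: (borelB sepY) => //.
  exact: borel_cst.
apply: (@le_trans _ _ (\int[mu]_(s in `]r, (r + 2 * dl)%R]) (4 * M ^+ 2)%:E)%E).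
  apply: ge0_le_integral => //.
  - exact: measurable_funTS.
  - move=> s _; rewrite lee_fin; apply: le_trans (sqr_normB_le _ _) _.
    have H z : `|x z| ^+ 2 <= M ^+ 2.
      by rewrite lerXn2r ?nnegrE// (le_trans _ (xM z)).
    by have := H s; have := H r; lra.
rewrite integral_cst; last exact: measurable_itv.
rewrite /= lebesgue_measure_itv /= lte_fin.
case: ifPn => _; last first.
  by rewrite mule0 lee_fin mulr_ge0// mulr_ge0// sqr_ge0.
by rewrite -EFinD -EFinM lee_fin; lra.
Qed.

(** A Lebesgue point of the countably many scalar functions [|x s - y k| ^ 2],
    for a dense sequence [y], is a Lebesgue point of [x] in the mean square. *)
Lemma sliding_gap_cvg0 (x : R -> Y) (M : R) :
  borel_wrt (@measurable _ (measurableTypeR R)) setT x -> (forall s, `|x s| <= M) ->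
  {ae mu, forall r, forall e : R, 0 < e -> exists2 D : R, 0 < D &
    forall dl, 0 < dl -> dl < D -> (sliding_gap x dl r <= (e * dl)%:E)%E}.
Proof.
move=> mx xM; have [y yd] := separable_dense_seq.
pose ph k s : R := `|x s - y k| ^+ 2.
have mph k : measurable_fun setT (ph k : measurableTypeR R -> R).
  apply: borel_sqr_norm; apply: (borelB sepY) => //; exact: borel_cst.
have lph k : locally_integrable setT (ph k).
  split; [exact: mph|exact: openT|move=> K _ cK].
  apply: (@le_lt_trans _ _ (\int[mu]_(s in K) (2 * M ^+ 2 + 2 * `|y k| ^+ 2)%:E)%E).
    have mK : measurable K by exact: compact_measurable.
    apply: ge0_le_integral => //.
    - by apply/measurable_EFinP; apply: measurableT_comp => //; exact: measurable_funTS.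
    - move=> s _; rewrite lee_fin ger0_norm ?sqr_ge0//.
      apply: le_trans (sqr_normB_le _ _) _; rewrite lerD2r ler_pM2l//.
      by rewrite lerXn2r ?nnegrE// (le_trans _ (xM s)).
  have mK : measurable K by exact: compact_measurable.
  rewrite integral_cst//; apply: lte_mul_pinfty; rewrite ?lee_fin//.
    by rewrite addr_ge0// mulr_ge0// sqr_ge0.
  exact: compact_finite_measure.
have : {ae mu, forall r, forall k, lebesgue_pt (ph k) r}.
  by apply/ae_foralln => k; exact: lebesgue_differentiation.
case=> A [mA A0 sub]; exists A; split=> // r /= nr; apply: sub => /= Hr.
apply: nr => e e0.
have [k kr] : exists k, ph k r < e / 48.
  have se0 : 0 < Num.sqrt (e / 48) by rewrite sqrtr_gt0 divr_gt0.
  have [k kr] := yd (x r) _ se0; exists k.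
  rewrite /ph -[ltRHS]sqr_sqrtr ?divr_ge0 ?ltW//.
  by rewrite ltr_pXn2r ?nnegrE ?sqrtr_ge0.
have := Hr k; rewrite /lebesgue_pt => /fine_cvgP[fin /cvgrPdist_lt].
have e24 : 0 < e / 24 by rewrite divr_gt0.
move=> /(_ _ e24) near0.
have [D D0 HD] : exists2 D : R, 0 < D & forall rho, 0 < rho -> rho < D ->
    (davg (ph k) r rho <= (e / 24)%:E)%E.
  have : \forall rho \near 0^'+, (davg (ph k) r rho <= (e / 24)%:E)%E.
    near=> rho; have f1 : davg (ph k) r rho \is a fin_num by near: rho.
    rewrite -(fineK f1) lee_fin ltW//.
    have : `|0 - (fine \o davg (ph k) r) rho| < e / 24 by near: rho.
    by rewrite sub0r normrN /= ger0_norm// fine_ge0// davg_ge0.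
  move=> [D /= D0 HD]; exists D => // rho rho0 rhoD; apply: HD => //=.
  by rewrite sub0r normrN gtr0_norm.
(* The interval []r, r + 2 * dl]] is contained in the ball of radius [3 * dl], of
   measure [6 * dl]. There [|x s - x r| ^+ 2] is at most
   [2 * |ph k s - ph k r| + 4 * ph k r], and [2 * 6 * e / 24 + 4 * 6 * e / 48 = e]. *)
exists (D / 3); first by rewrite divr_gt0.
move=> dl dl0 dlD.
have rho0 : 0 < 3 * dl by rewrite mulr_gt0.
have := HD _ rho0 ltac:(lra).
rewrite /davg /iavg lebesgue_measure_ball ?(ltW rho0)// => Hd.
have mB : measurable (ball r (3 * dl) : set (measurableTypeR R)) by exact: measurable_ball.
pose B := ball r (3 * dl).
have mc : measurable_fun setT (fun s : measurableTypeR R => `|ph k s - ph k r|%:E).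
  by apply/measurable_EFinP; apply: measurableT_comp => //; exact: measurable_funB.
have Bc : (\int[mu]_(s in B) (`|ph k s - ph k r|%:E) <= (e / 4 * dl)%:E)%E.
  have -> : (e / 4 * dl)%:E = ((3 * dl *+ 2)%:E * (e / 24)%:E)%E.
    by rewrite -EFinM; congr EFin; rewrite -mulr_natr; field.
  have r2 : 0 < 3 * dl *+ 2 by rewrite mulrn_wgt0.
  by rewrite -lee_pdivrMl//; move: Hd; rewrite inver gt_eqF.
apply: (@le_trans _ _ (\int[mu]_(s in B)
   (2%:E * `|ph k s - ph k r|%:E + (4 * ph k r)%:E))%E); last first.
  rewrite ge0_integralD//; first last.
  - by move=> s _; rewrite lee_fin mulr_ge0// sqr_ge0.
  - by apply: measurable_funeM; exact: measurable_funTS.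
  rewrite ge0_integralZl//; last exact: measurable_funTS.
  rewrite integral_cst//= lebesgue_measure_ball ?(ltW rho0)//.
  apply: (@le_trans _ _ (2%:E * (e / 4 * dl)%:E + (4 * ph k r)%:E * (3 * dl *+ 2)%:E)%E).
    by apply: leeD => //; rewrite lee_pmul2l.
  rewrite -!EFinM -EFinD lee_fin -mulr_natr.
  have : ph k r * dl <= e / 48 * dl by rewrite ler_pM2r// ltW.
  lra.
rewrite /sliding_gap; apply: (@le_trans _ _ (\int[mu]_(s in `]r, (r + 2 * dl)%R])
   (2%:E * `|ph k s - ph k r|%:E + (4 * ph k r)%:E))%E).
  have mx2 : measurable_fun setT (fun s : measurableTypeR R => (`|x s - x r| ^+ 2)%:E).
    apply/measurable_EFinP; apply: borel_sqr_norm; apply: (borelB sepY) => //.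
    exact: borel_cst.
  apply: ge0_le_integral => //.
  - exact: measurable_funTS.
  - by apply: measurable_funTS; apply: emeasurable_funD => //; exact: measurable_funeM.
  - move=> s _; rewrite -EFinM -EFinD lee_fin.
    have := sqr_normB_le (x s - y k) (x r - y k).
    rewrite opprB addrA subrK -/(ph k s) -/(ph k r).
    have := ler_norm (ph k s - ph k r); lra.
apply: ge0_subset_integral => //.
- by apply: measurable_funTS; apply: emeasurable_funD => //; exact: measurable_funeM.
- by move=> s _; rewrite adde_ge0// ?mule_ge0// lee_fin// mulr_ge0// sqr_ge0.
- move=> s /=; rewrite in_itv /= /B -ball_normE /= => /andP[rs sr].
  by rewrite ltr_norml; apply/andP; split; lra.
Unshelve. all: by end_near.
Qed.

End sliding_averages.

(** * Integrals over time and chance *)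

Section time_probability_product.
Context {R : realType} {d : measure_display} {Omega : measurableType d}.
Variable P : probability Omega R.
Local Notation mu := (@lebesgue_measure R).
Local Notation TO := (measurableTypeR R * Omega)%type.
Implicit Types (t : R) (h : R -> Omega -> \bar R).

Lemma borel_comp {d1 d2} {T1 : measurableType d1} {T2 : measurableType d2}
    (V : topologicalType) (f : T2 -> V) (g : T1 -> T2) :
  measurable_fun setT g -> borel_wrt (@measurable _ T2) setT f ->
  borel_wrt (@measurable _ T1) setT (f \o g).
Proof.
move=> mg mf O oO; have := mg measurableT _ (mf O oO).
by rewrite setTI.
Qed.

Lemma measurable_time_section h w :
  measurable_fun setT (fun z : TO => h z.1 z.2) ->
  measurable_fun setT (h ^~ w : measurableTypeR R -> \bar R).
Proof.
move=> mh; have mp : measurable_fun setT (fun s : measurableTypeR R => (s, w)).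
  exact: measurable_fun_pair.
exact: (measurableT_comp mh mp).
Qed.

Let timeset t : set TO := `[0, t]%classic `*` setT.

Let mtimeset t : measurable (timeset t).
Proof. by apply: measurableX => //; exact: measurable_itv. Qed.

Let patch_time t h z : ((fun z : TO => h z.1 z.2) \_ (timeset t)) z =
  ((h ^~ z.2) \_ `[0, t]) z.1.
Proof.
rewrite !patchE; congr (if _ then _ else _).
by apply/idP/idP; rewrite !inE /timeset /=; [case|split].
Qed.

Section fubini.
Variables (t : R) (h : R -> Omega -> \bar R).
Hypothesis mh : measurable_fun setT (fun z : TO => h z.1 z.2).
Hypothesis h0 : forall s w, (0 <= h s w)%E.

Let mp : measurable_fun setT ((fun z : TO => h z.1 z.2) \_ (timeset t)).
Proof.
by apply/(measurable_restrictT _ (mtimeset t)); exact: measurable_funTS.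
Qed.

Let p0 z : (0 <= ((fun z : TO => h z.1 z.2) \_ (timeset t)) z)%E.
Proof. by rewrite patchE; case: ifP. Qed.

Lemma E_int_prod :
  E_int P t h = (\int[mu \x P]_(z in `[0%R, t]%classic `*` setT) h z.1 z.2)%E.
Proof.
rewrite [RHS]integral_mkcond (fubini_tonelli2 _ mp p0).
apply: eq_integral => w _; rewrite integral_mkcond.
by apply: eq_integral => s _; rewrite -(patch_time t h (s, w)).
Qed.

Lemma E_int_fubini :
  E_int P t h = (\int[mu]_(s in `[0%R, t]) \int[P]_w h s w)%E.
Proof.
rewrite E_int_prod integral_mkcond (fubini_tonelli1 _ mp p0) [RHS]integral_mkcond.
apply: eq_integral => s _; rewrite [RHS]patchE /fubini_F.
under eq_integral do rewrite (patch_time t h (s, _)) patchE /=.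
by case: ifPn => // _; rewrite integral0.
Qed.

Lemma measurable_time_integral :
  measurable_fun setT (fun w => \int[mu]_(s in `[0%R, t]) h s w)%E.
Proof.
have := measurable_fun_fubini_tonelli_G (m1 := mu) _ mp p0.
apply: eq_measurable_fun => w _; rewrite /fubini_G [RHS]integral_mkcond.
by apply: eq_integral => s _; rewrite -(patch_time t h (s, w)).
Qed.

Lemma measurable_expectation : measurable_fun setT
  (fun s : measurableTypeR R => \int[P]_w h s w)%E.
Proof. exact: (measurable_fun_fubini_tonelli_F _ mh (fun z => h0 z.1 z.2)). Qed.

End fubini.

Lemma eq_E_int t h h' : (forall s w, 0 <= s <= t -> h s w = h' s w) ->
  E_int P t h = E_int P t h'.
Proof.
move=> hh; apply: eq_integral => w _; apply: eq_integral => s.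
by rewrite inE /= in_itv /= => /hh ->.
Qed.

Lemma E_int_le t h h' :
  measurable_fun setT (fun z : TO => h z.1 z.2) ->
  measurable_fun setT (fun z : TO => h' z.1 z.2) ->
  (forall s w, 0 <= h s w)%E -> (forall s w, 0 <= s <= t -> (h s w <= h' s w)%E) ->
  (forall s w, 0 <= h' s w)%E -> (E_int P t h <= E_int P t h')%E.
Proof.
move=> mh mh' h0 hh h'0; rewrite !E_int_prod//; apply: ge0_le_integral => //.
- exact: mtimeset.
- exact: measurable_funTS.
- exact: measurable_funTS.
- by move=> [s w] [/= + _]; rewrite in_itv /=; exact: hh.
Qed.

Lemma E_intD t h h' :
  measurable_fun setT (fun z : TO => h z.1 z.2) ->
  measurable_fun setT (fun z : TO => h' z.1 z.2) ->
  (forall s w, 0 <= h s w)%E -> (forall s w, 0 <= h' s w)%E ->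
  E_int P t (fun s w => h s w + h' s w)%E = (E_int P t h + E_int P t h')%E.
Proof.
move=> mh mh' h0 h'0; rewrite !E_int_prod//.
- rewrite ge0_integralD//; [exact: mtimeset|exact: measurable_funTS|exact: measurable_funTS].
- exact: emeasurable_funD.
- by move=> s w; exact: adde_ge0.
Qed.

Lemma E_intZ t h (k : R) : 0 <= k ->
  measurable_fun setT (fun z : TO => h z.1 z.2) -> (forall s w, 0 <= h s w)%E ->
  E_int P t (fun s w => k%:E * h s w)%E = (k%:E * E_int P t h)%E.
Proof.
move=> k0 mh h0; rewrite !E_int_prod//.
- rewrite ge0_integralZl//; [exact: mtimeset|exact: measurable_funTS].
- exact: measurable_funeM.
- by move=> s w; exact: mule_ge0.
Qed.

End time_probability_product.

(** * Sampling points *)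

Section sampling_points.
Context {R : realType}.
Local Notation mu := (@lebesgue_measure R).

(** Each cell of the uniform partition contains a point where [H] is at most
    its mean over the cell, up to an arbitrarily small error. *)
Lemma sampling_points (H : R -> \bar R) (t e : R) (N : nat) :
  measurable_fun setT (H : measurableTypeR R -> \bar R) -> (forall r, 0 <= H r)%E ->
  (\int[mu]_(r in `[0%R, t]) H r < +oo)%E -> 0 < t -> 0 < e -> (0 < N)%N ->
  exists r : nat -> R,
    (forall k, (k < N)%N -> k%:R * (t / N%:R) <= r k < k.+1%:R * (t / N%:R)) /\
    (\sum_(k < N) H (r k) <=
      (t / N%:R)^-1%:E * \int[mu]_(r in `[0%R, t]) H r + e%:E)%E.
Proof.
move=> mH H0 fH t0 e0 N0; set dl := t / N%:R.
have NR : 0 < N%:R :> R by rewrite ltr0n.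
have dl0 : 0 < dl by rewrite divr_gt0.
have NdlE : N%:R * dl = t by rewrite /dl mulrC divfK// gt_eqF.
pose I k : set (measurableTypeR R) := `[k%:R * dl, k.+1%:R * dl[%classic.
have mI k : measurable (I k) by exact: measurable_itv.
have kS k : k%:R * dl <= k.+1%:R * dl by rewrite ler_wpM2r ?ler_nat// ltW.
have muI k : mu (I k) = dl%:E.
  rewrite /I lebesgue_measure_itv /= lte_fin ltr_pM2r// ltr_nat leqnn.
  by rewrite -EFinB -natr1; congr EFin; ring.
have sub k : (k < N)%N -> I k `<=` `[0%R, t]%classic.
  move=> kN r; rewrite /I /= !in_itv /= => /andP[kr rk].
  apply/andP; split; first by apply: le_trans kr; rewrite mulr_ge0// ltW.
  by apply: le_trans (ltW rk) _; rewrite -NdlE ler_wpM2r ?(ltW dl0)// ler_nat.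
pose a k := (\int[mu]_(r in I k) H r)%E.
have a0 k : (0 <= a k)%E by exact: integral_ge0.
have afin k : (k < N)%N -> a k \is a fin_num.
  move=> kN; rewrite ge0_fin_numE//; apply: le_lt_trans fH.
  by apply: ge0_subset_integral => //; [exact: measurable_funTS|exact: sub].
have asum : (\sum_(k < N) a k <= \int[mu]_(r in `[0%R, t]) H r)%E.
  have E k : (\sum_(i < k) a i = \int[mu]_(r in `[0%R, (k%:R * dl)%R[) H r)%E.
    elim: k => [|k ih]; first by rewrite big_ord0 mul0r set_itvco0 integral_set0.
    rewrite big_ord_recr /= ih.
    have -> : `[0%R, (k.+1%:R * dl)%R[%classic = `[0%R, (k%:R * dl)%R[%classic `|` I k.
      by rewrite /I -itv_bndbnd_setU// bnd_simp ?mulr_ge0// ltW.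
    rewrite ge0_integral_setU//.
    - exact: measurable_funTS.
    - apply/disj_setPS => r []; rewrite /I /= !in_itv /= => /andP[_ rk] /andP[kr _].
      by move: rk; rewrite ltNge kr.
  rewrite E NdlE; apply: ge0_subset_integral => //.
  - exact: measurable_funTS.
  - by move=> r /=; rewrite !in_itv /= => /andP[-> /ltW].
have pick k : exists r : R, (k < N)%N -> I k r /\
    (H r <= dl^-1%:E * a k + (e / N%:R)%:E)%E.
  have [kN|] := boolP (k < N)%N; last by exists 0.
  apply: contrapT => /forallNP nr.
  have Hr r : I k r -> ((dl^-1 * fine (a k) + e / N%:R)%:E <= H r)%E.
    move=> Ir; rewrite EFinD EFinM fineK ?afin//; rewrite leNgt; apply/negP => /ltW Hr.
    by apply: (nr r).
  have : (\int[mu]_(r in I k) (dl^-1 * fine (a k) + e / N%:R)%:E <= a k)%E.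
    apply: ge0_le_integral => //; last exact: measurable_funTS.
    move=> r _; rewrite lee_fin; apply: addr_ge0; last by rewrite divr_ge0// ltW.
    by apply: mulr_ge0; [rewrite invr_ge0 ltW|exact: fine_ge0].
  rewrite integral_cst//= muI -[leRHS]fineK ?afin// -EFinM lee_fin.
  rewrite mulrDl mulrAC mulVf ?gt_eqF// mul1r gerDl leNgt.
  by rewrite mulr_gt0// divr_gt0.
have [r Hr] := choice pick.
exists r; split=> [k /Hr[+ _]|]; first by rewrite /I /= in_itv.
apply: (@le_trans _ _ (\sum_(k < N) (dl^-1%:E * a k + (e / N%:R)%:E))%E).
  by apply: lee_sum => k _; exact: (Hr k (ltn_ord k)).2.
rewrite big_split /=; apply: leeD.
  by rewrite -ge0_sume_distrr// lee_pmul2l// lte_fin invr_gt0.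
rewrite sumEFin lee_fin sumr_const card_ord -(mulr_natr (e / N%:R)) divfK ?gt_eqF//.
Qed.

End sampling_points.

Section density.
Context {R : realType} {d : measure_display} {Omega : measurableType d}.
Variable P : probability Omega R.
Context {Y : hilbertType R} (sepY : separable_space Y).
Local Notation mu := (@lebesgue_measure R).
Local Notation TO := (measurableTypeR R * Omega)%type.

Section bounded.
Variables (X : R -> Omega -> Y) (M : R).
Hypothesis mX : borel_wrt (@measurable _ TO) setT (fun z => X z.1 z.2).
Hypothesis XM : forall s w, `|X s w| <= M.

(** The variable interval of integration is turned into a condition on a triple
    [(r, w, s)], so that Tonelli's theorem applies. *)
Lemma measurable_sliding_gap (dl : R) : measurable_fun setT
  (fun z : TO => sliding_gap (X ^~ z.2) dl z.1).
Proof.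
pose k (p : TO * measurableTypeR R) : \bar R :=
  if (p.1.1 < p.2) && (p.2 <= p.1.1 + 2 * dl)
  then (`|X p.2 p.1.2 - X p.1.1 p.1.2| ^+ 2)%:E else 0%E.
have m11 : measurable_fun setT (fun p : TO * measurableTypeR R => p.1.1).
  exact: (measurableT_comp measurable_fst measurable_fst).
have m12 : measurable_fun setT (fun p : TO * measurableTypeR R => p.1.2).
  exact: (measurableT_comp measurable_snd measurable_fst).
have m2 : measurable_fun setT (fun p : TO * measurableTypeR R => p.2).
  exact: measurable_snd.
have b2 := borel_comp (measurable_fun_pair m2 m12) mX.
have b1 := borel_comp (measurable_fun_pair m11 m12) mX.
have mk : measurable_fun setT k.
  apply: measurable_fun_ifT => //.
  - apply: measurable_and; first exact: measurable_fun_ltr.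
    by apply: measurable_fun_ler => //; exact: measurable_funD.
  - apply/measurable_EFinP; apply: borel_sqr_norm; exact: (borelB sepY b2 b1).
have k0 p : (0 <= k p)%E by rewrite /k; case: ifP => // _; rewrite lee_fin sqr_ge0.
have := measurable_fun_fubini_tonelli_F (m2 := mu) _ mk k0.
apply: eq_measurable_fun => z _; rewrite /fubini_F /sliding_gap [RHS]integral_mkcond.
by apply: eq_integral => s _; rewrite patchE /k mem_setE in_itv.
Qed.

Let sect w : borel_wrt (@measurable _ (measurableTypeR R)) setT (X ^~ w).
Proof.
have mp : measurable_fun setT (fun s : measurableTypeR R => (s, w)).
  exact: measurable_fun_pair.
exact: (borel_comp mp mX).
Qed.

(** Dominated convergence is applied twice, over time for a fixed path and then
    over chance. Boundedness of [X] provides both dominating constants. *)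
Lemma sliding_gap_mean_cvg0 (t : R) : 0 < t ->
  (\int[P]_w \int[mu]_(r in `[0%R, t])
     ((t / n.+1%:R)^-1%:E * sliding_gap (X ^~ w) (t / n.+1%:R) r))%E
    @[n --> \oo] --> 0%E.
Proof.
move=> t0; pose dl n := t / n.+1%:R.
have dl0 n : 0 < dl n by rewrite divr_gt0.
pose u n r w := ((dl n)^-1%:E * sliding_gap (X ^~ w) (dl n) r)%E.
have g0 n r w : (0 <= sliding_gap (X ^~ w) (dl n) r)%E.
  by apply: integral_ge0 => s _; rewrite lee_fin sqr_ge0.
have u0 n r w : (0 <= u n r w)%E by rewrite mule_ge0// lee_fin invr_ge0 ltW.
have uC n r w : (u n r w <= (8 * M ^+ 2)%:E)%E.
  rewrite /u lee_pdivrMl// -EFinM [(dl n * _)]mulrC.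
  exact: (sliding_gap_le sepY r (sect w) (XM ^~ w) (ltW (dl0 n))).
have mu_ n : measurable_fun setT (fun z : TO => u n z.1 z.2).
  by apply: measurable_funeM; exact: measurable_sliding_gap.
have mI : measurable (`[0, t]%classic : set (measurableTypeR R)) by exact: measurable_itv.
have inner w : (\int[mu]_(r in `[0%R, t]) u n r w)%E @[n --> \oo] --> 0%E.
  have [] := @dominated_convergence _ _ _ mu _ mI (fun n r => u n r w) (cst 0%E)
    (cst (8 * M ^+ 2)%:E).
  - by move=> n; apply: measurable_funTS; exact: measurable_time_section (mu_ n).
  - exact: measurable_cst.
  - have [A [mA A0 sub]] := sliding_gap_cvg0 sepY (sect w) (XM ^~ w).
    exists A; split=> // r /= nr; apply: sub => /= Hr; apply: nr => _.
    apply/cvge0P => // e e0; have [D D0 HD] := Hr (e / 2) (divr_gt0 e0 (ltr0n R 2)).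
    exists (Num.truncn (t / D)) => n Nn; rewrite /u.
    apply: (@le_lt_trans _ _ (e / 2)%:E); last by rewrite lte_fin; lra.
    rewrite lee_pdivrMl// -EFinM [dl n * _]mulrC; apply: HD => //.
    rewrite /dl ltr_pdivrMr// -ltr_pdivrMl// mulrC.
    apply: lt_le_trans (truncnS_gt _) _; by rewrite ler_nat.
  - apply: (@integrableS _ _ _ mu _ _ _ mI mI) => //.
    apply/integrableP; split; first exact: measurable_cst.
    rewrite integral_cst//= lebesgue_measure_itv /= lte_fin t0 -EFinD -EFinM; exact: ltry.
  - by apply: aeW => r n _; rewrite gee0_abs.
  - by move=> _ _; rewrite integral0.
have [] := @dominated_convergence _ _ _ P _ measurableT
    (fun n w => \int[mu]_(r in `[0%R, t]) u n r w)%E (cst 0%E) (cst (8 * M ^+ 2 * t)%:E).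
- by move=> n; exact: measurable_time_integral.
- exact: measurable_cst.
- by apply: aeW => w _; exact: inner.
- exact: finite_measure_integrable_cst.
- apply: aeW => w n _; rewrite gee0_abs; last by apply: integral_ge0.
  apply: (@le_trans _ _ (\int[mu]_(r in `[0%R, t]) (8 * M ^+ 2)%:E)%E).
    apply: ge0_le_integral => //; apply: measurable_funTS.
    exact: measurable_time_section (mu_ n).
  rewrite integral_cst//= lebesgue_measure_itv /= lte_fin t0 -EFinD -EFinM lee_fin.
  by rewrite subr0.
- by move=> _ _; rewrite integral0.
Qed.

End bounded.
End density.

(** * Approximation of bounded processes *)

Section simple_approximation.
Context {R : realType} {d : measure_display} {Omega : measurableType d}.
Variables (P : probability Omega R) (F : R -> set (set Omega)).
Hypothesis Ffilt : is_filtration F.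
Context {Y : hilbertType R} (sepY : separable_space Y).
Local Notation mu := (@lebesgue_measure R).
Local Notation TO := (measurableTypeR R * Omega)%type.
Implicit Types (p : @simple_process R d Omega Y).

Lemma simple_val_meas t p : simple_on F t p ->
  borel_wrt (@measurable _ TO) setT (fun z => simple_val p z.1 z.2).
Proof.
move=> sp; apply: (borel_sum sepY) => // i.
have [p0 pS _] := simple_on_time sp (ltn_ord i).
apply: (borelZ sepY) => //.
  apply: measurableT_comp; last exact: measurable_fst.
  by apply: measurable_indic; exact: measurable_itv.
case: sp => _ _ _ /(_ i (ltn_ord i)) mp _.
apply: (borel_comp (f := sp_coef p i) measurable_snd).
by apply: borel_sub mp; have [] := Ffilt.1 _ p0.
Qed.

Lemma simple_val_in p s w k : (forall i, (i < sp_size p)%N -> sp_time p i <= sp_time p i.+1) ->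
  (k < sp_size p)%N -> sp_time p k < s -> s <= sp_time p k.+1 ->
  simple_val p s w = sp_coef p k w.
Proof.
move=> pS kp ks sk.
have mono i j : (i <= j)%N -> (j <= sp_size p)%N -> sp_time p i <= sp_time p j.
  elim: j => [|j ih]; first by rewrite leqn0 => /eqP ->.
  rewrite leq_eqVlt => /orP[/eqP -> //|ij] jp.
  by apply: le_trans (ih ij (ltnW jp)) _; exact: pS.
rewrite /simple_val (bigD1 (Ordinal kp))//= big1 ?addr0 => [|i ik].
  by rewrite indicE mem_set ?scale1r//= in_itv /= ks.
rewrite indicE memNset ?scale0r//= in_itv /= => /andP[is' si].
have /orP[lt|lt] : (i < k)%N || (k < i)%N by rewrite -neq_ltn.
- by have := lt_le_trans ks (le_trans si (mono _ _ lt (ltnW kp))); rewrite ltxx.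
- have := lt_le_trans is' (le_trans sk (mono _ _ lt (ltnW (ltn_ord i)))).
  by rewrite ltxx.
Qed.

Section bounded.
Variables (X : R -> Omega -> Y) (M t : R).
Hypothesis mX : borel_wrt (@measurable _ TO) setT (fun z => X z.1 z.2).
Hypothesis XM : forall s w, `|X s w| <= M.
Hypothesis aX : forall s, 0 <= s <= t -> borel_wrt (F s) setT (X s).
Hypothesis t0 : 0 < t.

Section one_partition.
Variables (N : nat) (r : nat -> R).
Hypothesis N0 : (0 < N)%N.
Let dl := t / N%:R.
Hypothesis Hr : forall k, (k < N)%N -> k%:R * dl <= r k < k.+1%:R * dl.

Let NR : 0 < N%:R :> R. Proof. by rewrite ltr0n. Qed.
Let dl0 : 0 < dl. Proof. by rewrite divr_gt0. Qed.
Let NdlE : N%:R * dl = t. Proof. by rewrite /dl mulrC divfK// gt_eqF. Qed.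

Let p := SimpleProcess N (fun k => if (k < N)%N then r k else t) (fun k w => X (r k) w).

Let r_in k : (k < N)%N -> 0 <= r k <= t.
Proof.
move=> kN; have /andP[kr rk] := Hr kN; apply/andP; split.
  by apply: le_trans kr; rewrite mulr_ge0// ltW.
by apply: le_trans (ltW rk) _; rewrite -NdlE ler_wpM2r ?ler_nat// ltW.
Qed.

Let time_next k : (k < N)%N -> r k <= sp_time p k.+1 <= r k + 2 * dl.
Proof.
move=> kN /=; have /andP[kr rk] := Hr kN; have kS : k.+1%:R = k%:R + 1 :> R by rewrite natr1.
have [kN'|Nk] := ltnP k.+1 N.
  have kSS : k.+2%:R = k%:R + 1 + 1 :> R by rewrite -kS natr1.
  have /andP[] := Hr kN'; rewrite kSS; rewrite kS in rk * => h1 h2.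
  by apply/andP; split; lra.
have E : k.+1 = N by apply/eqP; rewrite eqn_leq kN Nk.
have /andP[_ ->] := r_in kN; rewrite -NdlE -E kS /=; lra.
Qed.

Let p_simple : simple_on F t p.
Proof.
split=> /=.
- by rewrite N0; have /andP[] := r_in N0.
- by rewrite ltnn.
- by move=> i iN; rewrite iN; have /andP[] := time_next iN.
- by move=> i iN; rewrite iN; apply: aX; exact: r_in.
- by exists M => i w _; exact: XM.
Qed.

Let gap k s w : \bar R :=
  if (r k < s) && (s <= r k + 2 * dl) then (`|X s w - X (r k) w| ^+ 2)%:E else 0%E.

Let gap0 k s w : (0 <= gap k s w)%E.
Proof. by rewrite /gap; case: ifP => // _; rewrite lee_fin sqr_ge0. Qed.

(* Before the first sampling point, which lies in the first cell, the simple
   process is [0] and the error is only bounded by [M ^+ 2]. *)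
Let pointwise s w : 0 <= s <= t ->
  ((`|X s w - simple_val p s w| ^+ 2)%:E <=
    (M ^+ 2 * \1_(`[0, dl]) s)%:E + \sum_(k < N) gap k s w)%E.
Proof.
move=> /andP[s0 st].
have nn : (0 <= (M ^+ 2 * \1_(`[0, dl]) s)%:E :> \bar R)%E.
  by rewrite lee_fin mulr_ge0 ?sqr_ge0// indicE.
have [sr|rs] := leP s (r 0%N).
  have -> : simple_val p s w = 0.
    apply: big1 => i _; rewrite indicE memNset ?scale0r//= in_itv /= ltn_ord => /andP[is' _].
    have : r 0%N <= r i.
      have [->//|i0] := posnP i; have /andP[_ h0] := Hr N0; have /andP[hi _] := Hr (ltn_ord i).
      by apply: (le_trans (ltW h0)); apply: le_trans hi; rewrite ler_wpM2r ?ler_nat// ltW.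
    by move=> h; have := lt_le_trans is' (le_trans sr h); rewrite ltxx.
  rewrite subr0 indicE mem_set /=; last first.
    rewrite in_itv /= s0 /= (le_trans sr)//; have /andP[_ h0] := Hr N0.
    by apply: le_trans (ltW h0) _; rewrite mul1r.
  rewrite mulr1 -[leLHS]adde0; apply: leeD; last exact: sume_ge0.
  by rewrite lee_fin lerXn2r ?nnegrE// (le_trans _ (XM s w)).
have [k [kN ks sk]] : exists k, [/\ (k < N)%N, r k < s & s <= sp_time p k.+1].
  have ex : exists k, s <= sp_time p k by exists N; rewrite /= ltnn.
  have := ex_minnP ex; case=> -[|k] sk kmin.
    by move: sk; rewrite /= N0 leNgt rs.
  have kN : (k < N)%N by apply: kmin; rewrite /= ltnn.
  exists k; split=> //; rewrite ltNge; apply/negP => h.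
  by have := kmin k; rewrite /= kN h ltnn => /(_ isT).
have [_ _ pS _ _] := p_simple.
have ks' : sp_time p k < s by rewrite /= kN.
have -> := @simple_val_in p s w k pS kN ks' sk.
rewrite -[leLHS]add0e; apply: leeD; first exact: nn.
rewrite (bigD1 (Ordinal kN))//= -[leLHS]adde0; apply: leeD; last exact: sume_ge0.
have /andP[_ h] := time_next kN.
by rewrite /gap ks (le_trans sk h).
Qed.

Let mgap k : (k < N)%N -> measurable_fun setT (fun z : TO => gap k z.1 z.2).
Proof.
move=> kN; apply: measurable_fun_ifT => //.
- apply: measurable_and.
    by apply: measurable_fun_ltr; [exact: measurable_cst|exact: measurable_fst].
  by apply: measurable_fun_ler; [exact: measurable_fst|exact: measurable_cst].
- apply/measurable_EFinP; apply: borel_sqr_norm; apply: (borelB sepY) => //.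
  apply: (borel_comp (f := X (r k)) measurable_snd).
  have /andP[r0 _] := r_in kN.
  by apply: borel_sub (aX (r_in kN)); have [] := Ffilt.1 _ r0.
Qed.

(** The value at [r k] is used up to the next sampling point [r k.+1], or up to
    [t] when [k] is last, hence for a time of at most [2 * dl]: this makes the
    process adapted, and bounds its error over the [k]-th step by the sliding gap
    at [r k]. *)
Lemma sampled_process : exists p', simple_on F t p' /\
  (E_int P t (fun s w => (`|X s w - simple_val p' s w| ^+ 2)%:E) <=
    (M ^+ 2 * dl)%:E + \sum_(k < N) \int[P]_w sliding_gap (X ^~ w) dl (r k))%E.
Proof.
exists p; split; first exact: p_simple.
pose gs k s w := if (k < N)%N then gap k s w else 0%E.
have mgs k : measurable_fun setT (fun z : TO => gs k z.1 z.2).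
  rewrite /gs; case: (boolP (k < N)%N) => [kN|_]; last exact: measurable_cst.
  exact: mgap.
have gs0 k s w : (0 <= gs k s w)%E by rewrite /gs; case: ifP.
pose c s (w : Omega) : \bar R := (M ^+ 2 * \1_(`[0, dl]) s)%:E.
have mc : measurable_fun setT (fun z : TO => c z.1 z.2).
  apply/measurable_EFinP; apply: measurable_funM => //.
  apply: measurableT_comp; last exact: measurable_fst.
  by apply: measurable_indic; exact: measurable_itv.
have c0 s w : (0 <= c s w)%E by rewrite lee_fin mulr_ge0 ?sqr_ge0// indicE.
have msum : measurable_fun setT (fun z : TO => \sum_(k < N) gs k z.1 z.2)%E.
  by apply: emeasurable_sum => k; exact: mgs.
apply: (@le_trans _ _ (E_int P t (fun s w => c s w + \sum_(k < N) gs k s w)%E)).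
  apply: E_int_le.
  - apply/measurable_EFinP; apply: borel_sqr_norm; apply: (borelB sepY) => //.
    exact: simple_val_meas p_simple.
  - exact: emeasurable_funD.
  - by move=> s w; rewrite lee_fin sqr_ge0.
  - move=> s w st; apply: le_trans (pointwise w st) _; apply: leeD => //.
    by apply: lee_sum => k _; rewrite /gs ltn_ord.
  - by move=> s w; rewrite adde_ge0// sume_ge0.
rewrite E_intD//; last by move=> s w; exact: sume_ge0.
apply: leeD.
  rewrite /E_int; under eq_integral do under eq_integral do rewrite /c EFinM.
  have mI1 : measurable_fun setT (fun s : measurableTypeR R => (\1_(`[0, dl]) s)%:E : \bar R).
    by apply/measurable_EFinP; apply: measurable_indic; exact: measurable_itv.
  rewrite (eq_integral (cst (M ^+ 2 * dl)%:E)) => [|w _].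
    by rewrite integral_cst//= probability_setT mule1.
  rewrite ge0_integralZl//; last 2 first.
  - exact: measurable_funTS.
  - by rewrite lee_fin sqr_ge0.
  rewrite integral_indic//.
  have -> : `[0, dl]%classic `&` `[0, t]%classic = `[0, dl]%classic :> set R.
    apply/setIidl => s /=; rewrite !in_itv /= => /andP[-> /le_trans]; apply.
    by rewrite -NdlE ler_peMl ?ler1n// ltW.
  by rewrite /= lebesgue_measure_itv /= lte_fin dl0 -EFinD subr0 -EFinM.
have -> : E_int P t (fun s w => \sum_(k < N) gs k s w)%E =
    (\sum_(k < N) E_int P t (gs k))%E.
  have mti k : measurable_fun setT (fun w => \int[mu]_(s in `[0%R, t]) gs k s w)%E.
    exact: measurable_time_integral.
  rewrite /E_int -ge0_integral_sum//; last by move=> k w _; exact: integral_ge0.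
  apply: eq_integral => w _; rewrite ge0_integral_sum// => k.
  by apply: measurable_funTS; exact: measurable_time_section (mgs k).
apply: lee_sum => k _; apply: ge0_le_integral => //.
- by move=> w _; exact: integral_ge0.
- exact: measurable_time_integral.
- have mk : measurable_fun setT (fun w : Omega => (r k : measurableTypeR R, w)).
    exact: measurable_fun_pair.
  exact: (measurableT_comp (measurable_sliding_gap sepY mX dl) mk).
- move=> w _; rewrite /sliding_gap integral_mkcond [leRHS]integral_mkcond.
  apply: ge0_le_integral => //.
  + by move=> s _; rewrite patchE; case: ifP.
  + apply/(measurable_restrictT _ (measurable_itv _)).
    by apply: measurable_funTS; exact: measurable_time_section (mgs k).
  + apply/(measurable_restrictT _ (measurable_itv _)).
    apply: measurable_funTS; apply/measurable_EFinP; apply: borel_sqr_norm.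
    apply: (borelB sepY); last exact: borel_cst.
    have mp : measurable_fun setT (fun s : measurableTypeR R => (s, w)).
      exact: measurable_fun_pair.
    exact: (borel_comp mp mX).
  + move=> s _; rewrite !patchE /gs ltn_ord /gap !mem_setE !in_itv /=.
    case: (_ && (s <= t)); last by case: ifP => // _; rewrite lee_fin sqr_ge0.
    by case: ifP.
Qed.

End one_partition.

(** The sampling points are those of [sampling_points] for the mean sliding gap
    [H]. The sum of the [H (r k)] is then at most the mean of the averages in
    [sliding_gap_mean_cvg0] plus an arbitrarily small error. *)
Lemma simple_approx_bounded (e : R) : 0 < e -> exists p, simple_on F t p /\
  (E_int P t (fun s w => (`|X s w - simple_val p s w| ^+ 2)%:E) <= e%:E)%E.
Proof.
move=> e0; have e3 : 0 < e / 3 by rewrite divr_gt0.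
have cv := sliding_gap_mean_cvg0 P sepY mX XM t0.
have g0 dl r w : (0 <= sliding_gap (X ^~ w) dl r)%E.
  by apply: integral_ge0 => s _; rewrite lee_fin sqr_ge0.
have dlS n : 0 < t / n.+1%:R by rewrite divr_gt0.
have pos n : (0 <= \int[P]_w \int[mu]_(r in `[0%R, t])
     ((t / n.+1%:R)^-1%:E * sliding_gap (X ^~ w) (t / n.+1%:R) r))%E.
  apply: integral_ge0 => w _; apply: integral_ge0 => r _.
  by rewrite mule_ge0// lee_fin invr_ge0 ltW.
have [N1 HN1] := (cvge0P pos).1 cv _ e3.
pose n := maxn N1 (Num.truncn (M ^+ 2 * t / (e / 3))).
pose dl := t / n.+1%:R; have dl0 : 0 < dl by exact: dlS.
pose H r := (\int[P]_w sliding_gap (X ^~ w) dl r)%E.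
have mg : measurable_fun setT (fun z : TO => sliding_gap (X ^~ z.2) dl z.1).
  exact: measurable_sliding_gap.
have mH : measurable_fun setT (H : measurableTypeR R -> \bar R).
  exact: (measurable_expectation P (h := fun r w => sliding_gap (X ^~ w) dl r)).
have H0 r : (0 <= H r)%E by exact: integral_ge0.
have HE : (\int[mu]_(r in `[0%R, t]) H r = dl%:E * \int[P]_w \int[mu]_(r in `[0%R, t])
     (dl^-1%:E * sliding_gap (X ^~ w) dl r))%E.
  rewrite -(E_int_fubini P t (h := fun r w => sliding_gap (X ^~ w) dl r))//.
  rewrite -[X in (_ * X)%E]/(E_int P t (fun r w => dl^-1%:E * sliding_gap (X ^~ w) dl r)%E).
  rewrite E_intZ//; last by rewrite invr_ge0 ltW.
  by rewrite muleA -EFinM divff ?gt_eqF// mul1e.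
have small := HN1 n (leq_maxl _ _).
have fH : (\int[mu]_(r in `[0%R, t]) H r < +oo)%E.
  rewrite HE; apply: lte_mul_pinfty => //; first by rewrite lee_fin ltW.
  by apply: lt_trans small _; exact: ltry.
have [r [Hr rsum]] := sampling_points mH H0 fH t0 e3 (ltn0Sn n).
have [p [sp pe]] := sampled_process (ltn0Sn n) Hr.
exists p; split=> //; apply: le_trans pe _.
apply: (@le_trans _ _ ((e / 3)%:E + ((e / 3)%:E + (e / 3)%:E))%E); last first.
  by rewrite -!EFinD lee_fin; lra.
apply: leeD.
  rewrite lee_fin mulrA ler_pdivrMr// -ler_pdivrMl// mulrC.
  apply: (le_trans (ltW (truncnS_gt _))).
  by rewrite ler_nat ltnS leq_maxr.
apply: le_trans rsum _; apply: leeD => //.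
rewrite HE muleA -EFinM mulVf ?gt_eqF// mul1e; exact: ltW.
Qed.

End bounded.
End simple_approximation.

(** * Truncation and the density of simple processes *)

Section truncation.
Context {R : realType} {Y : hilbertType R}.
Implicit Types (y : Y) (n : nat).

(** A rational function of the norm, instead of the projection on a ball, because
    its continuity and its error are given by one formula. *)
Definition trunc n y : Y := (1 + `|y| / n.+1%:R)^-1 *: y.

Let den_ge1 n y : 1 <= 1 + `|y| / n.+1%:R.
Proof. by rewrite lerDl divr_ge0. Qed.

Let den_gt0 n y : 0 < 1 + `|y| / n.+1%:R.
Proof. exact: lt_le_trans (den_ge1 n y). Qed.

Lemma trunc_continuous n : continuous (trunc n).
Proof.
move=> y; apply: cvgZ; last exact: cvg_id.
apply: cvgV; first by rewrite gt_eqF.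
apply: cvgD; first exact: cvg_cst.
apply: cvgM; last exact: cvg_cst.
exact: norm_continuous.
Qed.

Lemma norm_trunc n y : `|trunc n y| <= n.+1%:R.
Proof.
rewrite /trunc normrZ ger0_norm ?invr_ge0 ?(ltW (den_gt0 n y))//.
rewrite mulrC ler_pdivrMr// mulrDr mulr1 mulrCA divff// mulr1.
by rewrite lerDr.
Qed.

Let trunc_err n y : `|y - trunc n y| = (1 - (1 + `|y| / n.+1%:R)^-1) * `|y|.
Proof.
rewrite /trunc -{1}[y]scale1r -scalerBl normrZ ger0_norm// subr_ge0.
by rewrite invf_le1.
Qed.

Lemma trunc_dist_le n y : `|y - trunc n y| <= `|y|.
Proof.
by rewrite trunc_err ler_piMl// gerBl invr_ge0 ltW.
Qed.

Lemma trunc_dist_small n y : `|y - trunc n y| <= `|y| ^+ 2 / n.+1%:R.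
Proof.
rewrite trunc_err expr2 mulrAC ler_wpM2r//.
set a := `|y| / n.+1%:R; have a0 : 0 <= a by exact: divr_ge0.
have a1 : 0 < 1 + a by rewrite (lt_le_trans ltr01)// lerDl.
rewrite -(ler_pM2r a1) mulrBl mul1r mulVf ?gt_eqF//.
by nra.
Qed.

Lemma trunc_cvg y : (fun n => (`|y - trunc n y| ^+ 2)%:E : \bar R) n @[n --> \oo] --> 0%E.
Proof.
apply/cvge0P => [n|e e0]; first by rewrite lee_fin sqr_ge0.
have se0 : 0 < Num.sqrt e by rewrite sqrtr_gt0.
exists (Num.truncn (`|y| ^+ 2 / Num.sqrt e)) => n Nn.
rewrite lte_fin -[ltRHS](sqr_sqrtr (ltW e0)) ltr_pXn2r ?nnegrE ?(ltW se0)//.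
apply: le_lt_trans (trunc_dist_small n y) _.
rewrite ltr_pdivrMr// -ltr_pdivrMl// mulrC.
by apply: lt_le_trans (truncnS_gt _) _; rewrite ler_nat.
Qed.

End truncation.

Section ito_integral.
Context {R : realType} {d : measure_display} {Omega : measurableType d}.
Variables (P : probability Omega R) (F : R -> set (set Omega)).
Hypothesis Ffilt : is_filtration F.
Context {Y : hilbertType R} (sepY : separable_space Y).
Local Notation mu := (@lebesgue_measure R).
Local Notation TO := (measurableTypeR R * Omega)%type.
Local Notation sqn := (sqn P).
Implicit Types (p : @simple_process R d Omega Y) (f : R -> Omega -> Y) (t : R).

(** The square of the distance in [L2([0, t] x Omega)]. *)
Definition sqd t f f' := E_int P t (fun s w => (`|f s w - f' s w| ^+ 2)%:E).

(** Extension by [0] in time, to apply statements on maps measurable on the whole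
    product space to maps that are measurable on [[0, t]] only. *)
Definition extend0 t f : R -> Omega -> Y :=
  fun s w => if 0 <= s <= t then f s w else 0.

Lemma extend0_meas t f :
  borel_wrt (@measurable _ TO) (`[0, t] `*` setT) (fun z => f z.1 z.2) ->
  borel_wrt (@measurable _ TO) setT (fun z => extend0 t f z.1 z.2).
Proof.
move=> mf O oO; set D := _ `*` _ in mf.
have mD : measurable D by apply: measurableX => //; exact: measurable_itv.
have -> : setT `&` (fun z => extend0 t f z.1 z.2) @^-1` O =
   (D `&` (fun z => f z.1 z.2) @^-1` O) `|` (~` D `&` (fun=> 0) @^-1` O).
  have DE z : D z <-> 0 <= z.1 <= t by rewrite /D /= in_itv /=; split=> [[]|].
  rewrite setTI; apply/seteqP; split=> [z|z [[/DE zt fz]|[nD fz]]];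
    rewrite /preimage /extend0 /=.
  - case: ifPn => zt Oz; first by left; split=> //; apply/DE.
    by right; split=> // /DE; exact/negP.
  - by rewrite zt.
  - by rewrite ifN//; apply/negP => /DE.
apply: measurableU; first exact: mf.
exact: (borel_cst (0 : Y) (measurableC mD) oO).
Qed.

Lemma E_int_extend0 t f (h : R -> Omega -> Y -> \bar R) :
  E_int P t (fun s w => h s w (f s w)) = E_int P t (fun s w => h s w (extend0 t f s w)).
Proof. by apply: eq_E_int => s w st; rewrite /extend0 st. Qed.

Lemma sqd_triangle t f1 f2 f3 :
  borel_wrt (@measurable _ TO) (`[0, t] `*` setT) (fun z => f1 z.1 z.2) ->
  borel_wrt (@measurable _ TO) (`[0, t] `*` setT) (fun z => f2 z.1 z.2) ->
  borel_wrt (@measurable _ TO) (`[0, t] `*` setT) (fun z => f3 z.1 z.2) ->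
  (sqd t f1 f3 <= 2%:E * sqd t f1 f2 + 2%:E * sqd t f2 f3)%E.
Proof.
move=> /extend0_meas m1 /extend0_meas m2 /extend0_meas m3.
have ext f f' : sqd t f f' = sqd t (extend0 t f) (extend0 t f').
  by apply: eq_E_int => s w st; rewrite /extend0 st.
rewrite (ext f1 f3) (ext f1 f2) (ext f2 f3) /sqd.
have mB f f' : borel_wrt (@measurable _ TO) setT (fun z => f z.1 z.2) ->
    borel_wrt (@measurable _ TO) setT (fun z => f' z.1 z.2) ->
    measurable_fun setT (fun z : TO => (`|f z.1 z.2 - f' z.1 z.2| ^+ 2)%:E).
  by move=> mf mf'; apply/measurable_EFinP; apply: borel_sqr_norm; exact: borelB.
have nn (y : Y) : (0 <= (`|y| ^+ 2)%:E :> \bar R)%E by rewrite lee_fin sqr_ge0.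
pose h1 s w := (`|extend0 t f1 s w - extend0 t f2 s w| ^+ 2)%:E : \bar R.
pose h2 s w := (`|extend0 t f2 s w - extend0 t f3 s w| ^+ 2)%:E : \bar R.
have two0 : 0 <= 2 :> R by [].
have mh1 : measurable_fun setT (fun z : TO => h1 z.1 z.2) by exact: mB.
have mh2 : measurable_fun setT (fun z : TO => h2 z.1 z.2) by exact: mB.
have n1 s w : (0 <= 2%:E * h1 s w)%E by apply: mule_ge0; [rewrite lee_fin|exact: nn].
have n2 s w : (0 <= 2%:E * h2 s w)%E by apply: mule_ge0; [rewrite lee_fin|exact: nn].
have m1' := measurable_funeM 2%:E mh1; have m2' := measurable_funeM 2%:E mh2.
rewrite -(E_intZ P t two0 mh1 (fun s w => nn _)) -(E_intZ P t two0 mh2 (fun s w => nn _)).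
rewrite -(E_intD P t m1' m2' n1 n2).
apply: E_int_le => [|||s w _|s w].
- exact: mB.
- exact: emeasurable_funD.
- by move=> s w; exact: nn.
- rewrite /h1 /h2 -!EFinM -EFinD lee_fin.
  by apply: le_trans (sqr_normD_le _ _); rewrite addrA subrK.
- exact: adde_ge0.
Qed.

Lemma simple_val_meas_on t p : simple_on F t p ->
  borel_wrt (@measurable _ TO) (`[0, t] `*` setT) (fun z => simple_val p z.1 z.2).
Proof.
move=> sp O oO; apply: measurableI; first by apply: measurableX => //; exact: measurable_itv.
by have := simple_val_meas Ffilt sepY sp oO; rewrite setTI.
Qed.

(** Truncation commutes with adaptedness and joint measurability because it is a
    continuous map of the value, and it converges by dominated convergence, the
    error being at most [|f|]. *)
Lemma simple_approx t f (e : R) : 0 <= t -> 0 < e -> ito_integrand P F t f ->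
  exists p, simple_on F t p /\ (sqd t f (simple_val p) < e%:E)%E.
Proof.
rewrite le_eqVlt => /orP[/eqP <-|t0] e0 [[mf af] ff].
  exists (SimpleProcess 0 (fun=> 0) (fun _ _ => 0)); split; first by split=> //; exists 0.
  rewrite /sqd /E_int (eq_integral (cst 0%E)) ?integral0 ?lte_fin// => w _.
  by rewrite set_itv1 integral_set1.
pose X := extend0 t f; have mX := extend0_meas mf.
pose Xn n s w := trunc n (X s w).
have mXn n : borel_wrt (@measurable _ TO) setT (fun z => Xn n z.1 z.2).
  exact: (borel_cont (@trunc_continuous _ _ n) mX).
have nn (y : Y) : (0 <= (`|y| ^+ 2)%:E :> \bar R)%E by rewrite lee_fin sqr_ge0.
have mB n : measurable_fun setT (fun z : TO => (`|X z.1 z.2 - Xn n z.1 z.2| ^+ 2)%:E).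
  by apply/measurable_EFinP; apply: borel_sqr_norm; exact: borelB.
have mX2 : measurable_fun setT (fun z : TO => (`|X z.1 z.2| ^+ 2)%:E).
  by apply/measurable_EFinP; exact: borel_sqr_norm.
have cvX : sqd t X (Xn n) @[n --> \oo] --> 0%E.
  pose D : set TO := `[0, t]%classic `*` setT.
  have mD : measurable D by apply: measurableX => //; exact: measurable_itv.
  rewrite /sqd; under eq_fun do rewrite (E_int_prod P t (mB _) (fun s w => nn _)).
  have [] := @dominated_convergence _ _ _ (mu \x P)%E D mD
    (fun n z => (`|X z.1 z.2 - Xn n z.1 z.2| ^+ 2)%:E) (cst 0%E)
    (fun z => (`|X z.1 z.2| ^+ 2)%:E).
  - by move=> n; exact: measurable_funTS.
  - exact: measurable_cst.
  - by apply: aeW => z _; exact: trunc_cvg.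
  - apply/integrableP; split; first exact: measurable_funTS.
    under eq_integral do rewrite gee0_abs//.
    rewrite -(E_int_prod P t (h := fun s w => (`|X s w| ^+ 2)%:E) mX2 (fun s w => nn _)).
    by rewrite -(E_int_extend0 t f (fun _ _ y => (`|y| ^+ 2)%:E)).
  - apply: aeW => z n _; rewrite gee0_abs// lee_fin lerXn2r ?nnegrE//.
    exact: trunc_dist_le.
  - by move=> _ _; rewrite integral0.
have sq0 n : (0 <= sqd t X (Xn n))%E.
  by apply: integral_ge0 => w _; apply: integral_ge0.
have e5 : 0 < e / 5 by rewrite divr_gt0.
have [n Hn] := (cvge0P sq0).1 cvX _ e5; have {}Hn := Hn n (leqnn n).
have aXn s : 0 <= s <= t -> borel_wrt (F s) setT (Xn n s).
  move=> st; have := af s st; rewrite /Xn /X /extend0 st => ms O oO.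
  by apply: (ms (trunc n @^-1` O)); move/continuousP: (@trunc_continuous R Y n); exact.
have [p [sp pe]] := simple_approx_bounded P Ffilt sepY (mXn n)
  (fun s w => norm_trunc n (X s w)) aXn t0 e5.
exists p; split=> //.
have D_ f' : borel_wrt (@measurable _ TO) setT (fun z => f' z.1 z.2) ->
    borel_wrt (@measurable _ TO) (`[0, t] `*` setT) (fun z => f' z.1 z.2).
  move=> m' O oO; apply: measurableI; first by apply: measurableX => //; exact: measurable_itv.
  by have := m' O oO; rewrite setTI.
apply: (le_lt_trans (sqd_triangle mf (D_ _ (mXn n)) (simple_val_meas_on sp))).
rewrite (_ : sqd t f (Xn n) = sqd t X (Xn n)); last first.
  by apply: eq_E_int => s w st; rewrite /X /extend0 st.
apply: le_lt_trans (lee_2D (ltW Hn) pe) _.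
by rewrite lte_fin; lra.
Qed.

End ito_integral.

(** * The Ito integral *)

Section ito_theory.
Context {R : realType} {d : measure_display} {Omega : measurableType d}.
Variables (P : probability Omega R) (F : R -> set (set Omega)).
Hypothesis Ffilt : is_filtration F.
Context {Y : hilbertType R} (sepY : separable_space Y).
Local Notation mu := (@lebesgue_measure R).
Local Notation TO := (measurableTypeR R * Omega)%type.
Local Notation sqn := (sqn P).
Local Notation sqd := (sqd P).
Local Notation simple_process := (@simple_process R d Omega Y).
Implicit Types (p : simple_process) (f : R -> Omega -> Y) (t : R).

Lemma sqd_ge0 t f f' : (0 <= sqd t f f')%E.
Proof.
by apply: integral_ge0 => w _; apply: integral_ge0 => s _; rewrite lee_fin sqr_ge0.
Qed.

Lemma sqd_sym t f f' : sqd t f f' = sqd t f' f.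
Proof. by apply: eq_E_int => s w _; rewrite distrC. Qed.

Lemma simple_integral_L2 t b p : is_wiener P F b -> simple_on F t p ->
  in_L2 P (simple_integral b p).
Proof.
move=> W sp; split; first exact: (simple_integral_meas Ffilt sepY W sp).
apply/L2norm_fin; rewrite /sqn; under eq_integral do rewrite -inner_norm.
have [i _] := simple_integral_dot Ffilt sepY sp sp W W (covariation_self Ffilt W).
by rewrite (rintegral_EFin i) ltry.
Qed.

Lemma sqnB_le (X1 X2 X3 : Omega -> Y) :
  borel_wrt (@measurable _ Omega) setT X1 -> borel_wrt (@measurable _ Omega) setT X2 ->
  borel_wrt (@measurable _ Omega) setT X3 ->
  (sqn (fun w => X1 w - X3 w)%R <=
    2%:E * sqn (fun w => X1 w - X2 w)%R + 2%:E * sqn (fun w => X2 w - X3 w)%R)%E.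
Proof.
move=> b1 b2 b3.
rewrite [X in (X <= _)%E](_ : _ = sqn (fun w => (X1 w - X2 w) + (X2 w - X3 w))%R).
  by apply: sqnD; apply: borel_sqr_norm; do ?[exact: borelB]; apply: borelD => //;
    exact: borelB.
by apply: eq_integral => w _; rewrite addrA subrK.
Qed.

(** The integrals of approximating simple processes are Cauchy by the isometry. *)
Lemma ito_integral_exists t b f : 0 <= t -> is_wiener P F b ->
  ito_integrand P F t f -> exists I, is_ito_integral P F b t f I.
Proof.
move=> t0 W fi.
have ex n : exists p, simple_on F t p /\ (sqd t f (simple_val p) < n.+1%:R^-1%:E)%E.
  by apply: (simple_approx Ffilt sepY) => //; rewrite invr_gt0.
have [p Hp] := choice ex.
have sp n : simple_on F t (p n) := (Hp n).1.
have close (e : R) : 0 < e -> exists N, forall n, (N <= n)%N ->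
    (sqd t f (simple_val (p n)) < e%:E)%E.
  move=> e0; exists (Num.truncn e^-1) => n Nn; apply: lt_trans (Hp n).2 _.
  rewrite lte_fin invf_plt ?posrE//.
  by apply: lt_le_trans (truncnS_gt _) _; rewrite ler_nat.
have [mf _] := fi.1.
have [I LI] : exists I, L2_cvg P (fun n => simple_integral b (p n)) I.
  apply: L2_complete => [m|m|m n|e e0].
  - by have [] := simple_integral_L2 W (sp m).
  - by apply/L2norm_fin; have [] := simple_integral_L2 W (sp m).
  - apply: borel_sqr_norm; apply: (borelB sepY);
      exact: (simple_integral_meas Ffilt sepY W (sp _)).
  - have [N HN] := close (e / 5) (divr_gt0 e0 (ltr0n R 5)).
    exists N => m n Nm Nn; rewrite /sqn (simple_isometryB Ffilt sepY W (sp m) (sp n)).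
    have smeas k := simple_val_meas_on Ffilt sepY (sp k).
    apply: (le_lt_trans (sqd_triangle P sepY (smeas m) mf (smeas n))).
    rewrite (sqd_sym t _ f); apply: le_lt_trans (lee_2D (ltW (HN m Nm)) (ltW (HN n Nn))) _.
    by rewrite lte_fin; lra.
exists I; split=> //; exists p; split=> //.
by apply/cvge0P => [n|]; [exact: sqd_ge0|exact: close].
Qed.

(** By the isometry, the integrals of two approximating sequences have the same
    limits. *)
Lemma ito_integral_unique t b f I I' : is_wiener P F b ->
  is_ito_integral P F b t f I -> is_ito_integral P F b t f I' -> I' = I %[ae P].
Proof.
move=> W [[[mf _] _] [p [sp pf pI]]] [_ [q [sq qf qI]]].
suff LI' : L2_cvg P (fun n => simple_integral b (p n)) I' by exact: L2_cvg_unique pI LI'.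
have [pL IL _] := pI; have [qL I'L /L2norm_cvg0 qI'] := qI.
split=> //; apply/L2norm_cvg0; apply/cvge0P => [n|e e0]; first exact: sqn_ge0.
(* The triangle inequality is used twice, so that the coefficients of the three
   distances add up to [4 + 4 + 2 = 10]. *)
have e11 : 0 < e / 11 by rewrite divr_gt0.
have [N1 H1] := (cvge0P (fun n => sqd_ge0 t f (simple_val (p n)))).1 pf _ e11.
have [N2 H2] := (cvge0P (fun n => sqd_ge0 t f (simple_val (q n)))).1 qf _ e11.
have [N3 H3] := (cvge0P (fun n => sqn_ge0 P _)).1 qI' _ e11.
exists (maxn N1 (maxn N2 N3)) => n; rewrite !geq_max => /andP[n1 /andP[n2 n3]].
apply: (le_lt_trans (sqnB_le (pL n).1 (qL n).1 I'L.1)).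
have pq : (sqn (fun w => simple_integral b (p n) w - simple_integral b (q n) w)%R <=
    (2 * (e / 11) + 2 * (e / 11))%:E)%E.
  rewrite /sqn (simple_isometryB Ffilt sepY W (sp n) (sq n)).
  have smp := simple_val_meas_on Ffilt sepY (sp n).
  have smq := simple_val_meas_on Ffilt sepY (sq n).
  apply: (le_trans (sqd_triangle P sepY smp mf smq)); rewrite (sqd_sym t _ f).
  exact: lee_2D (ltW (H1 n n1)) (ltW (H2 n n2)).
apply: le_lt_trans (lee_2D pq (ltW (H3 n n3))) _.
by rewrite lte_fin; lra.
Qed.

Lemma ito_integralP t b f : 0 <= t -> is_wiener P F b -> ito_integrand P F t f ->
  ae_the P (is_ito_integral P F b t f) (ito_integral P F b t f).
Proof.
move=> t0 W fi; have ex := ito_integral_exists t0 W fi.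
have H : is_ito_integral P F b t f (ito_integral P F b t f) by exact: xgetPex.
by split=> // I'; exact: ito_integral_unique.
Qed.

(* The triangle inequality with a factor [2] for each further term is harmless
   for a fixed finite sum. *)
Let sqn_sum_cvg0 (X : nat -> nat -> Omega -> Y) (r : seq nat) :
  (forall j n, borel_wrt (@measurable _ Omega) setT (X j n)) ->
  (forall j, sqn (X j n) @[n --> \oo] --> 0%E) ->
  sqn (fun w => \sum_(j <- r) X j n w)%R @[n --> \oo] --> 0%E.
Proof.
move=> bX cX; elim: r => [|j r ih].
  rewrite (_ : (fun n => _) = cst 0%E); first exact: cvg_cst.
  apply/funext => n; rewrite /sqn (eq_integral (cst 0%E)) ?integral0// => w _.
  by rewrite big_nil normr0 expr0n.
have s0 n := sqn_ge0 P (fun w => \sum_(j <- r) X j n w).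
apply/cvge0P => [n|e e0]; first exact: sqn_ge0.
have e5 : 0 < e / 5 by rewrite divr_gt0.
have [N1 H1] := (cvge0P (fun n => sqn_ge0 P (X j n))).1 (cX j) _ e5.
have [N2 H2] := (cvge0P s0).1 ih _ e5.
exists (maxn N1 N2) => n; rewrite geq_max => /andP[n1 n2].
rewrite (_ : (fun w => _) = (fun w => X j n w + \sum_(i <- r) X i n w)); last first.
  by apply/funext => w; rewrite big_cons.
have bs : borel_wrt (@measurable _ Omega) setT (fun w => \sum_(i <- r) X i n w).
  exact: borel_sum.
apply: (@le_lt_trans _ _ (2%:E * sqn (X j n) + 2%:E * sqn (fun w => \sum_(i <- r) X i n w)%R)%E).
  by apply: sqnD; apply: borel_sqr_norm => //; exact: borelD.
apply: le_lt_trans (lee_2D (ltW (H1 n n1)) (ltW (H2 n n2))) _.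
by rewrite lte_fin; lra.
Qed.

(** A crude form of the Ito isometry, passed to the limit from simple processes:
    the convergence of a series of orthogonal terms only needs its tails to be
    bounded up to a constant factor. The factor [4] comes from applying
    [|x + y| ^ 2 <= 2 * |x| ^ 2 + 2 * |y| ^ 2] to the integrals and again to the
    integrands. *)
Lemma ito_sum_le t (b : nat -> R -> Omega -> R) (f : nat -> R -> Omega -> Y)
    (I : nat -> Omega -> Y) (r : seq nat) :
  uniq r -> (forall j, is_wiener P F (b j)) ->
  (forall i j, i <> j -> covariation P F (b i) (b j) 0) ->
  (forall j, is_ito_integral P F (b j) t (f j) (I j)) ->
  (sqn (fun w => \sum_(j <- r) I j w)%R <=
   4%:E * \sum_(j <- r) E_int P t (fun s w => (`|f j s w| ^+ 2)%:E))%E.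
Proof.
move=> ur W cov HI.
have ex j : exists p : nat -> simple_process,
    [/\ forall n, simple_on F t (p n),
        sqd t (f j) (simple_val (p n)) @[n --> \oo] --> 0%E &
        L2_cvg P (fun n => simple_integral (b j) (p n)) (I j)].
  by have [_ [p Hp]] := HI j; exists p.
have [p Hp] := choice ex.
have sp j n : simple_on F t (p j n) by have [] := Hp j.
have mf j : borel_wrt (@measurable _ TO) (`[0, t] `*` setT) (fun z => f j z.1 z.2).
  by have [[[]]] := HI j.
have bI j : borel_wrt (@measurable _ Omega) setT (I j) by have [_ _ [_ []]] := Hp j.
have bZ j n : borel_wrt (@measurable _ Omega) setT (simple_integral (b j) (p j n)).
  exact: (simple_integral_meas Ffilt sepY (W j) (sp j n)).
set S := (\sum_(j <- r) _)%E.
have small (e : R) : 0 < e -> exists n,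
    (sqn (fun w => \sum_(j <- r) (I j w - simple_integral (b j) (p j n) w))%R < e%:E)%E /\
    (\sum_(j <- r) sqd t (f j) (simple_val (p j n)) < e%:E)%E.
  move=> e0.
  have c1 : sqn (fun w => \sum_(j <- r) (I j w - simple_integral (b j) (p j n) w))%R
      @[n --> \oo] --> 0%E.
    apply: (@sqn_sum_cvg0 (fun j n w => I j w - simple_integral (b j) (p j n) w)) => j.
      by move=> n; exact: borelB.
    under eq_fun do rewrite sqn_sym.
    by have [_ _ [_ _ /L2norm_cvg0]] := Hp j.
  have c2 : (\sum_(j <- r) sqd t (f j) (simple_val (p j n)))%E @[n --> \oo] --> 0%E.
    have := @cvg_nnesum _ \oo _ R _ r (fun j n => sqd t (f j) (simple_val (p j n)))
      (fun=> 0%E) xpredT.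
    rewrite big1_eq; apply=> j _; last by have [] := Hp j.
    by apply: nearW => n; exact: sqd_ge0.
  have [N1 H1] := (cvge0P (fun n => sqn_ge0 P _)).1 c1 e e0.
  have S0 n : (0 <= \sum_(j <- r) sqd t (f j) (simple_val (p j n)))%E.
    by apply: sume_ge0 => j _; exact: sqd_ge0.
  have [N2 H2] := (cvge0P S0).1 c2 e e0.
  exists (maxn N1 N2); split; [exact/H1/leq_maxl|exact/H2/leq_maxr].
apply/lee_addgt0Pr => e e0.
have e6 : 0 < e / 6 by rewrite divr_gt0.
have [n [n1 n2]] := small _ e6.
rewrite (_ : (fun w => _) = (fun w => \sum_(j <- r) (I j w - simple_integral (b j) (p j n) w) +
   \sum_(j <- r) simple_integral (b j) (p j n) w)); last first.
  by apply/funext => w; rewrite sumrB subrK.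
have bZs : borel_wrt (@measurable _ Omega) setT
    (fun w => \sum_(j <- r) simple_integral (b j) (p j n) w) by exact: borel_sum.
have bDs : borel_wrt (@measurable _ Omega) setT
    (fun w => \sum_(j <- r) (I j w - simple_integral (b j) (p j n) w)).
  by apply: borel_sum => // j; exact: borelB.
apply: (@le_trans _ _
  (2%:E * sqn (fun w => \sum_(j <- r) (I j w - simple_integral (b j) (p j n) w))%R +
   2%:E * sqn (fun w => \sum_(j <- r) simple_integral (b j) (p j n) w)%R)%E).
  by apply: sqnD; apply: borel_sqr_norm => //; exact: borelD.
have H j : (E_int P t (fun s w => (`|simple_val (p j n) s w| ^+ 2)%:E) <=
    2%:E * sqd t (f j) (simple_val (p j n)) + 2%:E * E_int P t (fun s w => (`|f j s w| ^+ 2)%:E))%E.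
  have sm := simple_val_meas_on Ffilt sepY (sp j n).
  have m0 : borel_wrt (@measurable _ TO) (`[0, t] `*` setT) (fun _ => (0 : Y)).
    by apply: borel_cst; apply: measurableX => //; exact: measurable_itv.
  have := @sqd_triangle _ _ _ P _ sepY t (simple_val (p j n)) (f j) (fun _ _ => 0) sm (mf j) m0.
  have E1 (h : R -> Omega -> Y) :
      sqd t h (fun _ _ => 0) = E_int P t (fun s w => (`|h s w| ^+ 2)%:E).
    by apply: eq_E_int => s w _; rewrite subr0.
  by rewrite (E1 (simple_val (p j n))) (E1 (f j)) (sqd_sym t _ (f j)).
rewrite {2}/sqn (simple_isometry_sum Ffilt sepY ur W cov (fun j => sp j n)).
have HS : (\sum_(j <- r) E_int P t (fun s w => (`|simple_val (p j n) s w| ^+ 2)%:E) <=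
    2%:E * (e / 6)%:E + 2%:E * S)%E.
  apply: (@le_trans _ _ (\sum_(j <- r) (2%:E * sqd t (f j) (simple_val (p j n)) +
      2%:E * E_int P t (fun s w => (`|f j s w| ^+ 2)%:E)))%E).
    by apply: lee_sum => j _; exact: H.
  have E0 j : (0 <= E_int P t (fun s w => (`|f j s w| ^+ 2)%:E))%E.
    by apply: integral_ge0 => w _; apply: integral_ge0 => s _; rewrite lee_fin sqr_ge0.
  rewrite big_split /= -!ge0_sume_distrr//; last by move=> j _; exact: sqd_ge0.
  by apply: leeD => //; rewrite lee_pmul2l// ltW.
apply: (@le_trans _ _ (2%:E * (e / 6)%:E + 2%:E * (2%:E * (e / 6)%:E + 2%:E * S))%E).
  by apply: leeD; rewrite lee_pmul2l// ltW.
have S0 : (0 <= S)%E.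
  by apply: sume_ge0 => j _; apply: integral_ge0 => w _; apply: integral_ge0 => s _;
    rewrite lee_fin sqr_ge0.
rewrite ge0_muleDr ?mule_ge0 ?lee_fin ?(ltW e6)// !muleA -!EFinM addeA -EFinD addeC.
rewrite (_ : 2 * 2 = 4 :> R); last by lra.
by rewrite leeD2l// lee_fin; lra.
Qed.

End ito_theory.

(** * Orthogonal series and the Wiener series *)

Section orthogonal_series.
Context {R : realType} {d : measure_display} {Omega : measurableType d}.
Variables (P : probability Omega R).
Context {Y : hilbertType R}.
Local Notation sqn := (sqn P).

(** The bound over all finite families, and not only over initial segments,
    applies to the differences of partial sums. *)
Lemma series_cauchy (I : nat -> Omega -> Y) (a : nat -> \bar R) (c : R) : 0 <= c ->
  (forall j, 0 <= a j)%E -> (\sum_(0 <= j <oo) a j < +oo)%E ->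
  (forall r : seq nat, uniq r ->
     (sqn (fun w => \sum_(j <- r) I j w)%R <= c%:E * \sum_(j <- r) a j)%E) ->
  let Z m w := \sum_(j < m) I j w in
  (forall m, sqn (Z m) < +oo)%E /\
  (forall e : R, 0 < e -> exists N, forall m n, (N <= m)%N -> (N <= n)%N ->
    (sqn (fun w => Z m w - Z n w)%R < e%:E)%E).
Proof.
move=> c0 a0 fa Ia Z; split=> [m|e e0].
  have -> : sqn (Z m) = sqn (fun w => \sum_(j <- index_iota 0 m) I j w).
    by apply: eq_integral => w _; rewrite /Z big_mkord.
  apply: (le_lt_trans (Ia _ (iota_uniq _ _))); apply: lte_mul_pinfty => //.
  by apply: le_lt_trans fa; exact: nneseries_lim_ge.
have tail0 N : (0 <= \sum_(N <= k <oo) a k)%E by apply: nneseries_ge0.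
have ec0 : 0 < e / (c + 1) by rewrite divr_gt0// ltr_wpDl.
have [N HN] := (cvge0P tail0).1 (nneseries_tail_cvg fa (fun k _ => a0 k)) _ ec0.
have key m n : (N <= n)%N -> (n <= m)%N -> (sqn (fun w => Z m w - Z n w)%R < e%:E)%E.
  move=> Nn nm.
  have -> : sqn (fun w => Z m w - Z n w) = sqn (fun w => \sum_(j <- index_iota n m) I j w).
    apply: eq_integral => w _; rewrite /Z -!(big_mkord xpredT (fun j => I j w)).
    by rewrite (big_cat_nat (leq0n n) nm) /= addrAC subrr add0r.
  apply: (le_lt_trans (Ia _ (iota_uniq _ _))).
  apply: (@le_lt_trans _ _ (c%:E * (e / (c + 1))%:E)%E).
    apply: lee_wpmul2l; first by rewrite lee_fin.
    by apply: le_trans (ltW (HN n Nn)); exact: nneseries_lim_ge.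
  by rewrite -EFinM lte_fin mulrCA gtr_pMr// ltr_pdivrMr ?mul1r ?ltrDl// ltr_wpDl.
exists N => m n Nm Nn; have [nm|mn] := leqP n m; first exact: key.
by rewrite sqn_sym; apply: key => //; exact: ltnW.
Qed.

End orthogonal_series.

Section wiener_series.
Context {R : realType} {d : measure_display} {Omega : measurableType d}.
Variables (P : probability Omega R) (F : R -> set (set Omega)).
Hypothesis Ffilt : is_filtration F.
Variable b : nat -> R -> Omega -> R.
Hypothesis bwiener : forall j, is_wiener P F (b j).
Hypothesis bindep : independent_processes P b.

(** The independence of a finite family contains that of a pair when the other
    events are the whole space. *)
Lemma independent_family_pair i j (A B : set Omega) : i <> j ->
  process_sigma_algebra (b i) A -> process_sigma_algebra (b j) B ->
  P (A `&` B) = (P A * P B)%E.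
Proof.
move=> /eqP ij Ai Bj.
pose C k := if k == i then A else if k == j then B else setT.
have GC k : process_sigma_algebra (b k) (C k).
  rewrite /C; case: eqVneq => [->//|_]; case: eqVneq => [->//|_].
  exact: (@measurableT _ (g_sigma_algebraType _)).
have := bindep (maxn i j).+1 GC.
have -> : \bigcap_(k in `I_(maxn i j).+1) C k = A `&` B.
  apply/seteqP; split=> [w H|w [Aw Bw] k _].
    split; first by have := H i; rewrite /C eqxx; apply; rewrite /= ltnS leq_maxl.
    have := H j; rewrite /C eqxx eq_sym (negbTE ij); apply.
    by rewrite /= ltnS leq_maxr.
  by rewrite /C; case: eqP => // _; case: eqP.
move=> ->.
have iM : (i < (maxn i j).+1)%N by rewrite ltnS leq_maxl.
have jM : (j < (maxn i j).+1)%N by rewrite ltnS leq_maxr.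
rewrite (bigD1 (Ordinal iM))//= (bigD1 (Ordinal jM))/=; last first.
  by apply/eqP => -[] /eqP; rewrite eq_sym (negbTE ij).
rewrite /C eqxx eq_sym (negbTE ij) eqxx big1 ?mule1// => k /andP[ki kj].
by rewrite !ifN ?probability_setT.
Qed.

Lemma covariation_neq i j : i <> j -> covariation P F (b i) (b j) 0.
Proof.
move=> ij; apply: (covariation_indep Ffilt) => // A B.
exact: independent_family_pair.
Qed.

Context {V : hilbertType R}.

Lemma wiener_sum_sqn (c : nat -> V) (t : R) (r : seq nat) : 0 <= t -> uniq r ->
  sqn P (fun w => \sum_(j <- r) b j t w *: c j) =
  (t%:E * \sum_(j <- r) (`|c j| ^+ 2)%:E)%E.
Proof.
move=> t0 ur.
have bm j : measurable_fun setT (b j t).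
  have [_ _ bF _ _] := bwiener j.
  exact: (adapted_at_meas Ffilt t0 (adapted_atE Ffilt t0 (bF _ t0))).
have im j : measurable_fun setT (incr (b j) 0 t) by exact: (incr_meas Ffilt (bwiener j)).
have sqE (x : nat -> Omega -> R) w : `|\sum_(j <- r) x j w *: c j| ^+ 2 =
    \sum_(i <- r) \sum_(j <- r) inner (c i) (c j) * (x i w * x j w).
  rewrite sqr_norm_sum; apply: eq_bigr => i _; apply: eq_bigr => j _.
  by rewrite innerZl innerZr; ring.
have mq (x : nat -> Omega -> R) : (forall j, measurable_fun setT (x j)) ->
    measurable_fun setT (fun w => (`|\sum_(j <- r) x j w *: c j| ^+ 2)%:E).
  move=> mx; apply/measurable_EFinP; under eq_fun do rewrite sqE.
  apply: measurable_sum => i; apply: measurable_sum => j.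
  by apply: measurable_funM => //; exact: measurable_funM.
(* Almost surely the processes start at [0], so the values are increments. *)
have -> : sqn P (fun w => \sum_(j <- r) b j t w *: c j) =
    sqn P (fun w => \sum_(j <- r) incr (b j) 0 t w *: c j).
  apply: ge0_ae_eq_integral => //; try exact: mq.
  have : {ae P, forall w, forall j, b j 0 w = 0}.
    by apply/ae_foralln => j; have [] := bwiener j.
  apply: filterS => w H _; congr (EFin (`|_| ^+ 2)); apply: eq_bigr => j _.
  by rewrite /incr H subr0.
have cov i j : rintegrable P (fun w => incr (b i) 0 t w * incr (b j) 0 t w) /\
    \int[P]_w (incr (b i) 0 t w * incr (b j) 0 t w) = (i == j)%:R * t.
  split.
    apply: rintegrableM_sqr => //; exact: (incr_sqr Ffilt (bwiener _) (lexx 0) t0).1.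
  have ci : covariation P F (b i) (b j) (i == j)%:R.
    by have [->|/eqP/covariation_neq//] := eqVneq i j; exact: covariation_self.
  have := ci 0 t 1 (fun=> 1) (lexx 0) t0 (measurable_cst _) (fun _ => _).
  rewrite rintegral_cst mulr1 subr0 normr1 => /(_ (fun=> lexx _)) <-.
  by apply: eq_Rintegral => w _; rewrite mul1r.
rewrite /sqn; under eq_integral do rewrite (sqE (fun j => incr (b j) 0 t)).
have is' i : rintegrable P (fun w => \sum_(j <- r)
    inner (c i) (c j) * (incr (b i) 0 t w * incr (b j) 0 t w)).
  by apply: rintegrable_sum => j; apply: rintegrableZ; exact: (cov i j).1.
rewrite rintegral_EFin; last exact: rintegrable_sum.
rewrite sumEFin -EFinM; congr EFin; rewrite rintegral_sum// mulr_sumr.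
apply: eq_big_seq => i ir; rewrite rintegral_sum => [|j]; last first.
  by apply: rintegrableZ; exact: (cov i j).1.
rewrite (bigD1_seq i)//= (rintegralZ _ (cov i i).1) (cov i i).2 eqxx mul1r.
rewrite big1 ?addr0 => [|j ji]; first by rewrite inner_norm mulrC.
by rewrite (rintegralZ _ (cov i j).1) (cov i j).2 eq_sym (negbTE ji) mul0r mulr0.
Qed.

(** The partial sums are the images under [iota] of sums in [U]. They are Borel
    because [U] is separable, whatever the size of [V]. *)
Lemma wiener_series_cvg (U : hilbertType R) (iota : {linear U -> V}) (g : nat -> U) (t : R) :
  separable_space U -> continuous iota -> 0 <= t ->
  (\sum_(0 <= j <oo) (`|iota (g j)| ^+ 2)%:E < +oo)%E ->
  exists W, L2_cvg P (wiener_partial_sum (iota \o g) b t) W.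
Proof.
move=> sepU ci t0 fg.
have bm j : measurable_fun setT (b j t).
  have [_ _ bF _ _] := bwiener j.
  exact: (adapted_at_meas Ffilt t0 (adapted_atE Ffilt t0 (bF _ t0))).
have [fZ cZ] := @series_cauchy _ _ _ P _ (fun j w => b j t w *: iota (g j))
  (fun j => (`|iota (g j)| ^+ 2)%:E) t t0 (fun j => ltac:(by rewrite lee_fin sqr_ge0)) fg
  (fun r ur => ltac:(by rewrite (wiener_sum_sqn _ t0 ur))).
have bU m : borel_wrt (@measurable _ Omega) setT (fun w => \sum_(j < m) b j t w *: g j).
  by apply: (borel_sum sepU) => // j; apply: (borelZ sepU) => //; exact: borel_cst.
have ZE m w : wiener_partial_sum (iota \o g) b t m w = iota (\sum_(j < m) b j t w *: g j).
  by rewrite linear_sum; apply: eq_bigr => j _; rewrite linearZ.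
apply: L2_complete => // [m|m n].
- by rewrite (funext (ZE m)); exact: borel_cont (bU m).
- apply: borel_sqr_norm; under eq_fun do rewrite !ZE -linearB.
  by apply: (borel_cont ci); exact: (borelB sepU (bU m) (bU n)).
Qed.

End wiener_series.

(** * Series and restrictions of adapted processes *)

Section measurable_adapted_processes.
Context {R : realType} {d : measure_display} {Omega : measurableType d}.
Variables (P : probability Omega R) (F : R -> set (set Omega)).
Context {Y : hilbertType R}.
Local Notation TO := (measurableTypeR R * Omega)%type.
Implicit Types (f : R -> Omega -> Y).

Lemma measurable_adapted_ext (t : R) f f' :
  (forall s w, 0 <= s <= t -> f s w = f' s w) ->
  measurable_adapted F t f -> measurable_adapted F t f'.
Proof.
move=> ff [mf af]; split=> [B oB|s st].
  rewrite (_ : _ `&` _ = (`[0, t] `*` setT) `&` (fun z : TO => f z.1 z.2) @^-1` B).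
    exact: mf.
  have zE (z : TO) : (`[0, t] `*` setT) z -> f z.1 z.2 = f' z.1 z.2.
    by move=> [+ _]; rewrite /= in_itv /= => zt; exact: ff.
  by apply/seteqP; split=> z [zt zO]; split=> //; move: zO; rewrite /preimage /= zE.
by rewrite (_ : f' s = f s); [exact: af|apply/funext => w; rewrite ff].
Qed.

Lemma is_ito_integral_ext (b : R -> Omega -> R) (t : R) f f' :
  (forall s w, 0 <= s <= t -> f s w = f' s w) ->
  is_ito_integral P F b t f `<=` is_ito_integral P F b t f'.
Proof.
move=> ff I [[mf fi] [p [sp pf pI]]]; split.
  split; first exact: measurable_adapted_ext mf.
  by rewrite (eq_E_int P (h' := fun s w => (`|f s w| ^+ 2)%:E))// => s w st; rewrite ff.
have E n : E_int P t (fun s w => (`|f' s w - simple_val (p n) s w| ^+ 2)%:E) =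
    E_int P t (fun s w => (`|f s w - simple_val (p n) s w| ^+ 2)%:E).
  by apply: eq_E_int => s w /ff ->.
by exists p; split; [exact: sp|rewrite (funext E); exact: pf|exact: pI].
Qed.

(** The two sets of versions are equal, so that the choice operator selects the
    same version: the integrals agree everywhere and not only almost surely. *)
Lemma ito_integral_ext (b : R -> Omega -> R) (t : R) f f' :
  (forall s w, 0 <= s <= t -> f s w = f' s w) ->
  ito_integral P F b t f = ito_integral P F b t f'.
Proof.
move=> ff; have E : is_ito_integral P F b t f = is_ito_integral P F b t f'.
  rewrite eqEsubset; split; apply: is_ito_integral_ext; first exact: ff.
  by move=> s w /ff.
by rewrite /ito_integral E.
Qed.

Lemma measurable_adapted_le (t T : R) f : t <= T ->
  measurable_adapted F T f -> measurable_adapted F t f.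
Proof.
move=> tT [mf af]; split=> [B oB|s /andP[s0 st]]; last first.
  by apply: af; rewrite s0 (le_trans st).
have mt : measurable ((`[0, t] `*` setT) : set TO).
  by apply: measurableX => //; exact: measurable_itv.
have := measurableI _ _ mt (mf B oB); rewrite setIA (_ : _ `&` (_ `*` _) = `[0, t] `*` setT)//.
apply/setIidl => z [/=]; rewrite !in_itv /= => /andP[-> zt] _.
by rewrite (le_trans zt).
Qed.

Lemma extend0_sqr_meas (T : R) f : measurable_adapted F T f ->
  measurable_fun setT (fun z : TO => (`|extend0 T f z.1 z.2| ^+ 2)%:E).
Proof.
by move=> [mf _]; apply/measurable_EFinP; apply: borel_sqr_norm; exact: extend0_meas.
Qed.

(** Outside [[0, T]] the process is replaced by [0], so that both integrals are
    those of one jointly measurable function. *)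
Lemma E_int_sqr_le (t T : R) f : t <= T -> measurable_adapted F T f ->
  (E_int P t (fun s w => (`|f s w| ^+ 2)%:E) <= E_int P T (fun s w => (`|f s w| ^+ 2)%:E))%E.
Proof.
move=> tT af; have mX := extend0_sqr_meas af.
have nn (y : Y) : (0 <= (`|y| ^+ 2)%:E :> \bar R)%E by rewrite lee_fin sqr_ge0.
rewrite (eq_E_int P (h' := fun s w => (`|extend0 T f s w| ^+ 2)%:E)); last first.
  by move=> s w /andP[s0 st]; rewrite /extend0 s0 (le_trans st).
rewrite [leRHS](eq_E_int P (h' := fun s w => (`|extend0 T f s w| ^+ 2)%:E)); last first.
  by move=> s w st; rewrite /extend0 st.
apply: ge0_le_integral => //.
- by move=> w _; exact: integral_ge0.
- exact: measurable_time_integral.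
- exact: measurable_time_integral.
- move=> w _; apply: ge0_subset_integral => //.
  + apply: measurable_funTS.
    exact: (measurable_time_section (h := fun s w => (`|extend0 T f s w| ^+ 2)%:E)).
  + by move=> s /=; rewrite !in_itv /= => /andP[-> /le_trans]; apply.
Qed.

Lemma E_int_series (T : R) (f : nat -> R -> Omega -> Y) :
  (forall j, measurable_adapted F T (f j)) ->
  E_int P T (fun s w => \sum_(0 <= j <oo) (`|f j s w| ^+ 2)%:E)%E =
  (\sum_(0 <= j <oo) E_int P T (fun s w => (`|f j s w| ^+ 2)%:E))%E.
Proof.
move=> af; pose h j s w := (`|extend0 T (f j) s w| ^+ 2)%:E : \bar R.
have mh j : measurable_fun setT (fun z : TO => h j z.1 z.2) by exact: extend0_sqr_meas.
have h0 j s w : (0 <= h j s w)%E by rewrite lee_fin sqr_ge0.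
transitivity (E_int P T (fun s w => \sum_(0 <= j <oo) h j s w)%E).
  by apply: eq_E_int => s w st; apply: eq_eseriesr => j _; rewrite /h /extend0 st.
transitivity (\sum_(0 <= j <oo) E_int P T (h j))%E; last first.
  by apply: eq_eseriesr => j _; apply: eq_E_int => s w st; rewrite /h /extend0 st.
rewrite /E_int -integral_nneseries//.
- apply: eq_integral => w _; apply: integral_nneseries => //.
  by move=> j; apply: measurable_funTS; exact: measurable_time_section (mh j).
- by move=> j; exact: measurable_time_integral.
- by move=> j w _; exact: integral_ge0.
Qed.

End measurable_adapted_processes.

(** * Dependence on the embedding *)

Section embedding.
Context {R : realType} {d : measure_display} {Omega : measurableType d}.
Variables (P : probability Omega R) (F : R -> set (set Omega)).
Context {U V Y : hilbertType R}.
Variables (K : {linear U -> U}) (iota : {linear U -> V}).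
Hypotheses (Kinj : injective K) (iinj : injective iota).
Variable g : nat -> U.
Hypothesis gK : forall j, range K (g j).

Let range_iota v : range (iota \o K) v <-> exists2 u, range K u & v = iota u.
Proof.
split=> [[x _ <-]|[_ [x _ <-] ->]]; last by exists x.
by exists (K x) => //; exists x.
Qed.

Let im_norm_iota u : range K u -> im_norm (iota \o K) (iota u) = im_norm K u.
Proof.
move=> [x _ <-]; rewrite /im_norm /im_inv; congr (`|_|).
rewrite (pinvKV _ (f := K)) ?inE//; last by move=> a c _ _; exact: Kinj.
rewrite -[iota (K x)]/((iota \o K) x) (pinvKV _ (f := iota \o K)) ?inE//.
by move=> a c _ _ /iinj/Kinj.
Qed.

(** Since [iota \o K] is injective, a vector and its image under [iota] have the
    same preimage in the source of [K], hence the same norm. *)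
Lemma hilbert_schmidt_embedding (psi : U -> Y) (psi1 : V -> Y) :
  (forall u, range K u -> psi1 (iota u) = psi u) ->
  hilbert_schmidt (iota \o K) (iota \o g) psi1 <-> hilbert_schmidt K g psi.
Proof.
move=> psiE.
have hsE : hs_norm2 (iota \o g) psi1 = hs_norm2 g psi.
  by apply: eq_eseriesr => j _; rewrite /= psiE.
have lin a u v : range K u -> range K v -> range K (a *: u + v).
  by move=> [x _ <-] [y _ <-]; exists (a *: x + y) => //; rewrite linearP.
rewrite /hilbert_schmidt hsE; split=> -[[psil [C psiC]] fin]; split=> //; split.
- move=> a u v ru rv; rewrite -!psiE//; last exact: lin.
  by rewrite linearP psil//; apply/range_iota; [exists u|exists v].
- exists C => v rv; rewrite -psiE// -(im_norm_iota rv).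
  by apply: psiC; apply/range_iota; exists v.
- move=> a _ _ /range_iota[u ru ->] /range_iota[v rv ->].
  by rewrite -linearP !psiE ?psil//; exact: lin.
- by exists C => _ /range_iota[v rv ->]; rewrite psiE// im_norm_iota// psiC.
Qed.

Lemma N_class_embedding (T : R) (Phi : R -> Omega -> U -> Y) (Phi1 : R -> Omega -> V -> Y) :
  (forall s w u, 0 <= s <= T -> range K u -> Phi1 s w (iota u) = Phi s w u) ->
  N_class P (iota \o K) (iota \o g) F T Phi1 <-> N_class P K g F T Phi.
Proof.
move=> PhiE.
have hsE s w : 0 <= s <= T ->
    hilbert_schmidt (iota \o K) (iota \o g) (Phi1 s w) <-> hilbert_schmidt K g (Phi s w).
  by move=> st; apply: hilbert_schmidt_embedding => u ru; exact: PhiE.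
have EE : E_int P T (fun s w => hs_norm2 (iota \o g) (Phi1 s w)) =
    E_int P T (fun s w => hs_norm2 g (Phi s w)).
  by apply: eq_E_int => s w st; apply: eq_eseriesr => j _; rewrite /= PhiE.
rewrite /N_class EE; split=> -[H1 H2 H3]; (split; [|exact: H2|]).
- by move=> s w st; apply/(hsE s w st); exact: H1.
- move=> u ru; apply: (measurable_adapted_ext (f := fun s w => Phi1 s w (iota u))).
    by move=> s w st; rewrite PhiE.
  by apply: H3; apply/range_iota; exists u.
- by move=> s w st; apply/(hsE s w st); exact: H1.
- move=> _ /range_iota[u ru ->].
  apply: (measurable_adapted_ext (f := fun s w => Phi s w u)); last exact: H3.
  by move=> s w st; rewrite PhiE.
Qed.

Lemma stoch_integral_embedding (b : nat -> R -> Omega -> R) (t T : R)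
    (Phi : R -> Omega -> U -> Y) (Phi1 : R -> Omega -> V -> Y) : t <= T ->
  (forall s w u, 0 <= s <= T -> range K u -> Phi1 s w (iota u) = Phi s w u) ->
  stoch_integral P (iota \o g) F b t Phi1 = stoch_integral P g F b t Phi.
Proof.
move=> tT PhiE.
have E j : ito_integral P F (b j) t (fun s w => Phi1 s w ((iota \o g) j)) =
    ito_integral P F (b j) t (fun s w => Phi s w (g j)).
  apply: ito_integral_ext => s w /andP[s0 st].
  apply: PhiE; last exact: gK.
  by rewrite s0 (le_trans st).
have -> : stoch_integral P (iota \o g) F b t Phi1 =
    xget (cst 0) (L2_cvg P (ito_partial_sum P g F b t Phi)); last by [].
rewrite /stoch_integral.
have -> : ito_partial_sum P (iota \o g) F b t Phi1 = ito_partial_sum P g F b t Phi; last by [].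
by apply/funext => m; apply/funext => w; apply: eq_bigr => j _; rewrite E.
Qed.

End embedding.

(** A zero of [K] is a zero of [Q = K \o K]. *)
Lemma op_sqrt_injective (R : realType) (U : hilbertType R) (Q K : {linear U -> U}) :
  strictly_positive Q -> is_op_sqrt Q K -> injective K.
Proof.
move=> [_ Qpos] [_ _ _ KK] x y /eqP; rewrite -subr_eq0 -linearB => /eqP Kxy.
apply/eqP; rewrite -subr_eq0; apply: contraT => /Qpos.
by rewrite -KK Kxy linear0 eqxx.
Qed.

(** * The stochastic integral *)

Section stochastic_integral.
Context {R : realType} {d : measure_display} {Omega : measurableType d}.
Variables (P : probability Omega R) (F : R -> set (set Omega)).
Hypothesis Ffilt : is_filtration F.
Context {U Y : hilbertType R} (sepY : separable_space Y).
Variables (K : U -> U) (g : nat -> U).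
Hypothesis gK : forall j, range K (g j).
Variable b : nat -> R -> Omega -> R.
Hypothesis bwiener : forall j, is_wiener P F (b j).
Hypothesis bindep : independent_processes P b.
Variables (T : R) (Phi : R -> Omega -> U -> Y).
Hypothesis PhiN : N_class P K g F T Phi.
Local Notation A t j := (E_int P t (fun s w => (`|Phi s w (g j)| ^+ 2)%:E)).

Let adapt j : measurable_adapted F T (fun s w => Phi s w (g j)).
Proof. by have [_ _] := PhiN; apply. Qed.

Let A0 t j : (0 <= A t j)%E.
Proof.
by apply: integral_ge0 => w _; apply: integral_ge0 => s _; rewrite lee_fin sqr_ge0.
Qed.

Let A_sum : (\sum_(0 <= j <oo) A T j < +oo)%E.
Proof.
have [_ fin _] := PhiN.
by rewrite -(E_int_series P adapt).
Qed.

Lemma N_class_integrand t j : t <= T -> ito_integrand P F t (fun s w => Phi s w (g j)).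
Proof.
move=> tT; split; first exact: measurable_adapted_le (adapt j).
apply: (le_lt_trans (E_int_sqr_le P tT (adapt j))); apply: le_lt_trans A_sum.
apply: le_trans (nneseries_lim_ge j.+1 _) => //.
by rewrite big_nat_recr//= leeDr// sume_ge0.
Qed.

Variable t : R.
Hypotheses (t0 : 0 <= t) (tT : t <= T).

Let I j := ito_integral P F (b j) t (fun s w => Phi s w (g j)).

Let IP j : ae_the P (is_ito_integral P F (b j) t (fun s w => Phi s w (g j))) (I j).
Proof. by apply: ito_integralP => //; exact: N_class_integrand. Qed.

Let I_borel j : borel_wrt (@measurable _ Omega) setT (I j).
Proof. by have [[_ [p [_ _ [_ [bI _] _]]]] _] := IP j. Qed.

Let sum_borel m : borel_wrt (@measurable _ Omega) setT (ito_partial_sum P g F b t Phi m).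
Proof. by apply: (borel_sum sepY) => // j; exact: I_borel. Qed.

Let sums : (forall m, sqn P (ito_partial_sum P g F b t Phi m) < +oo)%E /\
  (forall e : R, 0 < e -> exists N, forall m n, (N <= m)%N -> (N <= n)%N ->
    (sqn P (fun w => ito_partial_sum P g F b t Phi m w -
      ito_partial_sum P g F b t Phi n w)%R < e%:E)%E).
Proof.
apply: (@series_cauchy _ _ _ P _ I (fun j => A T j) 4) => // r ur.
apply: (le_trans (ito_sum_le Ffilt sepY ur bwiener
  (covariation_neq Ffilt bwiener bindep) (fun j => (IP j).1))).
apply: lee_wpmul2l; first by rewrite lee_fin.
by apply: lee_sum => j _; exact: E_int_sqr_le.
Qed.

Lemma ito_partial_sum_cauchy : L2_cauchy P (ito_partial_sum P g F b t Phi).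
Proof.
split=> [m|e e0]; first by split; [exact: sum_borel|exact/L2norm_fin/sums.1].
have [N HN] := sums.2 _ (exprn_gt0 2 e0).
by exists N => m n Nm Nn; apply/(L2norm_lt _ _ e0); exact: HN.
Qed.

Lemma stoch_integralP : ae_the P (L2_cvg P (ito_partial_sum P g F b t Phi))
  (stoch_integral P g F b t Phi).
Proof.
have ex : exists X, L2_cvg P (ito_partial_sum P g F b t Phi) X.
  apply: L2_complete sum_borel sums.1 _ sums.2 => m n.
  by apply: borel_sqr_norm; exact: (borelB sepY).
have H : L2_cvg P (ito_partial_sum P g F b t Phi) (stoch_integral P g F b t Phi).
  exact: xgetPex.
by split=> // X'; exact: L2_cvg_unique.
Qed.

End stochastic_integral.

Unset Implicit Arguments.

Theorem mainTheorem1
  (R : realType) (U Y : hilbertType R)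
  (sepU : separable_space U) (sepY : separable_space Y)
  (Q : {linear U -> U}) (Qcont : continuous Q)
  (Qsa : self_adjoint Q) (Qpos : strictly_positive Q)
  (Qh : {linear U -> U}) (QhE : is_op_sqrt Q Qh)
  (g : nat -> U) (gbasis : im_basis Qh g)
  (d : measure_display) (Omega : measurableType d) (P : probability Omega R)
  (F : R -> set (set Omega)) (Ffilt : is_filtration F)
  (b : nat -> R -> Omega -> R)
  (bwiener : forall j, is_wiener P F (b j))
  (bindep : independent_processes P b)
  (T : R) (T_gt0 : 0 < T) :
  (forall Phi : R -> Omega -> U -> Y, N_class P Qh g F T Phi ->
   forall t, 0 <= t <= T ->
   [/\ forall j, ae_the P
         (is_ito_integral P F (b j) t (fun s w => Phi s w (g j)))
         (ito_integral P F (b j) t (fun s w => Phi s w (g j))),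
       L2_cauchy P (ito_partial_sum P g F b t Phi) &
       ae_the P (L2_cvg P (ito_partial_sum P g F b t Phi))
         (stoch_integral P g F b t Phi)])
  /\
  (forall (U1 : hilbertType R) (iota : {linear U -> U1}),
   continuous iota -> injective iota -> hilbert_schmidt Qh g iota ->
   (forall t, 0 <= t -> exists W : Omega -> U1,
      L2_cvg P (wiener_partial_sum (iota \o g) b t) W) /\
   forall (Phi : R -> Omega -> U -> Y) (Phi1 : R -> Omega -> U1 -> Y),
   (forall s w u, 0 <= s <= T -> range Qh u -> Phi1 s w (iota u) = Phi s w u) ->
   (N_class P (iota \o Qh) (iota \o g) F T Phi1 <-> N_class P Qh g F T Phi) /\
   (N_class P Qh g F T Phi -> forall t, 0 <= t <= T ->
      stoch_integral P (iota \o g) F b t Phi1 =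
      stoch_integral P g F b t Phi %[ae P])).
Proof.
have [gQ _ _] := gbasis.
have Qinj := op_sqrt_injective Qpos QhE.
split=> [Phi PhiN t /andP[t0 tT]|U1 iota ciota iinj [_ hs]]; split.
- move=> j; apply: (ito_integralP Ffilt sepY) => //.
  exact: (N_class_integrand gQ PhiN).
- exact: (ito_partial_sum_cauchy Ffilt sepY gQ bwiener bindep PhiN).
- exact: (stoch_integralP Ffilt sepY gQ bwiener bindep PhiN).
- by move=> t t0; exact: (wiener_series_cvg Ffilt bwiener bindep sepU ciota t0 hs).
- move=> Phi Phi1 PhiE; split; first exact: N_class_embedding.
  move=> _ t /andP[t0 tT]; apply: aeW => w _.
  by rewrite (stoch_integral_embedding P F gQ b tT PhiE).
Qed.
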